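(* Let $M=(M_n)_{n\in\mathbb{N}}$ be the sequence $$M_n := \frac{1}{(\log\log 3)^{3}}\cdot\bigl(\log\log(n+3)\bigr)^{n+3},\qquad n\in\mathbb{N},$$ and let $\mathbb{R}_{\mathcal{Q}_M}$ be the expansion of the real field by restricted $\mathcal{Q}_M$-analytic functions. Then $\mathbb{R}_{\mathcal{Q}_M}$ does not admit quantifier elimination in the language of restricted $\mathcal{Q}_M$-analytic functions augmented by the reciprocal function $1/x$. More precisely, there is a plane curve $V\subset\mathbb{R}^2$ through $0\in\mathbb{R}^2$, namely the graph of some function $f\in\mathcal{Q}([0,\varepsilon],M)$ with $\varepsilon>0$, which is definable in $\mathbb{R}_{\mathcal{Q}_M}$ but is not definable by any quantifier-free formula of this language.
   Context: Here $\mathbb{N}=\{0,1,2,\dots\}$. Denjoy--Carleman class: for an open set $U\subset\mathbb{R}^m$, $\mathcal{Q}_M(U)$ is the set of smooth functions $f:U\to\mathbb{R}$ such that every point of $U$ has a neighbourhood $W\subset U$ and constants $C,R>0$ with $|\partial^{|\alpha|}f/\partial x^\alpha(x)|\le C\,R^{|\alpha|}\,|\alpha|!\,M_{|\alpha|}$ for all $\alpha\in\mathbb{N}^m$, $x\in W$. Functions in $\mathcal{Q}_M(U)$ are called $\mathcal{Q}_M$-analytic. For an interval $I\subset\mathbb{R}$, $\mathcal{Q}(I,M)$ is the set of smooth functions $f:I\to\mathbb{R}$ (with one-sided derivatives at endpoints belonging to $I$) for which there are constants $C,R>0$ with $|f^{(n)}(x)|\le C R^n n! M_n$ for all $n\in\mathbb{N}$,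 $x\in I$. A restricted $\mathcal{Q}_M$-analytic function is a function $\mathbb{R}^m\to\mathbb{R}$, $m\in\mathbb{N}$, which coincides on the cube $[-1,1]^m$ with a function that is $\mathcal{Q}_M$-analytic in a neighbourhood of $[-1,1]^m$ and is equal to $0$ outside $[-1,1]^m$. The language in question is the language of ordered rings $(+,-,\cdot,0,1,<)$ together with a function symbol for each restricted $\mathcal{Q}_M$-analytic function (for all $m$) and a unary function symbol for the reciprocal $x\mapsto 1/x$ (with the convention $1/0:=0$). Definable means definable with real parameters. A structure admits quantifier elimination in a language if every formula of the language is equivalent in the structure to a quantifier-free one. *)

(* Defs.v *)
From mathcomp Require Import all_boot all_order all_algebra.
From mathcomp Require Import all_classical all_reals all_analysis.

Set Implicit Arguments.
Unset Strict Implicit.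
Unset Printing Implicit Defensive.

Import Order.TTheory GRing.Theory Num.Theory.
Import numFieldNormedType.Exports.

Local Open Scope classical_set_scope.
Local Open Scope ring_scope.

Record signature := Signature {
  fsym : nat -> Type;
  rsym : nat -> Type }.

Record structure (L : signature) := Structure {
  carrier :> Type;
  finterp : forall m, fsym L m -> ('I_m -> carrier) -> carrier;
  rinterp : forall m, rsym L m -> ('I_m -> carrier) -> Prop }.

Inductive term (L : signature) (n : nat) : Type :=
| Var of 'I_n
| App m of fsym L m & ('I_m -> term L n).

(* [formula L n]: formulas with free variables among ['I_n].  Variables are
   de Bruijn indices: the bound variable of [Ex phi], [All phi] is [ord0]. *)
Inductive formula (L : signature) : nat -> Type :=
| Eq n of term L n & term L n : formula L n
| Rel n m of rsym L m & ('I_m -> term L n) : formula L n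
| Not n of formula L n : formula L n
| And n of formula L n & formula L n : formula L n
| Or n of formula L n & formula L n : formula L n
| Ex n of formula L n.+1 : formula L n
| All n of formula L n.+1 : formula L n.

Definition env_cons (A : Type) n (a : A) (e : 'I_n -> A) : 'I_n.+1 -> A :=
  fun i => oapp e a (unlift ord0 i).

Definition env_cat (A : Type) n k (x : 'I_n -> A) (p : 'I_k -> A) :
    'I_(n + k) -> A :=
  fun i => match fintype.split i with inl j => x j | inr j => p j end.

Fixpoint eval L (S : structure L) n (e : 'I_n -> S) (t : term L n) : S :=
  match t with
  | Var i => e i
  | App m f ts => finterp f (fun j : 'I_m => eval e (ts j))
  end.

Fixpoint holds L (S : structure L) n (phi : formula L n) : ('I_n -> S) -> Prop :=
  match phi in formula _ n return ('I_n -> S) -> Prop with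
  | Eq _ t u => fun e => eval e t = eval e u
  | Rel _ m r ts => fun e => rinterp r (fun j : 'I_m => eval e (ts j))
  | Not _ phi => fun e => ~ holds phi e
  | And _ phi psi => fun e => holds phi e /\ holds psi e
  | Or _ phi psi => fun e => holds phi e \/ holds psi e
  | Ex _ phi => fun e => exists a : S, holds phi (env_cons a e)
  | All _ phi => fun e => forall a : S, holds phi (env_cons a e)
  end.

Fixpoint quantifier_free L n (phi : formula L n) : bool :=
  match phi with
  | Eq _ _ _ | Rel _ _ _ _ => true
  | Not _ phi => quantifier_free phi
  | And _ phi psi | Or _ phi psi => quantifier_free phi && quantifier_free psi
  | Ex _ _ | All _ _ => false
  end.

Definition admits_QE L (S : structure L) : Prop :=
  forall n (phi : formula L n), exists psi : formula L n,
    quantifier_free psi /\ forall e : 'I_n -> S, holds phi e <-> holds psi e.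

(* The variables beyond the first [n] are instantiated by parameters. *)
Definition definable L (S : structure L) n (V : set ('I_n -> S)) : Prop :=
  exists k (phi : formula L (n + k)) (p : 'I_k -> S),
    forall x, V x <-> holds phi (env_cat x p).

Definition qf_definable L (S : structure L) n (V : set ('I_n -> S)) : Prop :=
  exists k (phi : formula L (n + k)) (p : 'I_k -> S),
    quantifier_free phi /\ forall x, V x <-> holds phi (env_cat x p).

Section DenjoyCarleman.
Variables (R : realType) (M : nat -> R).

Definition partial m (i : 'I_m) (f : 'rV[R]_m -> R) : 'rV[R]_m -> R :=
  fun x => 'D_(delta_mx 0 i) f x.

Definition partials m (s : seq 'I_m) (f : 'rV[R]_m -> R) : 'rV[R]_m -> R :=
  foldr (@partial m) f s.

(* All iterated partial derivatives, in any order of the variables, exist and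
   are continuous on [U]; meant for open [U], where they depend only on the
   restriction of [f] to [U]. *)
Definition smooth_on m (U : set 'rV[R]_m) (f : 'rV[R]_m -> R) : Prop :=
  forall (s : seq 'I_m) x, U x ->
    {for x, continuous (partials s f)} /\
    forall i, derivable (partials s f) x (delta_mx 0 i).

Definition mdeg m (a : 'I_m -> nat) : nat := (\sum_(i < m) a i)%N.

Definition mpartial m (a : 'I_m -> nat) (f : 'rV[R]_m -> R) : 'rV[R]_m -> R :=
  foldr (fun i g => iter (a i) (partial i) g) f (enum 'I_m).

Definition QM m (U : set 'rV[R]_m) (f : 'rV[R]_m -> R) : Prop :=
  smooth_on U f /\
  forall x0, U x0 ->
    exists (W : set 'rV[R]_m) (C r : R),
      [/\ nbhs x0 W, W `<=` U, 0 < C, 0 < r &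
        forall (a : 'I_m -> nat) x, W x ->
          `|mpartial a f x| <=
            C * r ^+ mdeg a * ((mdeg a)`!)%:R * M (mdeg a)].

(* Derivative relative to [I]; one-sided at endpoints of [I].  As usual for
   [lim], the value is junk when the limit does not exist. *)
Definition diffquot (f : R -> R) (x : R) : R -> R :=
  fun y => (f y - f x) / (y - x).

Definition derive_in (I : set R) (f : R -> R) : R -> R :=
  fun x => lim (diffquot f x @ within I x^').

Definition derivable_in (I : set R) (f : R -> R) (x : R) : Prop :=
  cvg (diffquot f x @ within I x^').

Definition QI (I : interval R) (f : R -> R) : Prop :=
  let D n := iter n (derive_in [set` I]) f in
  (forall n x, x \in I -> derivable_in [set` I] (D n) x) /\
  exists C r : R, [/\ 0 < C, 0 < r &
    forall n x, x \in I -> `|D n x| <= C * r ^+ n * (n`!)%:R * M n].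

Definition cube m : set 'rV[R]_m := [set x | forall i, -1 <= x 0 i <= 1].

Definition restricted_QM m (g : 'rV[R]_m -> R) : Prop :=
  exists (U : set 'rV[R]_m) (h : 'rV[R]_m -> R),
    [/\ open U, @cube m `<=` U, QM U h,
        forall x, @cube m x -> g x = h x &
        forall x, ~ @cube m x -> g x = 0].

Inductive ring_fsym : nat -> Type :=
| SZero : ring_fsym 0
| SOne : ring_fsym 0
| SOpp : ring_fsym 1
| SAdd : ring_fsym 2
| SMul : ring_fsym 2.

Inductive order_rsym : nat -> Type :=
| SLt : order_rsym 2.

Definition ring_finterp m (s : ring_fsym m) : ('I_m -> R) -> R :=
  match s in ring_fsym m return ('I_m -> R) -> R with
  | SZero => fun _ => 0
  | SOne => fun _ => 1
  | SOpp => fun x => - x ord0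
  | SAdd => fun x => x ord0 + x ord_max
  | SMul => fun x => x ord0 * x ord_max
  end.

Definition order_rinterp m (s : order_rsym m) : ('I_m -> R) -> Prop :=
  match s in order_rsym m return ('I_m -> R) -> Prop with
  | SLt => fun x => x ord0 < x ord_max
  end.

Inductive QM_fsym (m : nat) : Type :=
| SRing of ring_fsym m
| SRestr (g : 'rV[R]_m -> R) of restricted_QM g.

Definition QM_finterp m (s : QM_fsym m) (x : 'I_m -> R) : R :=
  match s with
  | SRing s => ring_finterp s x
  | SRestr g _ => g (\row_i x i)
  end.

Definition LQM : signature := Signature QM_fsym order_rsym.

Definition R_QM : structure LQM := @Structure LQM R QM_finterp order_rinterp.

Inductive QM_inv_fsym : nat -> Type :=
| SQM m of QM_fsym m : QM_inv_fsym m
| SInv : QM_inv_fsym 1.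

(* In a field, [0^-1 = 0]. *)
Definition QM_inv_finterp m (s : QM_inv_fsym m) : ('I_m -> R) -> R :=
  match s in QM_inv_fsym m return ('I_m -> R) -> R with
  | SQM _ s => QM_finterp s
  | SInv => fun x => (x ord0)^-1
  end.

Definition LQM_inv : signature := Signature QM_inv_fsym order_rsym.

Definition R_QM_inv : structure LQM_inv :=
  @Structure LQM_inv R QM_inv_finterp order_rinterp.

End DenjoyCarleman.

Definition graph_on (R : realType) (I : interval R) (f : R -> R) :
    set ('I_2 -> R) :=
  [set p | p ord0 \in I /\ p ord_max = f (p ord0)].

Definition loglog_seq (R : realType) (n : nat) : R :=
  ((ln (ln 3)) ^+ 3)^-1 * (ln (ln (n + 3)%:R)) ^+ (n + 3).

(* Main.v *)
(* Put rho n = log log (n + 3); up to geometric factors, M n is rho n ^+ n.  Let f be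
   a sum of simple fractions w_k / (1 + k^2 x), minus its value at 0, with positive
   weights w_k that decrease so fast that f lies in Q([0,1], M) and f(t^2) is
   Q_M-analytic near [-1,1].  Then y = f(x) means that x = t^2 and y = f(t^2) for some
   t, so the graph is definable.  The Taylor coefficients of f at 0 alternate in sign
   and grow faster than any geometric sequence.  By an argument of Bang, a function of
   the class with nonnegative derivatives at 0 is absolutely monotone to the right of
   0; after x -> -x this shows that neither f nor any of its Taylor remainders extends
   to the left of 0 within the class.

   Blow up the plane repeatedly along the Taylor series of f: the K-th chart is
   (x, z) -> (x, c_0 + c_1 x + ... + c_K x^K + x^K z).  A function G of the class in
   such a chart becomes, after further blow-ups, either 0 for x > 0 or a monomial in x
   times a unit.  Otherwise G would be flat, hence zero, along the lift of the graph,
   parametrised by t with x = t^2.  If all z-derivatives of G vanish there, G is zero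
   for x > 0; if not, a suitable z-derivative and the implicit function theorem extend
   a Taylor remainder of f to the left of 0.  It follows by induction on terms that in
   a high chart each term is, for x > 0, a negative power of x times a function of the
   class, of constant sign.  So a quantifier-free formula has a constant truth value
   for small x > 0 in some chart, while the graph is neither empty nor everything
   there. *)

Require Import Defs.
From mathcomp Require Import all_boot all_order all_algebra.
From mathcomp Require Import all_classical all_reals all_analysis.
From mathcomp Require Import ring lra.

Import Order.TTheory GRing.Theory Num.Theory.
Import numFieldNormedType.Exports.

Set Implicit Arguments.
Unset Strict Implicit.
Unset Printing Implicit Defensive.

Local Open Scope classical_set_scope.
Local Open Scope ring_scope.

(** * Functions with prescribed bounds on their derivatives *)

(** The summand with parameter k has its pole at x = -1/k^2, so the poles pile up at 0 from the
    left; after x = t^2 they sit at t = i/k and t = -i/k, off the real line. This is why one series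
    is harmless in t and cannot be continued in x. The terms of a quantifier-free formula only
    involve functions of the class on full neighbourhoods, on both sides of x = 0, and cannot
    imitate the existential quantifier over t. The obstacle is that no Weierstrass division is at
    hand, so the zeros of a function of the class cannot be put in polynomial form. Only operations
    preserving the class are used: sums, products, composition, inverses of units, division by a
    coordinate, implicit functions. The order of the first z-derivative that does not vanish along
    the branch replaces the Weierstrass degree. Blowing up along one formal branch is enough, since
    truth values matter only in a thin region around the graph. Bang's argument is preferred to a
    mere uniqueness theorem because it yields positivity: that is what excludes an extension to the
    left, while uniqueness follows by applying it to a function and its negative. *)

Section BoundedDerivatives.
Context {R : realType} {V : normedModType R} {I : Type}.
Variable e : I -> V.
Implicit Types (X : set V) (n : nat) (b : nat -> R) (F G : V -> R).

(** The directions [e] are a parameter so that the line (one direction) and R^m (the coordinate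
    directions) share all lemmas. The recursion on the order, with the bound sequence shifted at
    each derivative, turns closure under products and compositions into inductions on [n].
    Derivatives in every order of the directions are covered. *)
Fixpoint CB X n b F : Prop :=
  (forall q, X q -> {for q, continuous F} /\ `|F q| <= b 0) /\
  match n with
  | 0 => True
  | n'.+1 => forall i, (forall q, X q -> derivable F q (e i)) /\
                 CB X n' (fun k => b k.+1) ('D_(e i) F)
  end.

Lemma CB_continuous X n b F q : CB X n b F -> X q -> {for q, continuous F}.
Proof. by case: n => [|n] [h _] /h[]. Qed.

Lemma CB_bound X n b F q : CB X n b F -> X q -> `|F q| <= b 0.
Proof. by case: n => [|n] [h _] /h[]. Qed.

Lemma CB_derivable X n b F i q : CB X n.+1 b F -> X q -> derivable F q (e i).
Proof. by move=> [_ /(_ i)[h _]] /h. Qed.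

Lemma CB_derive X n b F i :
  CB X n.+1 b F -> CB X n (fun k => b k.+1) ('D_(e i) F).
Proof. by move=> [_ /(_ i)[]]. Qed.

Lemma CB_ler X n b b' F : (forall k, (k <= n)%N -> b k <= b' k) ->
  CB X n b F -> CB X n b' F.
Proof.
elim: n b b' F => [|n IH] b b' F bb' [h h'].
  by split=> // q /h[? le]; split => //; exact/(le_trans le)/bb'.
split=> [q /h[? le]|i]; first by split => //; exact/(le_trans le)/bb'.
have [h1 h2] := h' i; split => //.
by apply: IH h2 => k kn; exact: bb'.
Qed.

Lemma CB_subset X Y n b F : Y `<=` X -> CB X n b F -> CB Y n b F.
Proof.
move=> YX; elim: n b F => [|n IH] b F [h h'].
  by split=> // q /YX/h.
by split=> [q /YX/h //|i]; have [h1 h2] := h' i; split=> [q /YX/h1//|]; exact: IH.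
Qed.

Lemma CB_leq X n n' b F : (n' <= n)%N -> CB X n b F -> CB X n' b F.
Proof.
elim: n n' b F => [|n IH] [|n'] b F // nn' [h h']; split=> // i.
by have [h1 h2] := h' i; split => //; exact: IH.
Qed.

Lemma near_open_eq X F G : open X -> (forall q, X q -> F q = G q) ->
  forall q, X q -> \near q, F q = G q.
Proof.
move=> oX FG q Xq; near=> t; apply: FG; near: t.
exact: (open_nbhs_nbhs (conj oX Xq)).
Unshelve. all: by end_near. Qed.

Lemma for_continuous_ext X F G q : open X -> (forall q, X q -> F q = G q) ->
  X q -> {for q, continuous F} -> {for q, continuous G}.
Proof.
move=> oX FG Xq; rewrite /prop_for /continuous_at -(FG _ Xq).
by apply: cvg_trans; apply: near_eq_cvg; exact: (near_open_eq oX).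
Qed.

Lemma CB_ext X n b F G : open X -> (forall q, X q -> F q = G q) ->
  CB X n b F -> CB X n b G.
Proof.
move=> oX; elim: n b F G => [|n IH] b F G FG [h h'].
  split=> // q Xq; have [c l] := h _ Xq; split; last by rewrite -FG.
  exact: (for_continuous_ext oX FG).
split=> [q Xq|i].
  have [c l] := h _ Xq; split; last by rewrite -FG.
  exact: (for_continuous_ext oX FG).
have [h1 h2] := h' i; split => [q Xq|].
  by apply: near_eq_derivable (h1 _ Xq); exact: (near_open_eq oX).
apply: IH h2 => q Xq.
by apply: near_eq_derive; exact: (near_open_eq oX FG).
Qed.

Lemma CB_intro X n b F (F' : I -> V -> R) : open X ->
  (forall q, X q -> {for q, continuous F} /\ `|F q| <= b 0) ->
  (forall i q, X q -> is_derive q (e i) F (F' i q)) ->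
  (forall i, CB X n (fun k => b k.+1) (F' i)) ->
  CB X n.+1 b F.
Proof.
move=> oX h h1 h2; split=> // i; split=> [q Xq|].
  by have [] := h1 i _ Xq.
by apply: CB_ext (h2 i) => // q Xq; have [_ ->] := h1 i _ Xq.
Qed.

Lemma CB_cst X n b c : `|c| <= b 0 -> (forall k, 0 <= b k) ->
  CB X n b (cst c).
Proof.
elim: n b c => [|n IH] b c cb b0.
  by split=> // q Xq; split=> //; exact: cvg_cst.
split=> [q Xq|i]; first by split=> //; exact: cvg_cst.
split=> [q Xq|]; first exact: derivable_cst.
rewrite (_ : 'D_(e i) _ = cst 0); first by apply: IH; rewrite ?normr0.
by apply/funext => x; rewrite derive_cst.
Qed.

Lemma CB_add X n b b' F G : open X -> CB X n b F -> CB X n b' G ->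
  CB X n (fun k => b k + b' k) (fun q => F q + G q).
Proof.
move=> oX; elim: n b b' F G => [|n IH] b b' F G hF hG.
  split=> // q Xq; split.
    by apply: cvgD; [exact: CB_continuous hF Xq|exact: CB_continuous hG Xq].
  apply: (le_trans (ler_normD _ _)).
  by apply: lerD; [exact: CB_bound hF Xq|exact: CB_bound hG Xq].
apply: (CB_intro (F' := fun i q => 'D_(e i) F q + 'D_(e i) G q)) => //.
- move=> q Xq; split.
    by apply: cvgD; [exact: CB_continuous hF Xq|exact: CB_continuous hG Xq].
  apply: (le_trans (ler_normD _ _)).
  by apply: lerD; [exact: CB_bound hF Xq|exact: CB_bound hG Xq].
- move=> i q Xq; apply: is_deriveD; apply: derivableP.
    exact: CB_derivable hF Xq.
  exact: CB_derivable hG Xq.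
- by move=> i; apply: IH; exact: CB_derive.
Qed.

Definition bconv b b' k := \sum_(i < k.+1) 'C(k, i)%:R * b i * b' (k - i)%N.

(** Pascal's rule; it mirrors (FG)' = F'G + FG', the step of the induction for products. *)
Lemma bconv_shift b b' k :
  bconv b b' k.+1 = bconv (fun i => b i.+1) b' k + bconv b (fun i => b' i.+1) k.
Proof.
rewrite /bconv big_ord_recl /= subn0 bin0.
rewrite (eq_bigr (fun i : 'I_k.+1 => 'C(k, i.+1)%:R * b i.+1 * b' (k - i)%N +
   'C(k, i)%:R * b i.+1 * b' (k - i)%N)); last first.
  by move=> i _; rewrite /= /bump /= add1n binS natrD subSS !mulrDl.
rewrite big_split /= addrA addrC; congr (_ + _).
rewrite [in RHS]big_ord_recl /= bin0 subn0; congr (_ + _).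
rewrite big_ord_recr /= bin_small// !mul0r addr0.
apply: eq_bigr => i _; rewrite /bump /= add1n; congr (_ * b' _).
by rewrite -subSn.
Qed.

Lemma CB_mul X n b b' F G : open X -> CB X n b F -> CB X n b' G ->
  CB X n (bconv b b') (fun q => F q * G q).
Proof.
have base b1 b1' : bconv b1 b1' 0 = b1 0%N * b1' 0%N.
  by rewrite /bconv big_ord_recl big_ord0 addr0 /= bin0 mul1r.
move=> oX; elim: n b b' F G => [|n IH] b b' F G hF hG.
  split=> // q Xq; split.
    by apply: cvgM; [exact: CB_continuous hF Xq|exact: CB_continuous hG Xq].
  rewrite base normrM.
  by apply: ler_pM => //; [exact: CB_bound hF Xq|exact: CB_bound hG Xq].
apply: (CB_intro (F' := fun i q => 'D_(e i) F q * G q + F q * 'D_(e i) G q)) => //.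
- move=> q Xq; split.
    by apply: cvgM; [exact: CB_continuous hF Xq|exact: CB_continuous hG Xq].
  rewrite base normrM.
  by apply: ler_pM => //; [exact: CB_bound hF Xq|exact: CB_bound hG Xq].
- move=> i q Xq; rewrite addrC [_ * G q]mulrC.
  apply: is_deriveM; apply: derivableP.
    exact: CB_derivable hF Xq.
  exact: CB_derivable hG Xq.
- move=> i; apply: (@CB_ler _ _ (fun k => bconv (fun i => b i.+1) b' k +
     bconv b (fun i => b' i.+1) k)).
    by move=> k _; rewrite bconv_shift.
  apply: CB_add => //; apply: IH.
  + exact: CB_derive.
  + exact: CB_leq hG.
  + exact: CB_leq hF.
  + exact: CB_derive.
Qed.

Lemma CB_sum X n m (b : 'I_m -> nat -> R) (F : 'I_m -> V -> R) : open X ->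
  (forall j, CB X n (b j) (F j)) ->
  CB X n (fun k => \sum_(j < m) b j k) (fun q => \sum_(j < m) F j q).
Proof.
move=> oX; elim: m b F => [|m IH] b F h.
  apply: (CB_ext (F := cst 0)) => //; first by move=> q _; rewrite big_ord0.
  apply: CB_cst.
  - by rewrite big_ord0 normr0.
  - by move=> k; rewrite big_ord0.
apply: (CB_ext oX _ (CB_ler _ (CB_add oX (h ord0) (IH _ _ (fun j => h (lift ord0 j)))))) => //.
- by move=> q _; rewrite big_ord_recl.
- by move=> k _; rewrite big_ord_recl.
Qed.

Definition ders (w : seq I) F : V -> R := foldl (fun G i => 'D_(e i) G) F w.

Lemma CBP X n b F : CB X n b F <->
  (forall w q, (size w <= n)%N -> X q ->
     {for q, continuous (ders w F)} /\ `|ders w F q| <= b (size w)) /\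
  (forall w q i, (size w < n)%N -> X q -> derivable (ders w F) q (e i)).
Proof.
elim: n b F => [|n IH] b F.
  split=> [[h _]|[h _]].
    by split=> -[|//] q // _ Xq; exact: h.
  by split=> // q Xq; exact: (h [::]).
split=> [[h h']|[h h']].
  split=> [[|i w] q //= wn Xq|[|j w] q i //= wn Xq].
  - exact: h.
  - by have [_ /IH[+ _]] := h' i; exact.
  - by have [+ _] := h' i; exact.
  - by have [_ /IH[_]] := h' j; exact.
split=> [q Xq|i]; first exact: (h [::]).
split=> [q Xq|]; first exact: (h' [::]).
apply/IH; split=> [w q wn Xq|w q j wn Xq]; first exact: (h (i :: w)).
exact: (h' (i :: w)).
Qed.

(** A derivative of order k needs only the bounds attached to n = k, so bounds that worsen with n
    still give one sequence valid at all orders. This turns geometric bounds whose ratio depends on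
    n back into bounds of the class. *)
Lemma CB_diag X (b : nat -> nat -> R) F :
  (forall n, CB X n (b n) F) -> forall n, CB X n (fun k => b k k) F.
Proof.
move=> h n; apply/CBP; split=> [w q wn Xq|w q i wn Xq].
  by have /CBP[+ _] := h (size w); exact.
by have /CBP[_] := h n; exact.
Qed.

End BoundedDerivatives.

(** * The chain rule from continuous partial derivatives *)

Section ChainRule.
Context {R : realType}.

Lemma cvg_sum_ord (T : Type) (F : set_system T) m (f : 'I_m -> T -> R) (l : 'I_m -> R) :
  Filter F -> (forall j, f j x @[x --> F] --> l j) ->
  (\sum_(j < m) f j x) @[x --> F] --> \sum_(j < m) l j.
Proof.
move=> FF; elim: m f l => [|m IH] f l fl.
  under eq_fun do rewrite big_ord0.
  by rewrite big_ord0; exact: cvg_cst.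
under eq_fun do rewrite big_ord_recl.
by rewrite big_ord_recl; apply: cvgD => //; apply: IH.
Qed.

Lemma is_derive1_continuous (f : R -> R) (x d : R) : is_derive x 1 f d ->
  {for x, continuous f}.
Proof. by move=> [/derivable1_diffP/differentiable_continuous]. Qed.

Lemma MVT_dist (f df : R -> R) (a b : R) :
  (forall x, `|x - a| <= `|b - a| -> is_derive x 1 f (df x)) ->
  exists2 c, `|c - a| <= `|b - a| & f b - f a = df c * (b - a).
Proof.
move=> h.
have cont u v : (forall x, u <= x <= v -> `|x - a| <= `|b - a|) ->
    {within `[u, v], continuous f}.
  move=> uv; apply: derivable_within_continuous => x; rewrite in_itv /= => xuv.
  by have [] := h _ (uv _ xuv).
case: (leP a b) => ab.
  have dom x : a <= x <= b -> `|x - a| <= `|b - a|.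
    by move=> /andP[ax xb]; rewrite !ger0_norm ?subr_ge0// lerB.
  have [|c] := MVT_segment ab (df := df) _ (cont _ _ dom).
    move=> x; rewrite in_itv /= => /andP[/ltW ? /ltW ?]; apply/h/dom.
    by apply/andP.
  by rewrite in_itv /= => /dom ? ?; exists c.
have dom x : b <= x <= a -> `|x - a| <= `|b - a|.
  by move=> /andP[ax xb]; rewrite !ler0_norm ?subr_le0// ?(ltW ab)// !opprB lerB.
have [|c] := MVT_segment (ltW ab) (df := df) _ (cont _ _ dom).
  move=> x; rewrite in_itv /= => /andP[/ltW ? /ltW ?]; apply/h/dom.
  by apply/andP.
rewrite in_itv /= => /dom ? E; exists c => //.
by rewrite -[LHS]opprB E -mulrN opprB.
Qed.

Lemma is_derive_line (V : normedModType R) (h : V -> R) (S : R -> V) v t :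
  (forall s, S (s + t) = s *: v + S t) -> derivable h (S t) v ->
  is_derive t 1 (h \o S) ('D_v h (S t)).
Proof.
move=> hS dh.
have E : (fun s : R => s^-1 *: ((h \o S) (s *: 1 + t) - (h \o S) t)) =
         (fun s : R => s^-1 *: (h (s *: v + S t) - h (S t))).
  by apply/funext => s /=; rewrite [_ *: 1]mulr1 hS.
apply: DeriveDef; first by rewrite /derivable E.
by rewrite /derive E.
Qed.

Lemma rV_ballP m (p y : 'rV[R]_m) r : 0 < r ->
  ball p r y <-> forall j, `|p 0 j - y 0 j| < r.
Proof.
move=> r0; split=> [[_ h] j|h]; first exact: (h 0 j).
by split=> // i j; rewrite (ord1 i); exact: h.
Qed.

Lemma rV_norm_le m (x : 'rV[R]_m) a : 0 <= a -> (forall j, `|x 0 j| <= a) -> `|x| <= a.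
Proof.
move=> a0 h; rewrite /Num.Def.normr /= mx_normrE.
by apply: bigmax_le => //= -[i j] _; rewrite (ord1 i).
Qed.

Lemma rV_coord_le m (x : 'rV[R]_m) j : `|x 0 j| <= `|x|.
Proof.
rewrite [leRHS]/Num.Def.normr /= mx_normrE.
exact: (le_bigmax _ (fun ij : 'I_1 * 'I_m => `|x ij.1 ij.2|) (0, j)).
Qed.

(** The increment is telescoped over points that pass from [p] to [y] one coordinate at a time, with
    the one-variable mean value theorem on each leg. Partial derivatives suffice, at the price of
    one intermediate point per coordinate. *)
Lemma mean_value_rV m (h : 'rV[R]_m -> R) (p : 'rV[R]_m) r :
  (forall y j, ball p r y -> derivable h y (delta_mx 0 j)) ->
  forall y, ball p r y -> exists xi : 'I_m -> 'rV[R]_m,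
    (forall j, `|p - xi j| <= `|p - y|) /\
    h y - h p = \sum_(j < m) 'D_(delta_mx 0 j) h (xi j) * (y 0 j - p 0 j).
Proof.
move=> dh y py.
have r0 : 0 < r by case: py.
pose z k : 'rV[R]_m := \row_i (if (i < k)%N then y 0 i else p 0 i).
pose S (j : 'I_m) t : 'rV[R]_m :=
  \row_i (if (i < j)%N then y 0 i else if i == j then t else p 0 i).
have SE (j : 'I_m) s t : S j (s + t) = s *: delta_mx 0 j + S j t.
  apply/rowP => i; rewrite !mxE eqxx /=.
  case: (eqVneq i j) => [->|ij]; first by rewrite ltnn mulr1.
  by rewrite mulr0 add0r.
have SN (j : 'I_m) t : `|t - p 0 j| <= `|y 0 j - p 0 j| -> `|p - S j t| <= `|p - y|.
  move=> tj; apply: rV_norm_le => // i; rewrite !mxE.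
  case: ifP => _; first by have := rV_coord_le (p - y) i; rewrite !mxE.
  case: eqVneq => [->|_]; last by rewrite subrr normr0.
  rewrite distrC (le_trans tj)//.
  by have := rV_coord_le (p - y) j; rewrite !mxE distrC.
have dS (j : 'I_m) t : `|t - p 0 j| <= `|y 0 j - p 0 j| ->
    is_derive t 1 (h \o S j) ('D_(delta_mx 0 j) h (S j t)).
  move=> tj; apply: is_derive_line => [s|]; first exact: SE.
  apply: dh; move: py; rewrite -!ball_normE /ball_ /=.
  by apply: le_lt_trans; exact: SN.
have step (j : 'I_m) : exists c, `|c - p 0 j| <= `|y 0 j - p 0 j| /\
   h (z j.+1) - h (z j) = 'D_(delta_mx 0 j) h (S j c) * (y 0 j - p 0 j).
  have [c cj E] := MVT_dist (dS j).
  exists c; split => //; rewrite -E /=; congr (h _ - h _).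
    apply/rowP => i; rewrite !mxE ltnS leq_eqVlt -val_eqE /=.
    by case: ltngtP => //= /ord_inj ->.
  apply/rowP => i; rewrite !mxE.
  case: ltnP => //; case: eqVneq => // ->//.
exists (fun j => S j (sval (cid (step j)))); split=> [j|].
  by case: cid => c /= [cj _]; exact: SN.
transitivity (\sum_(j < m) (h (z j.+1) - h (z j))).
  rewrite -(big_mkord predT (fun j => h (z j.+1) - h (z j))) telescope_sumr//.
  congr (h _ - h _); apply/rowP => i; rewrite !mxE ?ltn_ord//.
by apply: eq_bigr => j _; case: cid => c /= [_ ->].
Qed.

(** The mean value formula expresses the difference quotient through partial derivatives at points
    tending to the image of [q]; their continuity there gives the limit, so total differentiability
    never enters. *)
Lemma is_derive_chain (V : normedModType R) m (h : 'rV[R]_m -> R) (Y : set 'rV[R]_m)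
    (G : 'I_m -> V -> R) (q v : V) (g' : 'I_m -> R) :
  open Y -> Y (\row_j G j q) ->
  (forall j y, Y y -> derivable h y (delta_mx 0 j)) ->
  (forall j, {for \row_j G j q, continuous ('D_(delta_mx 0 j) h)}) ->
  (forall j, is_derive q v (G j) (g' j)) ->
  is_derive q v (fun x => h (\row_j G j x))
    (\sum_(j < m) 'D_(delta_mx 0 j) h (\row_j G j q) * g' j).
Proof.
set p := \row_j G j q => oY Yp dh ch dG.
have [r /= r0 rY] : exists2 r : R, 0 < r & ball p r `<=` Y.
  by have /nbhs_ballP[r /= r0 rY] := open_nbhs_nbhs (conj oY Yp); exists r.
have mv := mean_value_rV (fun y j (hy : ball p r y) => dh j y (rY _ hy)).
(* Outside the ball [p] is a default value; the limit only involves points inside. *)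
pose xi y := if pselect (ball p r y) is left hy then sval (cid (mv y hy))
             else (fun=> p).
have xiN y j : `|p - xi y j| <= `|p - y|.
  rewrite /xi; case: pselect => [hy|_]; last by rewrite subrr normr0.
  by case: cid => /= x [].
have xiE y : ball p r y ->
    h y - h p = \sum_(j < m) 'D_(delta_mx 0 j) h (xi y j) * (y 0 j - p 0 j).
  by rewrite /xi; case: pselect => // hy _; case: cid => /= x [].
pose Gm t := (\row_j G j (t *: v + q)) : 'rV[R]_m.
pose d j t := t^-1 *: (G j (t *: v + q) - G j q).
have dcvg j : d j t @[t --> 0^'] --> g' j.
  by have [/cvgP h1 h2] := dG j; rewrite -h2; exact: h1.
have Gcvg : Gm t @[t --> 0^'] --> p.
  apply/cvgrPdist_lt => e e0; near=> t.
  have -> : p - Gm t = - \row_j (t * d j t).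
    apply/rowP => j; rewrite !mxE /d -[_ *: (_ - _)]/(_ * _) mulrA mulfV.
      by rewrite mul1r opprB.
    by near: t; exact: nbhs_dnbhs_neq.
  rewrite normrN.
  have : forall j, `|t * d j t| < e.
    near: t; apply: filter_forall => j.
    have : t * d j t @[t --> 0^'] --> 0 * g' j.
      by apply: cvgM => //; apply: cvg_within; exact: cvg_id.
    rewrite mul0r => /cvgrPdist_lt/(_ _ e0); apply: filterS => t.
    by rewrite sub0r normrN.
  move=> hj; have : ball 0 e (\row_j (t * d j t) : 'rV[R]_m).
    by apply/rV_ballP => // j; rewrite !mxE sub0r normrN.
  by rewrite -ball_normE /ball_ /= sub0r normrN.
have Q : t^-1 *: (h (Gm t) - h p) @[t --> 0^'] -->
    \sum_(j < m) 'D_(delta_mx 0 j) h p * g' j.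
  have : (\sum_(j < m) 'D_(delta_mx 0 j) h (xi (Gm t) j) * d j t) @[t --> 0^']
      --> \sum_(j < m) 'D_(delta_mx 0 j) h p * g' j.
    apply: cvg_sum_ord => j; apply: cvgM => //.
    have : xi (Gm t) j @[t --> 0^'] --> p.
      apply/cvgrPdist_lt => e e0; near=> t.
      apply: le_lt_trans (xiN _ _) _; near: t.
      by have /cvgrPdist_lt/(_ _ e0) := Gcvg.
    by move=> xc; exact: (cvg_comp _ _ xc (ch j)).
  apply: cvg_trans; apply: near_eq_cvg; near=> t.
  rewrite xiE; last first.
    rewrite -ball_normE /ball_ /=; near: t.
    by have /cvgrPdist_lt/(_ _ r0) := Gcvg.
  rewrite scaler_sumr; apply: eq_bigr => j _.
  by rewrite -scalerAr /d; congr (_ * _); rewrite !mxE.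
by apply: DeriveDef; [apply/cvg_ex; eexists; exact: Q|apply/cvg_lim => //].
Unshelve. all: by end_near. Qed.

End ChainRule.

(** * The Denjoy-Carleman class of a gauge *)

Section Gauge.
Context {R : realType}.
Implicit Types (rho : nat -> R).

(* M n is rho n ^+ n up to geometric factors; the last condition makes the sum of
   the inverses of n * rho n diverge, hence the class quasianalytic. *)
Definition gauge rho := [/\ 0 < rho 0, forall n, rho n <= rho n.+1,
  forall A, exists n, A <= rho n &
  forall n, n.+1%:R * rho n.+1 * (rho n.+1 - rho n) <= 1].

Variable rho : nat -> R.
Hypothesis hrho : gauge rho.

Lemma gauge_le m n : (m <= n)%N -> rho m <= rho n.
Proof. by have [_ h _ _] := hrho; apply/(homo_leq (@lexx _ _) (@le_trans _ _) h). Qed.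

Lemma gauge_gt0 n : 0 < rho n.
Proof. by have [h _ _ _] := hrho; apply: (lt_le_trans h); exact: gauge_le. Qed.

Lemma gauge_ge0 n : 0 <= rho n. Proof. exact/ltW/gauge_gt0. Qed.

Lemma gauge_step n : rho n.+1 - rho n <= (n.+1%:R * rho n.+1)^-1.
Proof.
have [_ _ _ h] := hrho; have := gauge_gt0 n.+1 => r0.
by rewrite -[leRHS]mul1r ler_pdivlMr ?mulr_gt0 ?ltr0n// mulrC.
Qed.

Lemma gauge_step0 n : rho n.+1 - rho n <= (rho 0)^-1.
Proof.
apply: (le_trans (gauge_step n)); rewrite lef_pV2 ?posrE ?gauge_gt0//.
  apply: (@le_trans _ _ (rho n.+1)); first exact: gauge_le.
  by rewrite ler_peMl ?gauge_ge0// ler1n.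
by rewrite mulr_gt0 ?gauge_gt0// ltr0n.
Qed.

Lemma gauge_ratio n : rho n.+1 <= (1 + (rho 0)^-2) * rho n.
Proof.
have h := gauge_step0 n; have r0 := gauge_gt0 0; have rn := gauge_le (leq0n n).
rewrite mulrDl mul1r -lerBlDl; apply: (le_trans h).
rewrite -exprVn expr2 -mulrA ler_pMr ?invr_gt0//.
by rewrite mulrC ler_pdivlMr// mul1r.
Qed.

Lemma gauge_le2X n : rho n <= (rho 0 + (rho 0)^-1) * 2 ^+ n.
Proof.
have r0 := gauge_gt0 0.
have ri0 : 0 < (rho 0)^-1 by rewrite invr_gt0.
elim: n => [|n IH]; first by rewrite expr0 mulr1 lerDl ltW.
have := gauge_step0 n; rewrite lerBlDr => /le_trans; apply.
rewrite exprS mulrCA [2 * _]mulr_natl mulr2n addrC lerD//.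
apply: (@le_trans _ _ ((rho 0 + (rho 0)^-1) * 1)); first by rewrite mulr1 lerDr ltW.
by rewrite ler_pM2l ?addr_gt0// exprn_ege1// ler1n.
Qed.

Lemma succ_le2X n : n.+1%:R <= 2 ^+ n :> R.
Proof. by rewrite -natrX ler_nat ltn_expl. Qed.

(* Since rho grows at most geometrically, one of the k+1 factors rho (k+1) can be absorbed into the geometric constant. *)
Lemma gauge_shift (C S : R) : 0 < C -> 0 < S -> exists L T, [/\ 0 < L, 0 < T &
  forall k, C * (S * rho k.+1) ^+ k.+1 * k.+1`!%:R <= L * (T * rho k) ^+ k * k`!%:R].
Proof.
move=> C0 S0; have r0 := gauge_gt0 0.
pose c := rho 0 + (rho 0)^-1; pose kap : R := 1 + (rho 0)^-2.
have c0 : 0 < c by rewrite addr_gt0 ?invr_gt0.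
have kap0 : 0 < kap by rewrite addr_gt0 ?invr_gt0 ?exprn_gt0.
exists (C * S * c * 2), (4 * S * kap); split; [by rewrite !mulr_gt0| by rewrite !mulr_gt0|].
move=> k; rewrite factS natrM exprS.
have rk := gauge_gt0 k; have rk1 := gauge_gt0 k.+1.
rewrite (_ : C * _ * _ = (C * S * (S ^+ k) * k`!%:R) * (rho k.+1 * rho k.+1 ^+ k * k.+1%:R)); last first.
  by rewrite !exprMn; ring.
rewrite [leRHS](_ : _ = (C * S * (S ^+ k) * k`!%:R) * (c * 2 ^+ k.+1 * (kap * rho k) ^+ k * 2 ^+ k)); last first.
  by rewrite (_ : 4 = 2 * 2 :> R) ?exprMn ?exprS; [ring|rewrite -natrM].
rewrite ler_pM2l; last by rewrite !mulr_gt0 ?exprn_gt0// ltr0n fact_gt0.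
apply: ler_pM.
- by rewrite mulr_ge0 ?exprn_ge0 ?gauge_ge0.
- by [].
- apply: ler_pM; rewrite ?exprn_ge0 ?gauge_ge0//; first exact: gauge_le2X.
  by apply: lerXn2r; rewrite ?nnegrE ?gauge_ratio// ?mulr_ge0// ltW.
- exact: succ_le2X.
Qed.

End Gauge.

(** * Geometric bounds and Leibniz's formula *)

Section GeometricBounds.
Context {R : realType}.
Implicit Types (K L lam mu : R).

(** The offset [m] counts derivatives already taken: differentiating raises it by one and multiplies
    [K] by [lam], but leaves the ratio [lam] alone, so inductions over the order do not degrade the
    ratio. *)
Definition gb K lam m : nat -> R := fun k => K * lam ^+ k * (m + k)`!%:R.

Lemma gb_shift K lam m : (fun k => gb K lam m k.+1) = gb (K * lam) lam m.+1.
Proof. by apply/funext => k; rewrite /gb exprS addnS addSn; ring. Qed.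

Lemma gb_le K K' lam lam' m k : 0 <= K -> K <= K' -> 0 <= lam -> lam <= lam' ->
  gb K lam m k <= gb K' lam' m k.
Proof.
move=> K0 KK l0 ll; rewrite /gb ler_wpM2r// ler_pM// ?exprn_ge0//.
by rewrite lerXn2r// nnegrE// (le_trans l0).
Qed.

(** After division by (m + i)! (k - i)! this compares the binomial coefficients of k and of m + k
    over k - i. *)
Lemma bin_fact_le k i m : (i <= k)%N ->
  ('C(k, i) * (m + i)`! * (k - i)`! <= (m + k)`!)%N.
Proof.
move=> ik.
have E : ((m + k) - (k - i) = m + i)%N by rewrite subnBA// addnAC addnK.
have le : (k - i <= m + k)%N := leq_trans (leq_subr i k) (leq_addl m k).
rewrite -(bin_fact le) E -mulnA [((m + i)`! * _)%N]mulnC leq_mul2r -bin_sub// leq_bin2l ?orbT//.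
exact: leq_addl.
Qed.

(** Since [mu] is at most half of [lam], the terms of Leibniz's sum decay like 2^-(k - i). The whole
    sum costs a factor 2 in the constant and nothing in the ratio. *)
Lemma bconv_gb K L lam mu m k : 0 <= K -> 0 <= L -> 0 <= mu -> 2 * mu <= lam ->
  bconv (gb K lam m) (gb L mu 0) k <= gb (2 * K * L) lam m k.
Proof.
move=> K0 L0 mu0 mulam; have lam0 : 0 <= lam by apply: le_trans mulam; rewrite mulr_ge0.
rewrite /bconv.
apply: (@le_trans _ _ (\sum_(i < k.+1) K * L * lam ^+ k * (m + k)`!%:R * 2^-1 ^+ (k - i))).
  apply: ler_sum => i _; have ik : (i <= k)%N by rewrite -ltnS.
  rewrite /gb add0n.
  rewrite [leLHS](_ : _ = K * L * (lam ^+ i * mu ^+ (k - i)) * ('C(k, i) * (m + i)`! * (k - i)`!)%:R); last first.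
    by rewrite !natrM; ring.
  rewrite [leRHS](_ : _ = K * L * (lam ^+ k * 2^-1 ^+ (k - i)) * (m + k)`!%:R); last by ring.
  rewrite ler_pM//.
  - by rewrite !mulr_ge0// exprn_ge0.
  - rewrite ler_wpM2l ?mulr_ge0//.
    have -> : lam ^+ k = lam ^+ i * lam ^+ (k - i) by rewrite -exprD subnKC.
    rewrite -mulrA ler_wpM2l ?exprn_ge0//.
    rewrite -exprMn lerXn2r// ?nnegrE// ?mulr_ge0//.
    by rewrite ler_pdivlMr// mulrC.
  - by rewrite ler_nat bin_fact_le.
rewrite -mulr_sumr /gb.
rewrite [leRHS](_ : _ = K * L * lam ^+ k * (m + k)`!%:R * 2); last by ring.
rewrite ler_wpM2l// ?mulr_ge0// ?exprn_ge0//.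
rewrite -(big_mkord predT (fun i => 2^-1 ^+ (k - i))) big_nat_rev /= add0n.
elim: k => [|k IH]; first by rewrite big_nat1 subnn expr0 ler1n.
rewrite big_nat_recl// subSS subn0 subnn expr0.
rewrite (eq_big_nat _ _ (F2 := fun i => 2^-1 * 2^-1 ^+ (k - (k.+1 - i.+1)))); last first.
  move=> i /andP[_ ik]; rewrite -exprS; congr (_ ^+ _).
  by rewrite !subSS subKn// subSn ?subKn// ?leq_subr//.
rewrite -mulr_sumr; lra.
Qed.

End GeometricBounds.

(** * Compositions and solutions of differential equations *)

Definition unit_dir {R : realType} : unit -> R := fun=> 1.

Definition coord_dir {R : realType} m : 'I_m -> 'rV[R]_m := fun j => delta_mx 0 j.

Section CompositionBounds.
Context {R : realType} {V : normedModType R} {I : Type}.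
Variables (e : I -> V) (X : set V).
Hypothesis oX : open X.

Lemma CB_mul_gb n (K L lam mu : R) m F G : 0 <= K -> 0 <= L -> 0 <= mu -> 2 * mu <= lam ->
  CB e X n (gb K lam m) F -> CB e X n (gb L mu 0) G ->
  CB e X n (gb (2 * K * L) lam m) (fun q => F q * G q).
Proof.
move=> K0 L0 mu0 ml hF hG; apply: CB_ler (CB_mul oX hF hG) => k _.
exact: bconv_gb.
Qed.

(** Induction on the order in place of the formula of Faa di Bruno. Each partial derivative of [h]
    is again composed with [G], with offset b + 1 and constant K * nu; the condition m * 2 * L * nu
    <= lam pays for the m summands, the factor 2 of the product and the size L of the derivatives of
    [G]. *)
Lemma CB_comp m (Y : set 'rV[R]_m) (G : 'I_m -> V -> R) N (L mu nu lam : R) :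
  open Y -> (forall q, X q -> Y (\row_j G j q)) ->
  (forall j i q, X q -> derivable (G j) q (e i)) ->
  (forall j q, X q -> {for q, continuous (G j)}) ->
  (forall j i, CB e X N (gb L mu 0) ('D_(e i) (G j))) ->
  0 <= L -> 0 <= mu -> 0 <= nu -> 2 * mu <= lam -> m%:R * 2 * L * nu <= lam ->
  forall n b K h, (n <= N.+1)%N -> 0 <= K -> CB (@coord_dir R m) Y n (gb K nu b) h ->
  CB e X n (gb K lam b) (fun q => h (\row_j G j q)).
Proof.
move=> oY XY dG cG hG L0 mu0 nu0 mulam Llam.
have cGr q : X q -> {for q, continuous (fun q => \row_j G j q)}.
  move=> Xq; apply/cvg_ballP => r r0; near=> t.
  apply/rV_ballP => // j; rewrite !mxE.
  move: j; near: t; apply: filter_forall => j.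
  by have /cvgrPdist_lt/(_ _ r0) := cG j _ Xq.
have base b K h n : CB (@coord_dir R m) Y n (gb K nu b) h ->
    forall q, X q -> {for q, continuous (fun q => h (\row_j G j q))} /\
       `|h (\row_j G j q)| <= gb K lam b 0.
  move=> hh q Xq; split.
    apply: (cvg_comp _ _ (cGr _ Xq)).
    by apply: CB_continuous hh _; exact: XY.
  by have := CB_bound hh (XY _ Xq); rewrite /gb !expr0.
elim=> [|n IH] b K h nN K0 hh.
  by split=> //; exact: base hh.
apply: (CB_intro (F' := fun i q => \sum_(j < m) 'D_(delta_mx 0 j) h (\row_j G j q) * 'D_(e i) (G j) q)) => //.
- exact: base hh.
- move=> i q Xq; apply: (is_derive_chain (Y := Y)) => //.
  + exact: XY.
  + by move=> j y Yy; exact: CB_derivable hh Yy.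
  + by move=> j; apply: CB_continuous (CB_derive j hh) _; exact: XY.
  + by move=> j; apply: derivableP; exact: dG.
- move=> i; rewrite gb_shift.
  have K'0 : 0 <= K * nu by rewrite mulr_ge0.
  apply: (@CB_ler _ _ _ _ _ _ (fun k => \sum_(j < m) gb (2 * (K * nu) * L) lam b.+1 k)).
    move=> k _; rewrite sumr_const card_ord -mulr_natl.
    have lam0 : 0 <= lam by apply: le_trans mulam; rewrite mulr_ge0.
    rewrite /gb [leLHS](_ : _ = K * (m%:R * 2 * L * nu) * (lam ^+ k * (b.+1 + k)`!%:R)); last by ring.
    rewrite -[leRHS]mulrA ler_wpM2r ?mulr_ge0 ?exprn_ge0//.
    by rewrite ler_wpM2l.
  apply: CB_sum => // j; apply: (CB_mul_gb (mu := mu)) => //; last first.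
    by apply: CB_leq (hG j i).
  apply: (IH _ _ ('D_(delta_mx 0 j) h)) => //; first exact: ltnW.
  by rewrite -gb_shift; exact: CB_derive.
Unshelve. all: by end_near. Qed.

End CompositionBounds.

Definition pt {R : realType} (x z : R) : 'rV[R]_2 := \row_(j < 2) (if j == 0 then x else z).

(** As phi' = Q(x, phi), the derivative of F(x, phi) is F1(x, phi) with F1 = F_x + F_z Q. The
    induction thus runs over functions on the plane and requires no bounds on the derivatives of
    [phi]; each step costs a factor (1 + 2 L) * lam. *)
Lemma CB_solution {R : realType} (X : set R) (Y : set 'rV[R]_2) (phi : R -> R) (Q : 'rV[R]_2 -> R)
    N (L mu lam : R) :
  open X -> open Y -> (forall x, X x -> Y (pt x (phi x))) ->
  (forall x, X x -> is_derive x 1 phi (Q (pt x (phi x)))) ->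
  CB (@coord_dir R 2) Y N (gb L mu 0) Q -> 0 <= L -> 0 <= mu -> 2 * mu <= lam ->
  forall n b K F, (n <= N)%N -> 0 <= K ->
  CB (@coord_dir R 2) Y n (gb K lam b) F ->
  CB unit_dir X n (gb K ((1 + 2 * L) * lam) b) (fun x => F (pt x (phi x))).
Proof.
move=> oX oY XY dphi hQ L0 mu0 mulam.
have lam0 : 0 <= lam by apply: le_trans mulam; rewrite mulr_ge0.
pose G (j : 'I_2) x := if j == 0 then x else phi x.
have GE x : pt x (phi x) = \row_j G j x by apply/rowP => j; rewrite !mxE.
have dG j x : X x -> is_derive x 1 (G j) (if j == 0 then 1 else Q (pt x (phi x))).
  by move=> Xx; rewrite /G; case: ifP => _; [exact: is_derive_id|exact: dphi].
have cGr x : X x -> {for x, continuous (fun x => pt x (phi x))}.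
  move=> Xx; apply/cvg_ballP => r r0; near=> t.
  rewrite !GE; apply/rV_ballP => // j; rewrite !mxE.
  move: j; near: t; apply: filter_forall => j.
  by have /cvgrPdist_lt/(_ _ r0) := is_derive1_continuous (dG j _ Xx).
elim=> [|n IH] b K F nN K0 hF.
  split=> // x Xx; split.
    apply: (cvg_comp _ _ (cGr _ Xx)).
    by apply: CB_continuous hF _; exact: XY.
  by have := CB_bound hF (XY _ Xx); rewrite /gb !expr0.
pose F1 q := 'D_(delta_mx 0 0) F q + 'D_(delta_mx 0 1) F q * Q q.
apply: (CB_intro (F' := fun _ x => F1 (pt x (phi x)))) => //.
- move=> x Xx; split.
    apply: (cvg_comp _ _ (cGr _ Xx)).
    by apply: CB_continuous hF _; exact: XY.
  by have := CB_bound hF (XY _ Xx); rewrite /gb !expr0.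
- move=> i x Xx; rewrite {i}/unit_dir.
  have := @is_derive_chain R R 2 F Y G x 1 (fun j => if j == 0 then 1 else Q (pt x (phi x))) oY.
  rewrite -GE big_ord_recl big_ord_recl big_ord0 addr0 /=.
  rewrite (_ : lift ord0 ord0 = 1); last exact/val_inj.
  rewrite mulr1 -/(F1 _) => H.
  have -> : (fun x => F (pt x (phi x))) = (fun x => F (\row_j G j x)).
    by apply/funext => y; rewrite GE.
  apply: H => [|j y Yy|j|j].
  + exact: XY.
  + exact: CB_derivable hF Yy.
  + by apply: CB_continuous (CB_derive j hF) _; exact: XY.
  + exact: dG.
- move=> i; rewrite {i} gb_shift; apply: (IH _ _ F1); [exact: ltnW|by rewrite !mulr_ge0// addr_ge0// mulr_ge0|].
  apply: (@CB_ler _ _ _ _ _ _ (fun k => gb (K * lam) lam b.+1 k + gb (2 * (K * lam) * L) lam b.+1 k)).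
    by move=> k _; rewrite /gb le_eqVlt; apply/orP; left; apply/eqP; ring.
  apply: CB_add => //; first by rewrite -gb_shift; exact: CB_derive.
  apply: (CB_mul_gb oY (mu := mu)) => //; first by rewrite mulr_ge0.
    by rewrite -gb_shift; exact: CB_derive.
  by apply: CB_leq hQ; exact: ltnW.
Unshelve. all: by end_near. Qed.

(** * Closure properties of the class *)

Section DenjoyCarlemanClass.
Context {R : realType}.
Variable rho : nat -> R.
Hypothesis hrho : gauge rho.

Section Generic.
Context {V : normedModType R} {I : Type}.
Variable e : I -> V.
Implicit Types (X : set V) (F G : V -> R).

Definition wt (C S : R) : nat -> R := fun k => C * (S * rho k) ^+ k * k`!%:R.

Definition DC X F := exists C S, [/\ 0 < C, 0 < S & forall n, CB e X n (wt C S) F].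

Lemma CB_wt_gb X n C S F : 0 <= C -> 0 <= S ->
  CB e X n (wt C S) F -> CB e X n (gb C (S * rho n) 0) F.
Proof.
move=> C0 S0; apply: CB_ler => k kn; rewrite /wt /gb add0n.
rewrite ler_wpM2r// ler_wpM2l// lerXn2r// ?nnegrE ?mulr_ge0 ?(gauge_ge0 hrho)//.
by rewrite ler_wpM2l// (gauge_le hrho).
Qed.

(* As rho is nondecreasing, up to order n the weights are dominated by geometric
   ones with ratio S * rho n, and it suffices to bound the derivative of top order. *)
Lemma DC_gb X F : DC X F -> exists C S, [/\ 0 < C, 0 < S &
  forall n, CB e X n (gb C (S * rho n) 0) F].
Proof.
move=> [C [S [C0 S0 h]]]; exists C, S; split=> // n.
by apply: CB_wt_gb; rewrite ?ltW.
Qed.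

Lemma gb_DC X F C S : 0 <= C -> 0 <= S ->
  (forall n, CB e X n (gb C (S * rho n) 0) F) -> DC X F.
Proof.
move=> C0 S0 h; exists (C + 1), (S + 1); split; rewrite ?ltr_wpDl// => n.
apply: (@CB_ler _ _ _ _ _ _ (fun k => gb C (S * rho k) 0 k)); last exact: (CB_diag (b := fun n => gb C (S * rho n) 0) h).
move=> k _; rewrite /wt -[k in k`!]add0n; apply: gb_le; rewrite ?lerDl//.
  by rewrite mulr_ge0// (gauge_ge0 hrho).
by rewrite ler_wpM2r ?(gauge_ge0 hrho)// lerDl.
Qed.

Lemma DC_common X m (F : 'I_m -> V -> R) : (forall j, DC X (F j)) ->
  exists C S, [/\ 0 < C, 0 < S & forall j n, CB e X n (wt C S) (F j)].
Proof.
move=> h.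
pose C j := sval (cid (h j)); pose S j := sval (cid (svalP (cid (h j)))).
have hCS j : [/\ 0 < C j, 0 < S j & forall n, CB e X n (wt (C j) (S j)) (F j)].
  exact: (svalP (cid (svalP (cid (h j))))).
have sumge (A : 'I_m -> R) j : (forall j, 0 < A j) -> A j <= 1 + \sum_i A i.
  move=> A0; rewrite (bigD1 j)//= addrCA lerDl addr_ge0//.
  by apply: sumr_ge0 => i _; exact: ltW.
have C0 j : 0 < C j by case: (hCS j).
have S0 j : 0 < S j by case: (hCS j).
exists (1 + \sum_j C j), (1 + \sum_j S j); split.
- by rewrite ltr_wpDr// sumr_ge0// => j _; exact: ltW.
- by rewrite ltr_wpDr// sumr_ge0// => j _; exact: ltW.
move=> j n; have [_ _ /(_ n)] := hCS j; apply: CB_ler => k _.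
rewrite /wt -[k in k`!]add0n; apply: gb_le; rewrite ?sumge ?(ltW (C0 j))//.
  by rewrite mulr_ge0 ?(gauge_ge0 hrho)// ltW.
by rewrite ler_wpM2r ?(gauge_ge0 hrho)// sumge.
Qed.

(** The new constants depend on [C] and [S] only, not on the function or the direction; composition
    needs this uniformity for all components at once. *)
Lemma CB_wt_derive C S : 0 < C -> 0 < S -> exists L T, [/\ 0 < L, 0 < T &
  forall X F, (forall n, CB e X n (wt C S) F) ->
  forall i n, CB e X n (wt L T) ('D_(e i) F)].
Proof.
move=> C0 S0; have [L [T [L0 T0 h]]] := gauge_shift hrho C0 S0.
exists L, T; split=> // X F hF i n.
apply: CB_ler (CB_derive i (hF n.+1)) => k _; exact: h.
Qed.

Lemma DC_derive X F i : DC X F -> DC X ('D_(e i) F).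
Proof.
move=> [C [S [C0 S0 h]]]; have [L [T [L0 T0 /(_ _ _ h) {}h]]] := CB_wt_derive C0 S0.
by exists L, T.
Qed.

Lemma DC_continuous X F q : DC X F -> X q -> {for q, continuous F}.
Proof. by move=> [C [S [_ _ h]]]; exact: CB_continuous (h 0%N). Qed.

Lemma DC_derivable X F q i : DC X F -> X q -> derivable F q (e i).
Proof. by move=> [C [S [_ _ h]]]; exact: CB_derivable (h 1%N). Qed.

Lemma DC_bounded X F : DC X F -> exists2 B, 0 < B & forall q, X q -> `|F q| <= B.
Proof.
move=> [C [S [C0 _ h]]]; exists C => // q Xq.
by have := CB_bound (h 0%N) Xq; rewrite /wt expr0 fact0 !mulr1.
Qed.

Lemma DC_subset X Y F : Y `<=` X -> DC X F -> DC Y F.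
Proof.
move=> YX [C [S [C0 S0 h]]]; exists C, S; split=> // n; exact: CB_subset (h n).
Qed.

Lemma DC_ext X F G : open X -> (forall q, X q -> F q = G q) -> DC X F -> DC X G.
Proof.
move=> oX FG [C [S [C0 S0 h]]]; exists C, S; split=> // n; exact: CB_ext FG (h n).
Qed.

Lemma DC_cst X c : DC X (cst c).
Proof.
apply: (@gb_DC _ _ `|c| 1) => // n; apply: CB_cst.
  by rewrite /gb expr0 addn0 fact0 !mulr1.
by move=> k; rewrite /gb !mulr_ge0// exprn_ge0// mul1r (gauge_ge0 hrho).
Qed.

Lemma DC_add X F G : open X -> DC X F -> DC X G -> DC X (fun q => F q + G q).
Proof.
move=> oX [C [S [C0 S0 h]]] [C' [S' [C'0 S'0 h']]].
exists (C + C'), (S + S'); split; rewrite ?addr_gt0// => n.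
apply: CB_ler (CB_add oX (h n) (h' n)) => k _.
rewrite /wt !mulrDl lerD// ler_wpM2r// ler_wpM2l ?(ltW C0) ?(ltW C'0)//;
 apply: lerXn2r; rewrite ?nnegrE -?mulrDl ?mulr_ge0 ?(gauge_ge0 hrho) ?addr_ge0 ?(ltW S0) ?(ltW S'0)//;
 rewrite ler_wpM2r ?(gauge_ge0 hrho)// ?lerDl ?lerDr ltW//.
Qed.

Lemma DC_mul X F G : open X -> DC X F -> DC X G -> DC X (fun q => F q * G q).
Proof.
move=> oX /DC_gb[C [S [C0 S0 h]]] /DC_gb[C' [S' [C'0 S'0 h']]].
apply: (@gb_DC _ _ (2 * C * C') (S + 2 * S')).
- by rewrite !mulr_ge0// ltW.
- by rewrite addr_ge0// ?mulr_ge0// ltW.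
move=> n; apply: (CB_mul_gb oX (mu := S' * rho n)); rewrite ?(ltW C0) ?(ltW C'0)//.
- by rewrite mulr_ge0 ?(gauge_ge0 hrho)// ltW.
- by rewrite [leRHS]mulrDl mulrA lerDr mulr_ge0 ?(gauge_ge0 hrho)// ltW.
apply: CB_ler (h n) => k _; apply: gb_le; rewrite ?(ltW C0)//.
  by rewrite mulr_ge0 ?(gauge_ge0 hrho)// ltW.
by rewrite ler_wpM2r ?(gauge_ge0 hrho)// lerDl mulr_ge0// ltW.
Qed.

Lemma DC_opp X F : open X -> DC X F -> DC X (fun q => - F q).
Proof.
move=> oX hF; apply: DC_ext (DC_mul oX (DC_cst X (-1)) hF) => // q _.
by rewrite /= mulN1r.
Qed.

Lemma DC_exp X F n : open X -> DC X F -> DC X (fun q => F q ^+ n).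
Proof.
move=> oX hF; elim: n => [|n IH]; first exact: DC_ext (DC_cst X 1).
by apply: DC_ext (DC_mul oX hF IH) => // q _; rewrite exprS.
Qed.

Lemma DC_const_derive X F (c : I -> R) A : open X ->
  (forall q, X q -> {for q, continuous F} /\ `|F q| <= A) ->
  (forall i q, X q -> is_derive q (e i) F (c i)) -> (forall i, `|c i| <= A) ->
  0 <= A -> DC X F.
Proof.
move=> oX h hd hc A0; have r0 := gauge_gt0 hrho 0.
(* With this ratio the first-order bound is [A] times a quotient rho n / rho 0, which is at least
   1. *)
apply: (@gb_DC _ _ A (rho 0)^-1) => //; first by rewrite invr_ge0 ltW.
case=> [|n].
  by split=> // q Xq; rewrite /gb expr0 !mulr1; exact: h.
apply: (CB_intro (F' := fun i => cst (c i))) => //.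
  by move=> q Xq; rewrite /gb expr0 !mulr1; exact: h.
move=> i; apply: CB_cst => [|k].
  rewrite /gb expr1 mulr1 (le_trans (hc i))// ler_peMr//.
  by rewrite mulrC ler_pdivlMr// mul1r (gauge_le hrho).
by rewrite /gb !mulr_ge0// exprn_ge0// mulr_ge0 ?(gauge_ge0 hrho)// invr_ge0 ltW.
Qed.

(** Up to order n the data have geometric ratios proportional to rho n. The ratio that [CB_comp]
    requires is linear in them, hence again a constant times rho n, and the diagonal argument
    returns to the class. *)
Lemma DC_comp X m (Y : set 'rV[R]_m) (h : 'rV[R]_m -> R) (G : 'I_m -> V -> R) :
  open X -> open Y -> (forall q, X q -> Y (\row_j G j q)) ->
  (forall j, DC X (G j)) ->
  (exists C S, [/\ 0 < C, 0 < S & forall n, CB (@coord_dir R m) Y n (wt C S) h]) ->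
  DC X (fun q => h (\row_j G j q)).
Proof.
move=> oX oY XY hG [C [S [C0 S0 hh]]].
have [CG [SG [CG0 SG0 hGb]]] := DC_common hG.
have [L [T [L0 T0 hD]]] := CB_wt_derive CG0 SG0.
pose A := 2 * T + m%:R * 2 * L * S.
have P0 : 0 <= m%:R * 2 * L * S by rewrite !mulr_ge0// ltW.
apply: (@gb_DC _ _ C A) => [||n]; rewrite ?(ltW C0)//.
  by rewrite addr_ge0// mulr_ge0// ltW.
have rn := gauge_ge0 hrho n.
apply: (CB_comp (Y := Y) (N := n) (L := L) (mu := T * rho n) (nu := S * rho n) oX oY XY) => //.
- by move=> j i q Xq; exact: DC_derivable (hG j) Xq.
- by move=> j q Xq; exact: DC_continuous (hG j) Xq.
- move=> j i; apply: CB_wt_gb; rewrite ?(ltW L0) ?(ltW T0)//; exact: hD.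
- exact: ltW.
- by rewrite mulr_ge0// ltW.
- by rewrite mulr_ge0// ltW.
- by rewrite /A [leRHS]mulrDl mulrA lerDl mulr_ge0.
- by rewrite /A [leRHS]mulrDl !mulrA lerDr !mulr_ge0// ltW.
- exact: ltW.
- have := hh n; apply: CB_ler => k kn; rewrite /wt /gb add0n.
  rewrite ler_wpM2r// ler_wpM2l ?(ltW C0)//.
  rewrite lerXn2r// ?nnegrE ?mulr_ge0 ?(gauge_ge0 hrho) ?(ltW S0)//.
  by rewrite ler_wpM2l ?(ltW S0)// (gauge_le hrho).
Qed.

End Generic.

Lemma open_norm_gt (r : R) : open [set y : 'rV[R]_1 | r < `|y 0 0|].
Proof.
have cn : continuous (fun y : 'rV[R]_1 => `|y 0 0|).
  move=> y; apply: (cvg_comp (fun y : 'rV[R]_1 => y 0 0) Num.norm).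
    exact: coord_continuous.
  exact: norm_continuous.
by apply: (@open_comp _ _ (fun y : 'rV[R]_1 => `|y 0 0|) [set t | r < t]) => //; exact: open_gt.
Qed.

(** Differentiating c y^-(b+1) multiplies c by -(b+1) and raises the exponent; these factors build
    up exactly the factorial with offset [b] in [gb]. *)
Lemma CB_inv_pow (r : R) n b (K c : R) : 0 < r -> 0 <= K -> `|c| <= K * b`!%:R ->
  CB (@coord_dir R 1) [set y : 'rV[R]_1 | r < `|y 0 0|] n (gb (K * r^-1 ^+ b.+1) r^-1 b)
    (fun y => c * (y 0 0)^-1 ^+ b.+1).
Proof.
move=> r0; have oY := @open_norm_gt r.
have neq0 (y : 'rV[R]_1) : r < `|y 0 0| -> y 0 0 != 0.
  by move=> ry; rewrite -normr_gt0 (lt_trans r0).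
have base b' (K' c' : R) : 0 <= K' -> `|c'| <= K' * b'`!%:R ->
   forall q : 'rV[R]_1, r < `|q 0 0| ->
   {for q, continuous (fun y : 'rV[R]_1 => c' * (y 0 0)^-1 ^+ b'.+1)} /\
   `|c' * (q 0 0)^-1 ^+ b'.+1| <= gb (K' * r^-1 ^+ b'.+1) r^-1 b' 0.
  move=> K0 cK q rq; split.
    have cq : {for q, continuous (fun y : 'rV[R]_1 => (y 0 0)^-1)}.
      apply: (cvg_comp (fun y : 'rV[R]_1 => y 0 0) GRing.inv).
        exact: coord_continuous.
      by apply: inv_continuous; exact: neq0.
    have cX : {for q, continuous (fun y : 'rV[R]_1 => (y 0 0)^-1 ^+ b'.+1)}.
      apply: (cvg_comp (fun y : 'rV[R]_1 => (y 0 0)^-1) (fun t => t ^+ b'.+1)); first exact: cq.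
      exact: exprn_continuous.
    exact: (cvgM (cvg_cst c') cX).
  rewrite /gb expr0 mulr1 addn0 normrM normrX normfV mulrAC ler_pM ?exprn_ge0 ?invr_ge0//.
  rewrite lerXn2r// ?nnegrE ?invr_ge0 ?(ltW r0)// lef_pV2 ?posrE//; first exact: ltW.
  exact: lt_trans rq.
elim: n b K c => [|n IH] b K c K0 cK.
  by split=> // q; exact: base.
apply: (CB_intro (e := @coord_dir R 1) (F' := fun (_ : 'I_1) (y : 'rV[R]_1) => (- (b.+1%:R * c)) * (y 0 0)^-1 ^+ b.+2)) => //.
- by move=> q; exact: base.
- move=> i q rq; rewrite (ord1 i) /coord_dir.
  have q0 := neq0 _ rq.
  have dcoord : is_derive q (delta_mx 0 0 : 'rV[R]_1) (fun y : 'rV[R]_1 => y 0 0) 1.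
    have E : (fun t : R => t^-1 *: ((t *: (delta_mx 0 0 : 'rV[R]_1) + q) 0 0 - q 0 0)) @ 0^' --> (1 : R).
      apply: (@cvg_trans _ ((cst (1 : R)) @ 0^')); last exact: cvg_cst.
      apply: near_eq_cvg; near=> t; rewrite !mxE mulr1 addrK.
      by rewrite -[_ *: _]/(_ * _) mulVf//; near: t; exact: nbhs_dnbhs_neq.
    by apply: DeriveDef; [apply/cvg_ex; exists 1|apply/cvg_lim].
  have [dV eV] : is_derive q (delta_mx 0 0 : 'rV[R]_1) (fun y : 'rV[R]_1 => (y 0 0)^-1) (- (q 0 0)^-2).
    have := @derivableV _ _ (fun y : 'rV[R]_1 => y 0 0) q (delta_mx 0 0) q0.
    case: dcoord => d1 d2 /(_ d1) dd; apply: DeriveDef => //.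
    by rewrite (deriveV q0 d1) d2 -[_ *: _]/(_ * _) mulr1.
  have dX := @derivableX _ _ (fun y : 'rV[R]_1 => (y 0 0)^-1) b.+1 q (delta_mx 0 0) dV.
  have E : (fun y : 'rV[R]_1 => c * (y 0 0)^-1 ^+ b.+1) = c *: ((fun y : 'rV[R]_1 => (y 0 0)^-1) ^+ b.+1).
    apply/funext => y; rewrite [RHS]/(_ * _); congr (_ * _).
    by elim: b.+1 => [|k IHk]; rewrite ?expr0// !exprS IHk.
  rewrite E; apply: DeriveDef; first exact: derivableZ.
  rewrite deriveZ// deriveX// eV -[c *: _]/(_ * _) -[(_ * _) *: _]/(_ * _) -mulr_natl [in RHS]exprS [in RHS]exprS /=.
  by rewrite exprVn expr2 invfM; ring.
- move=> i; rewrite gb_shift.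
  rewrite (_ : K * r^-1 ^+ b.+1 * r^-1 = K * r^-1 ^+ b.+2); last by rewrite [in RHS]exprSr mulrA.
  apply: IH => //; rewrite normrN normrM factS natrM mulrCA.
  by rewrite ger0_norm// ler_wpM2l.
Unshelve. all: by end_near. Qed.

Lemma DC_inv {V : normedModType R} {I : Type} (e : I -> V) (X : set V) (u : V -> R) r :
  open X -> 0 < r -> (forall q, X q -> r < `|u q|) -> DC e X u -> DC e X (fun q => (u q)^-1).
Proof.
move=> oX r0 ur hu.
have := @DC_comp _ _ e X 1 [set y | r < `|y 0 0|] (fun y => (y 0 0)^-1) (fun _ => u) oX (@open_norm_gt r).
rewrite (_ : (fun q => ((\row_(j < 1) u q) 0 0)^-1) = fun q => (u q)^-1); last first.
  by apply/funext => q; rewrite mxE.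
apply => //; first by move=> q Xq /=; rewrite mxE; exact: ur.
have : DC (@coord_dir R 1) [set y : 'rV[R]_1 | r < `|y 0 0|] (fun y : 'rV[R]_1 => (y 0 0)^-1).
  have ri0 : 0 <= r^-1 by rewrite invr_ge0 ltW.
  have rho0 := gauge_gt0 hrho 0.
  apply: (@gb_DC _ _ _ _ _ r^-1 (r^-1 / rho 0)) => //; first by rewrite mulr_ge0// invr_ge0 ltW.
  move=> n; have := @CB_inv_pow r n 0 1 1 r0 ler01.
  rewrite normr1 fact0 mulr1 lexx => /(_ isT).
  rewrite (_ : (fun y : 'rV[R]_1 => 1 * (y 0 0)^-1 ^+ 1) = fun y : 'rV[R]_1 => (y 0 0)^-1); last first.
    by apply/funext => y; rewrite mul1r expr1.
  apply: CB_ler => k _; rewrite mul1r expr1; apply: gb_le => //.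
  by rewrite -mulrA ler_peMr// mulrC ler_pdivlMr// mul1r (gauge_le hrho).
by [].
Qed.

Lemma DC_coord (X : set 'rV[R]_2) j : open X -> X `<=` ball 0 1 ->
  DC (@coord_dir R 2) X (fun q => q 0 j).
Proof.
move=> oX X1; apply: (DC_const_derive (c := fun i => (i == j)%:R) (A := 1)) => //.
- move=> q Xq; split; first exact: coord_continuous.
  have := X1 _ Xq; rewrite -ball_normE /ball_ /= sub0r normrN => /ltW.
  by apply: le_trans; exact: rV_coord_le.
- move=> i q Xq.
  have E : (fun t : R => t^-1 *: ((t *: @coord_dir R 2 i + q) 0 j - q 0 j)) @ 0^' --> ((i == j)%:R : R).
    apply: (@cvg_trans _ ((cst ((i == j)%:R : R)) @ 0^')); last exact: cvg_cst.
    apply: near_eq_cvg; near=> t; rewrite !mxE eqxx /= addrK eq_sym.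
    rewrite -[_ *: _]/(_ * _) mulrA mulVf ?mul1r//; near: t; exact: nbhs_dnbhs_neq.
  by apply: DeriveDef; [apply/cvg_ex; exists (i == j)%:R|apply/cvg_lim].
- by move=> i; case: eqP; rewrite ?normr1 ?normr0.
Unshelve. all: by end_near. Qed.

Lemma DC_id (X : set R) A : open X -> (forall x, X x -> `|x| <= A) -> 1 <= A ->
  DC unit_dir X (fun x => x).
Proof.
move=> oX XA A1; apply: (DC_const_derive (c := fun=> 1) (A := A)) => //.
- by move=> q Xq; split; [exact: cvg_id|exact: XA].
- by rewrite normr1.
- exact: le_trans A1.
Qed.

End DenjoyCarlemanClass.

Lemma continuous_dist {R : realType} {V : normedModType R} (F : V -> R) q :
  (forall e, 0 < e -> exists d, 0 < d /\ forall q', ball q d q' -> `|F q - F q'| < e) ->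
  {for q, continuous F}.
Proof.
move=> h; apply/cvgrPdist_lt => e /h[d [d0 hd]]; near=> q'; apply: hd.
by near: q'; exact: nbhsx_ballx.
Unshelve. all: by end_near. Qed.

(** * Division by the first coordinate *)

Section Plane.
Context {R : realType}.
Implicit Types (q : 'rV[R]_2) (F G : 'rV[R]_2 -> R).

Local Notation e0 := (@coord_dir R 2 0).
Local Notation e1 := (@coord_dir R 2 1).

Lemma ord2P (j : 'I_2) : j = 0 \/ j = 1.
Proof. by case: j => -[|[|//]] h; [left|right]; exact/val_inj. Qed.

Lemma pt0 (x z : R) : pt x z 0 0 = x. Proof. by rewrite mxE. Qed.
Lemma pt1 (x z : R) : pt x z 0 1 = z. Proof. by rewrite mxE. Qed.

Lemma ptE q : pt (q 0 0) (q 0 1) = q.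
Proof. by apply/rowP => j; rewrite mxE; case: (ord2P j) => ->. Qed.

Lemma plane_ballP (p q : 'rV[R]_2) (r : R) : 0 < r ->
  ball p r q <-> `|p 0 0 - q 0 0| < r /\ `|p 0 1 - q 0 1| < r.
Proof.
move=> r0; rewrite rV_ballP//; split=> [h|[h0 h1] j]; first by split.
by case: (ord2P j) => ->.
Qed.

Lemma pt_ball (r x z : R) : 0 < r -> ball 0 r (pt x z) <-> `|x| < r /\ `|z| < r.
Proof. by move=> r0; rewrite plane_ballP// !mxE !sub0r !normrN. Qed.

Lemma pt_ball_le (r : R) q (x z : R) : 0 < r -> ball 0 r q -> `|x| <= `|q 0 0| -> `|z| <= `|q 0 1| ->
  ball 0 r (pt x z).
Proof.
move=> r0; rewrite -{1}(ptE q) pt_ball// => -[h0 h1] hx hz; apply/pt_ball => //.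
by split; [exact: le_lt_trans h0|exact: le_lt_trans h1].
Qed.

Lemma add_e0 (h : R) q : h *: e0 + q = pt (h + q 0 0) (q 0 1).
Proof.
by apply/rowP => j; rewrite !mxE; case: (ord2P j) => -> /=; rewrite ?mulr1 ?mulr0 ?add0r.
Qed.

Lemma add_e1 (h : R) q : h *: e1 + q = pt (q 0 0) (h + q 0 1).
Proof.
by apply/rowP => j; rewrite !mxE; case: (ord2P j) => -> /=; rewrite ?mulr1 ?mulr0 ?add0r.
Qed.

Lemma is_derive_e0 G q (d : R) :
  is_derive q e0 G d <-> is_derive (q 0 0) 1 (fun t => G (pt t (q 0 1))) d.
Proof.
have E : (fun h : R => h^-1 *: (G (h *: e0 + q) - G q)) =
         (fun h : R => h^-1 *: (G (pt (h *: 1 + q 0 0) (q 0 1)) - G (pt (q 0 0) (q 0 1)))).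
  by apply/funext => h; rewrite add_e0 ptE [h *: 1]mulr1.
split=> -[h1 h2].
  by apply: DeriveDef; [rewrite /derivable -E|rewrite /derive -E].
by apply: DeriveDef; [rewrite /derivable E|rewrite /derive E].
Qed.

Lemma is_derive_e1 G q (d : R) :
  is_derive q e1 G d <-> is_derive (q 0 1) 1 (fun t => G (pt (q 0 0) t)) d.
Proof.
have E : (fun h : R => h^-1 *: (G (h *: e1 + q) - G q)) =
         (fun h : R => h^-1 *: (G (pt (q 0 0) (h *: 1 + q 0 1)) - G (pt (q 0 0) (q 0 1)))).
  by apply/funext => h; rewrite add_e1 ptE [h *: 1]mulr1.
split=> -[h1 h2].
  by apply: DeriveDef; [rewrite /derivable -E|rewrite /derive -E].
by apply: DeriveDef; [rewrite /derivable E|rewrite /derive E].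
Qed.

Lemma continuous_pt (T : topologicalType) (f g : T -> R) t :
  {for t, continuous f} -> {for t, continuous g} ->
  {for t, continuous (fun t => pt (f t) (g t))}.
Proof.
move=> cf cg; apply/cvg_ballP => r r0; near=> u.
apply/plane_ballP => //; rewrite !mxE /=; split; near: u.
  by have /cvgrPdist_lt/(_ _ r0) := cf.
by have /cvgrPdist_lt/(_ _ r0) := cg.
Unshelve. all: by end_near. Qed.

Lemma ball_shrink (q p : 'rV[R]_2) (del : R) : 0 < del -> ball 0 del q -> `|p| <= `|q| ->
  forall y, ball p (del - `|q|) y -> ball 0 del y.
Proof.
move=> d0 + pq y; rewrite -!ball_normE /ball_ /= !sub0r !normrN => qd.
rewrite ltrBrDr => h; apply: le_lt_trans h.
rewrite -{1}(subrK p y) (le_trans (ler_normD _ _))// lerD// distrC//.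
Qed.

Local Notation mu := (@lebesgue_measure R).

(** For [a] = 0, applied to the x-derivative of a function vanishing on the axis, this is the
    quotient by x in Hadamard's lemma. The exponent [a] counts later x-derivatives, each of which
    brings out one factor s. *)
Definition hadamard a F q : R :=
  \int[mu]_(s in `[0, 1]) (s ^+ a * F (pt (s * q 0 0) (q 0 1))).

Variables (del : R).
Hypothesis del0 : 0 < del.
Local Notation X := (ball (0 : 'rV[R]_2) del).

Lemma scale_ball q s : X q -> 0 <= s <= 1 -> X (pt (s * q 0 0) (q 0 1)).
Proof.
move=> Xq /andP[s0 s1]; apply: pt_ball_le Xq _ _ => //.
by rewrite normrM ger0_norm// ler_piMl.
Qed.

Lemma hadamard_integrable a F q : (forall q, X q -> {for q, continuous F}) -> X q ->
  mu.-integrable `[0, 1] (EFin \o (fun s => s ^+ a * F (pt (s * q 0 0) (q 0 1)))).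
Proof.
move=> cF Xq; apply: continuous_compact_integrable; first exact: segment_compact.
apply: continuous_in_subspaceT => s /set_mem /=; rewrite in_itv /= => s01.
have c1 : {for s, continuous (fun s : R => pt (s * q 0 0) (q 0 1))}.
  apply: continuous_pt; last exact: cvg_cst.
  by apply: cvgM; [exact: cvg_id|exact: cvg_cst].
have c2 : {for s, continuous (fun s : R => F (pt (s * q 0 0) (q 0 1)))}.
  by apply: (cvg_comp _ _ c1); apply: cF; exact: scale_ball.
exact: (cvgM (@exprn_continuous _ a s) c2).
Qed.

Lemma integrable_cst01 (B : R) : mu.-integrable `[0, 1] (EFin \o cst B).
Proof.
apply: continuous_compact_integrable; first exact: segment_compact.
by apply: continuous_subspaceT => x; exact: cvg_cst.
Qed.

Lemma Rintegral01_cst (B : R) : \int[mu]_(s in `[0, 1]) B = B.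
Proof.
by rewrite Rintegral_cst//= lebesgue_measure_itv /= lte01 oppr0 adde0 mulr1.
Qed.

Lemma Rintegral01_bound (f : R -> R) B : mu.-integrable `[0, 1] (EFin \o f) ->
  (forall s, 0 <= s <= 1 -> `|f s| <= B) -> `|\int[mu]_(s in `[0, 1]) f s| <= B.
Proof.
move=> fi fB; apply: (le_trans (le_normr_Rintegral _ fi)) => //.
rewrite -[leRHS]Rintegral01_cst; apply: le_Rintegral => //.
- exact: (integrable_norm fi).
- exact: integrable_cst01.
Qed.

Lemma hadamard_bound a F q B : (forall q, X q -> {for q, continuous F}) ->
  (forall q, X q -> `|F q| <= B) -> X q -> `|hadamard a F q| <= B.
Proof.
move=> cF FB Xq; apply: Rintegral01_bound; first exact: hadamard_integrable.
move=> s s01; rewrite normrM -[leRHS]mul1r ler_pM//.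
  have /andP[s0 s1] := s01; rewrite ger0_norm ?exprn_ge0// exprn_ile1//.
by apply: FB; exact: scale_ball.
Qed.

(** The bound on the first derivatives makes the integrand Lipschitz near [q], uniformly in s, hence
    the integral as well. *)
Lemma hadamard_continuous a F q B :
  (forall q, X q -> {for q, continuous F}) ->
  (forall q j, X q -> derivable F q (coord_dir j) /\ `|'D_(coord_dir j) F q| <= B) ->
  X q -> {for q, continuous (hadamard a F)}.
Proof.
move=> cF dF Xq.
have B0 : 0 <= B by apply: (le_trans (normr_ge0 _) (dF q 0 Xq).2).
have r0 : 0 < del - `|q|.
  by rewrite subr_gt0; move: Xq; rewrite -ball_normE /ball_ /= sub0r normrN.
have lip q' : ball q (del - `|q|) q' -> `|hadamard a F q - hadamard a F q'| <= 2 * B * `|q - q'|.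
  move=> qq'; have Xq' : X q' by apply: (@ball_shrink q q).
  rewrite /hadamard -RintegralB//; try exact: hadamard_integrable.
  apply: Rintegral01_bound.
    rewrite (_ : _ \o _ = ((EFin \o (fun s : R => (s ^+ a * F (pt (s * q 0 0) (q 0 1)))%R)) \-
      (EFin \o (fun s : R => (s ^+ a * F (pt (s * q' 0 0) (q' 0 1)))%R)))%E); last exact/funext.
    by apply: integrableB => //; exact: hadamard_integrable.
  move=> s s01; rewrite -mulrBr normrM -[leRHS]mul1r ler_pM//.
    have /andP[s0 s1] := s01; rewrite ger0_norm ?exprn_ge0// exprn_ile1//.
  set p := pt (s * q 0 0) _; set p' := pt (s * q' 0 0) _.
  have pp' : `|p - p'| <= `|q - q'|.
    apply: rV_norm_le => // j; rewrite !mxE; case: (ord2P j) => -> /=.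
      rewrite -mulrBr normrM; have /andP[s0 s1] := s01; rewrite ger0_norm//.
      rewrite (le_trans (ler_piMl _ s1))//.
      by have := rV_coord_le (q - q') 0; rewrite !mxE.
    by have := rV_coord_le (q - q') 1; rewrite !mxE.
  have pq : `|p| <= `|q|.
    apply: rV_norm_le => // j; rewrite !mxE; case: (ord2P j) => -> /=.
      rewrite normrM; have /andP[s0 s1] := s01; rewrite ger0_norm//.
      by rewrite (le_trans (ler_piMl _ s1))// rV_coord_le.
    exact: rV_coord_le.
  have sub := ball_shrink del0 Xq pq.
  have bp : ball p (del - `|q|) p'.
    by move: qq'; rewrite -!ball_normE /ball_ /=; exact: le_lt_trans.
  have [xi [xi1 E]] := mean_value_rV (fun y j (hy : ball p (del - `|q|) y) => (dF y j (sub y hy)).1) bp.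
  rewrite distrC E (le_trans (ler_norm_sum _ _ _))//.
  apply: (@le_trans _ _ (\sum_(j < 2) B * `|q - q'|)); last first.
    by rewrite !big_ord_recl big_ord0 addr0 -[leRHS]mulrA [leRHS]mulr_natl mulr2n.
  apply: ler_sum => j _; rewrite normrM ler_pM//.
    apply: (dF _ j _).2; apply: sub; move: bp; rewrite -!ball_normE /ball_ /=.
    by apply: le_lt_trans.
  apply: le_trans pp'; rewrite distrC.
  by have := rV_coord_le (p - p') j; rewrite !mxE.
apply: continuous_dist => ep ep0.
have K0 : 0 < 2 * B + 1 by rewrite ltr_wpDl// mulr_ge0.
exists (Num.min (del - `|q|) (ep / (2 * B + 1))).
split; first by rewrite lt_min r0 divr_gt0.
move=> q' bq; apply: le_lt_trans (lip _ _) _.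
  by apply: le_ball bq; rewrite ge_min lexx.
apply: (@le_lt_trans _ _ ((2 * B + 1) * `|q - q'|)).
  by rewrite ler_wpM2r// lerDl.
rewrite mulrC -ltr_pdivlMr//; move: bq; rewrite -ball_normE /ball_ /=.
by move=> /lt_le_trans; apply; rewrite ge_min lexx orbT.
Qed.

Lemma hadamard_derive0 a F q B : (forall q, X q -> {for q, continuous F}) ->
  (forall q, X q -> derivable F q e0 /\ `|'D_e0 F q| <= B) -> X q ->
  is_derive q e0 (hadamard a F) (hadamard a.+1 ('D_e0 F) q).
Proof.
move=> cF dF Xq; apply/is_derive_e0.
have B0 : 0 <= B by apply: (le_trans (normr_ge0 _) (dF q Xq).2).
have [q0 q1] : `|q 0 0| < del /\ `|q 0 1| < del by apply/pt_ball => //; rewrite ptE.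
pose f (x s : R) := s ^+ a * F (pt (s * x) (q 0 1)).
have Xx x : `]-del, del[%classic x -> X (pt x (q 0 1)).
  by rewrite /= in_itv /= -ltr_norml => xd; apply/pt_ball.
have df x s : `]-del, del[%classic x -> `[0, 1]%classic s ->
    is_derive x 1 (f ^~ s) (s ^+ a.+1 * 'D_e0 F (pt (s * x) (q 0 1))).
  move=> /Xx Xp; rewrite /= in_itv /= => s01.
  have Xs := scale_ball Xp s01; rewrite !mxE /= in Xs.
  have /derivableP/is_derive_e0 := (dF _ Xs).1; rewrite !mxE /= => D1.
  have D2 : is_derive x 1 (fun x => s * x) s.
    by apply: is_derive_eq; rewrite -[_ *: _]/(_ * _) mulr1.
  have D3 := is_derive1_comp D1 D2.
  have D4 := is_deriveZ (s ^+ a) D3.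
  by apply: (is_derive_eq D4); rewrite -[_ *: _]/(_ * _) exprSr; ring.
have Iq : `]-del, del[%classic (q 0 0) by rewrite /= in_itv /= -ltr_norml.
have intf x : `]-del, del[%classic x -> mu.-integrable `[0, 1] (EFin \o f x).
  move=> /Xx Xp; have := hadamard_integrable a cF Xp.
  by rewrite pt0 pt1.
have derf1 x s : `]-del, del[%classic x -> `[0, 1]%classic s -> derivable (f ^~ s) x 1.
  by move=> hx hs; have [] := df _ _ hx hs.
have Gub x s : `]-del, del[%classic x -> `[0, 1]%classic s -> `|partial1of2 f x s| <= cst B s.
  move=> hx hs; rewrite /= partial1of2E; have [_ ->] := df _ _ hx hs.
  move: (hs); rewrite /= in_itv /= => s01; rewrite normrM -[leRHS]mul1r ler_pM//.
    have /andP[s0 s1] := s01; rewrite ger0_norm ?exprn_ge0// exprn_ile1//.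
  by have := (dF _ (scale_ball (Xx _ hx) s01)).2; rewrite pt0 pt1.
have D : derivable (fun x => \int[mu]_(s in `[0, 1]) f x s) (q 0 0) 1.
  exact: (derivable_under_integral _ Iq intf derf1 (fun=> B0) (integrable_cst01 B) Gub).
have E : derive1 (fun x => \int[mu]_(s in `[0, 1]) f x s) (q 0 0) =
    \int[mu]_(s in `[0, 1]) (partial1of2 f ^~ s) (q 0 0).
  exact: (differentiation_under_integral _ Iq intf derf1 (fun=> B0) (integrable_cst01 B) Gub).
have HE : (fun t => hadamard a F (pt t (q 0 1))) = (fun x => \int[mu]_(s in `[0, 1]) f x s).
  by apply/funext => t; rewrite /hadamard pt0 pt1.
rewrite HE; apply: DeriveDef; first exact: D.
rewrite -derive1E E; apply: eq_Rintegral => s /set_mem hs.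
by rewrite partial1of2E; have [_ ->] := df _ _ Iq hs.
Qed.

Lemma hadamard_derive1 a F q B : (forall q, X q -> {for q, continuous F}) ->
  (forall q, X q -> derivable F q e1 /\ `|'D_e1 F q| <= B) -> X q ->
  is_derive q e1 (hadamard a F) (hadamard a ('D_e1 F) q).
Proof.
move=> cF dF Xq; apply/is_derive_e1.
have B0 : 0 <= B by apply: (le_trans (normr_ge0 _) (dF q Xq).2).
have [q0 q1] : `|q 0 0| < del /\ `|q 0 1| < del by apply/pt_ball => //; rewrite ptE.
pose f (x s : R) := s ^+ a * F (pt (s * q 0 0) x).
have Xx x : `]-del, del[%classic x -> X (pt (q 0 0) x).
  by rewrite /= in_itv /= -ltr_norml => xd; apply/pt_ball.
have df x s : `]-del, del[%classic x -> `[0, 1]%classic s ->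
    is_derive x 1 (f ^~ s) (s ^+ a * 'D_e1 F (pt (s * q 0 0) x)).
  move=> /Xx Xp; rewrite /= in_itv /= => s01.
  have Xs := scale_ball Xp s01; rewrite !mxE /= in Xs.
  have /derivableP/is_derive_e1 := (dF _ Xs).1; rewrite !mxE /= => D1.
  have D4 := is_deriveZ (s ^+ a) D1.
  by apply: (is_derive_eq D4).
have Iq : `]-del, del[%classic (q 0 1) by rewrite /= in_itv /= -ltr_norml.
have intf x : `]-del, del[%classic x -> mu.-integrable `[0, 1] (EFin \o f x).
  move=> /Xx Xp; have := hadamard_integrable a cF Xp.
  by rewrite pt0 pt1.
have derf1 x s : `]-del, del[%classic x -> `[0, 1]%classic s -> derivable (f ^~ s) x 1.
  by move=> hx hs; have [] := df _ _ hx hs.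
have Gub x s : `]-del, del[%classic x -> `[0, 1]%classic s -> `|partial1of2 f x s| <= cst B s.
  move=> hx hs; rewrite /= partial1of2E; have [_ ->] := df _ _ hx hs.
  move: (hs); rewrite /= in_itv /= => s01; rewrite normrM -[leRHS]mul1r ler_pM//.
    have /andP[s0 s1] := s01; rewrite ger0_norm ?exprn_ge0// exprn_ile1//.
  by have := (dF _ (scale_ball (Xx _ hx) s01)).2; rewrite pt0 pt1.
have D : derivable (fun x => \int[mu]_(s in `[0, 1]) f x s) (q 0 1) 1.
  exact: (derivable_under_integral _ Iq intf derf1 (fun=> B0) (integrable_cst01 B) Gub).
have E : derive1 (fun x => \int[mu]_(s in `[0, 1]) f x s) (q 0 1) =
    \int[mu]_(s in `[0, 1]) (partial1of2 f ^~ s) (q 0 1).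
  exact: (differentiation_under_integral _ Iq intf derf1 (fun=> B0) (integrable_cst01 B) Gub).
have HE : (fun t => hadamard a F (pt (q 0 0) t)) = (fun x => \int[mu]_(s in `[0, 1]) f x s).
  by apply/funext => t; rewrite /hadamard pt0 pt1.
rewrite HE; apply: DeriveDef; first exact: D.
rewrite -derive1E E; apply: eq_Rintegral => s /set_mem hs.
by rewrite partial1of2E; have [_ ->] := df _ _ Iq hs.
Qed.

(** Derivatives pass under the integral, and s^a <= 1 keeps the bounds unchanged. One order is lost
    because continuity is drawn from a bounded first derivative; for functions with bounds at all
    orders the loss is immaterial. *)
Lemma CB_hadamard n a b F : CB (@coord_dir R 2) X n.+1 b F ->
  CB (@coord_dir R 2) X n b (hadamard a F).
Proof.
have base a' b' F' : CB (@coord_dir R 2) X 1 b' F' -> forall q, X q ->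
   {for q, continuous (hadamard a' F')} /\ `|hadamard a' F' q| <= b' 0%N.
  move=> hF q Xq; split.
    apply: (@hadamard_continuous _ _ _ (b' 1%N)) => //.
      by move=> p Xp; exact: CB_continuous hF Xp.
    move=> p j Xp; split; first exact: CB_derivable hF Xp.
    exact: (CB_bound (CB_derive j hF) Xp).
  apply: hadamard_bound => // p Xp; first exact: CB_continuous hF Xp.
  exact: CB_bound hF Xp.
elim: n a b F => [|n IH] a b F hF; first by split=> //; exact: base.
apply: (CB_intro (F' := fun j => if j == 0 then hadamard a.+1 ('D_e0 F) else hadamard a ('D_e1 F))).
- exact: ball_open.
- by apply: base; exact: CB_leq hF.
- have hc p : X p -> {for p, continuous F} by move=> Xp; exact: CB_continuous hF Xp.
  move=> j q Xq; case: (ord2P j) => -> /=.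
    apply: (@hadamard_derive0 _ _ _ (b 1%N)) => // p Xp.
    split; first exact: CB_derivable hF Xp.
    exact: (CB_bound (CB_derive 0 hF) Xp).
  apply: (@hadamard_derive1 _ _ _ (b 1%N)) => // p Xp.
  split; first exact: CB_derivable hF Xp.
  exact: (CB_bound (CB_derive 1 hF) Xp).
- by move=> j; case: (ord2P j) => -> /=; apply: IH; exact: CB_derive.
Qed.

Lemma hadamard_mul F q : (forall q, X q -> {for q, continuous F}) ->
  (forall q, X q -> {for q, continuous ('D_e0 F)}) ->
  (forall q, X q -> derivable F q e0) -> (forall z, `|z| < del -> F (pt 0 z) = 0) ->
  X q -> F q = q 0 0 * hadamard 0 ('D_e0 F) q.
Proof.
move=> cF cD dF F0 Xq.
have [q0 q1] : `|q 0 0| < del /\ `|q 0 1| < del by apply/pt_ball => //; rewrite ptE.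
pose phi s := F (pt (s * q 0 0) (q 0 1)).
have dphi (s : R) : 0 <= s <= 1 -> is_derive s 1 phi (q 0 0 * 'D_e0 F (pt (s * q 0 0) (q 0 1))).
  move=> s01; have Xs := scale_ball Xq s01.
  have /derivableP/is_derive_e0 := dF _ Xs; rewrite !mxE /= => D1.
  have D2 : is_derive s 1 (fun s : R => s * q 0 0) (q 0 0).
    have -> : (fun s : R => s * q 0 0) = (fun s : R => q 0 0 * s) by apply/funext => u; rewrite mulrC.
    by apply: is_derive_eq; rewrite -[_ *: _]/(_ * _) mulr1.
  have D3 := @is_derive1_comp R (fun t => F (pt t (q 0 1))) (fun s : R => s * q 0 0) s _ _ D1 D2.
  by rewrite mulrC; exact: D3.
pose f (s : R) := q 0 0 * (s ^+ 0 * 'D_e0 F (pt (s * q 0 0) (q 0 1))).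
have cphi (s : R) : 0 <= s <= 1 -> {for s, continuous phi}.
  by move=> /dphi/is_derive1_continuous.
have := @continuous_FTC2 R f phi 0 1 ltr01.
have cf : {within `[0, 1], continuous f}.
  apply: continuous_in_subspaceT => s /set_mem /=; rewrite in_itv /= => s01.
  have c1 : {for s, continuous (fun s : R => pt (s * q 0 0) (q 0 1))}.
    apply: continuous_pt; last exact: cvg_cst.
    exact: (cvgM cvg_id (cvg_cst (q 0 0))).
  have c2 : {for s, continuous (fun s : R => 'D_e0 F (pt (s * q 0 0) (q 0 1)))}.
    exact: (cvg_comp _ _ c1 (cD _ (scale_ball Xq s01))).
  exact: (cvgM (cvg_cst (q 0 0)) (cvgM (@exprn_continuous _ 0 s) c2)).
have c0 : phi @ 0^'+ --> phi 0.
  by apply: cvg_at_right_filter; apply: cphi; rewrite lexx ler01.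
have c1 : phi @ 1^'- --> phi 1.
  by apply: cvg_at_left_filter; apply: cphi; rewrite lexx ler01.
move=> /(_ cf) H.
have {H} := H (And3 _ c0 c1).
have E1 : phi 1 = F q by rewrite /phi mul1r ptE.
have E0 : phi 0 = 0 by rewrite /phi mul0r F0.
rewrite E1 E0 sube0 => H.
have h1 : {in `]0, 1[, forall s : R, derivable phi s 1}.
  move=> s; rewrite in_itv /= => /andP[/ltW s0 /ltW s1].
  by have [] := dphi s (introT andP (conj s0 s1)).
have h2 : {in `]0, 1[, derive1 phi =1 f}.
  move=> s; rewrite in_itv /= => /andP[/ltW s0 /ltW s1].
  have [_ E] := dphi s (introT andP (conj s0 s1)).
  by rewrite derive1E E /f expr0 mul1r.
move: (H h1 h2) => {}H; rewrite -[LHS]/(fine (F q)%:E) -H.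
have := hadamard_integrable 0 cD Xq => hi.
rewrite -[LHS]/(\int[mu]_(x in `[0, 1]) f x) RintegralZl//.
Qed.

(** The quotient inherits the bounds of the x-derivative on the same ball and is defined across the
    axis, so that it can be blown up again. *)
Lemma DC_divide (rho : nat -> R) F : gauge rho -> DC rho (@coord_dir R 2) X F ->
  (forall z, `|z| < del -> F (pt 0 z) = 0) ->
  exists2 F1, DC rho (@coord_dir R 2) X F1 & forall q, X q -> F q = q 0 0 * F1 q.
Proof.
move=> hrho hF F0; have hD := DC_derive hrho 0 hF.
exists (hadamard 0 ('D_e0 F)).
  have [C [S [C0 S0 h]]] := hD; exists C, S; split=> // n.
  exact: CB_hadamard.
move=> q Xq; apply: hadamard_mul => // p Xp.
- exact: DC_continuous hF Xp.
- exact: DC_continuous hD Xp.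
- exact: DC_derivable hF Xp.
Qed.

End Plane.

(** * Bang's theorem and quasianalyticity *)

Section Taylor.
Context {R : realType}.

Lemma is_derive_exp_fact (s : R) i :
  is_derive s 1 (fun s : R => s ^+ i.+1 / (i.+1)`!%:R) (s ^+ i / i`!%:R).
Proof.
have H : is_derive s 1 (fun s : R => s ^+ i.+1) (i.+1%:R * s ^+ i).
  by apply: DeriveDef; [exact: exprn_derivable|rewrite exp_derive [LHS]mulr1].
have -> : (fun s : R => s ^+ i.+1 / (i.+1)`!%:R) = (i.+1)`!%:R^-1 *: (fun s : R => s ^+ i.+1).
  by apply/funext => t; rewrite [RHS]/(_ * _) mulrC.
apply: is_derive_eq; rewrite -[_ *: _]/(_ * _) factS natrM; field.
by rewrite pnatr_eq0 -lt0n fact_gt0 /= nat1r pnatr_eq0.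
Qed.

Lemma MVT_cc (f df : R -> R) (a b : R) : a <= b ->
  (forall x, a <= x <= b -> is_derive x 1 f (df x)) ->
  exists2 c, a <= c <= b & f b - f a = df c * (b - a).
Proof.
move=> ab h; have [||c cab E] := @MVT_segment R f df a b ab.
- by move=> x; rewrite in_itv /= => /andP[/ltW ? /ltW ?]; apply: h; apply/andP.
- apply: derivable_within_continuous => x; rewrite in_itv /= => xab.
  by have [] := h _ xab.
by exists c => //; move: cab; rewrite in_itv.
Qed.

(** The defect of the inequality vanishes at h = 0, and its derivative in h is the same defect one
    order lower, nonnegative by induction. The one-sided form allows B = 0 for functions with
    nonnegative derivatives. *)
Lemma taylor_ge N (g : nat -> R -> R) (a h B : R) : 0 <= h ->
  (forall n x, (n < N)%N -> a <= x <= a + h -> is_derive x 1 (g n) (g n.+1 x)) ->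
  (forall x, a <= x <= a + h -> - B <= g N x) ->
  \sum_(i < N) g i a * (h ^+ i / i`!%:R) - B * (h ^+ N / N`!%:R) <= g 0%N (a + h).
Proof.
elim: N g h => [|N IH] g h h0 dg gB.
  rewrite big_ord0 sub0r expr0 fact0 divr1 mulr1; apply: gB.
  by rewrite lexx andbT lerDl.
pose psi s := g 0%N (a + s) - (\sum_(i < N.+1) g i a * (s ^+ i / i`!%:R) -
   B * (s ^+ N.+1 / (N.+1)`!%:R)).
pose dpsi s := g 1%N (a + s) - (\sum_(i < N) g i.+1 a * (s ^+ i / i`!%:R) -
   B * (s ^+ N / N`!%:R)).
have dpsiE s : 0 <= s <= h -> is_derive s 1 psi (dpsi s).
  move=> /andP[s0 sh].
  have D1 : is_derive s 1 (fun s => g 0%N (a + s)) (g 1%N (a + s)).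
    have D : is_derive (a + s) 1 (g 0%N) (g 1%N (a + s)).
      by apply: dg => //; rewrite lerDl s0 lerD2l.
    have D' : is_derive s 1 (fun s : R => a + s) 1.
      rewrite (_ : (fun s : R => a + s) = shift a); first exact: is_derive_shift.
      by apply/funext => t; rewrite addrC.
    have := @is_derive1_comp R (g 0%N) (fun s => a + s) s _ _ D D'.
    by rewrite mulr1.
  have D2 : is_derive s 1 (fun s => \sum_(i < N.+1) g i a * (s ^+ i / i`!%:R))
      (\sum_(i < N) g i.+1 a * (s ^+ i / i`!%:R)).
    have -> : (fun s => \sum_(i < N.+1) g i a * (s ^+ i / i`!%:R)) =
       cst (g 0%N a) + \sum_(i < N) (g i.+1 a *: (fun s : R => s ^+ i.+1 / (i.+1)`!%:R)).
      apply/funext => t; rewrite big_ord_recl /= expr0 fact0 divr1 mulr1.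
      by rewrite fctE /= fct_sumE.
    rewrite -[X in is_derive _ _ _ X]add0r; apply: is_deriveD.
    apply: is_derive_sum => i; apply: is_deriveZ; exact: is_derive_exp_fact.
  have D3 : is_derive s 1 (fun s => B * (s ^+ N.+1 / (N.+1)`!%:R)) (B * (s ^+ N / N`!%:R)).
    exact: (is_deriveZ B (is_derive_exp_fact s N)).
  exact: (is_deriveB D1 (is_deriveB D2 D3)).
have psi0 : psi 0 = 0.
  rewrite /psi addr0 big_ord_recl /= expr0 fact0 divr1 mulr1 expr0n /= mul0r mulr0 subr0.
  rewrite big1 ?addr0 ?subrr// => i _; by rewrite expr0n /= mul0r mulr0.
have [c /andP[c0 ch]] := MVT_cc h0 dpsiE.
rewrite psi0 !subr0 => E.
have : 0 <= psi h.
  rewrite E mulr_ge0// subr_ge0.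
  apply: (IH (fun n => g n.+1)) => // [n x nN /andP[ax xc]|x /andP[ax xc]].
    by apply: dg => //; rewrite ax (le_trans xc)// lerD2l.
  by apply: gB; rewrite ax (le_trans xc)// lerD2l.
by rewrite subr_ge0.
Qed.

Lemma taylor_dist N (g : nat -> R -> R) (a h B : R) : 0 <= h ->
  (forall n x, (n < N)%N -> a <= x <= a + h -> is_derive x 1 (g n) (g n.+1 x)) ->
  (forall x, a <= x <= a + h -> `|g N x| <= B) ->
  `|g 0%N (a + h) - \sum_(i < N) g i a * (h ^+ i / i`!%:R)| <= B * (h ^+ N / N`!%:R).
Proof.
move=> h0 dg gB; rewrite ler_norml; apply/andP; split.
  rewrite lerBrDr addrC; apply: taylor_ge => // x /gB.
  by rewrite ler_norml => /andP[].
have := @taylor_ge N (fun n x => - g n x) a h B h0.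
have -> : \sum_(i < N) - g i a * (h ^+ i / i`!%:R) = - \sum_(i < N) g i a * (h ^+ i / i`!%:R).
  by rewrite -sumrN; apply: eq_bigr => i _; rewrite mulNr.
move=> H; suff : - (\sum_(i < N) g i a * (h ^+ i / i`!%:R)) - B * (h ^+ N / N`!%:R) <= - g 0%N (a + h) by lra.
apply: H => [n x nN /(dg n x nN) D|x /gB]; first exact: is_deriveN.
by rewrite ler_norml lerN2 => /andP[].
Qed.

(* Only the coefficients of the jet at [0] are determined, so each [K] may depend on the order. *)
Lemma taylor_coef_unique (g : nat -> R -> R) (del : R) (M a : nat -> R) : 0 < del ->
  (forall n x, 0 <= x < del -> is_derive x 1 (g n) (g n.+1 x)) ->
  (forall n x, 0 <= x < del -> `|g n x| <= M n) ->
  (forall N, exists K, forall x, 0 < x < del ->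
     `|g 0%N x - \sum_(i < N) a i * x ^+ i| <= K * x ^+ N) ->
  forall n, g n 0 = n`!%:R * a n.
Proof.
move=> d0 dg gM ga n.
pose d i := g i 0 / i`!%:R - a i.
suff dn0 : d n = 0.
  by move/eqP: dn0; rewrite subr_eq0 => /eqP <-; rewrite mulrC divfK// pnatr_eq0 -lt0n fact_gt0.
elim/ltn_ind: n => n IH.
have [K hK] := ga n.+1.
pose K' := M n.+1 / (n.+1)`!%:R + K.
have main x : 0 < x < del -> `|d n| <= K' * x.
  move=> /andP[x0 xd].
  have T : `|g 0%N x - \sum_(i < n.+1) g i 0 * (x ^+ i / i`!%:R)| <=
      M n.+1 * (x ^+ n.+1 / (n.+1)`!%:R).
    have := @taylor_dist n.+1 g 0 x (M n.+1) (ltW x0); rewrite add0r; apply.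
      by move=> k y _ /andP[y0 yx]; apply: dg; rewrite y0 (le_lt_trans yx).
    by move=> y /andP[y0 yx]; apply: gM; rewrite y0 (le_lt_trans yx).
  have A := hK x; rewrite x0 xd in A; have {}A := A isT.
  have E : d n * x ^+ n = (g 0%N x - \sum_(i < n.+1) a i * x ^+ i) -
      (g 0%N x - \sum_(i < n.+1) g i 0 * (x ^+ i / i`!%:R)).
    rewrite [RHS](_ : _ = \sum_(i < n.+1) g i 0 * (x ^+ i / i`!%:R) - \sum_(i < n.+1) a i * x ^+ i); last by ring.
    rewrite -sumrB.
    rewrite big_ord_recr /= big1 ?add0r; first by rewrite /d mulrBl mulrA mulrAC.
    move=> i _; have := IH i (ltn_ord i); rewrite /d => /eqP; rewrite subr_eq0 => /eqP <-.
    by rewrite mulrA mulrAC subrr.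
  have xn0 : 0 < x ^+ n by rewrite exprn_gt0.
  rewrite -(ler_pM2r xn0) -{1}(gtr0_norm xn0) -normrM E.
  apply: (le_trans (ler_normB _ _)).
  rewrite -mulrA -exprS /K' mulrDl addrC lerD//.
  by rewrite mulrAC -mulrA.
have K'0 : 0 <= K'.
  have := main (del / 2); rewrite divr_gt0//= ltr_pdivrMr// mulr_natr mulr2n ltrDl d0.
  by move=> /(_ isT) /(le_trans (normr_ge0 _)); rewrite pmulr_lge0// divr_gt0.
apply/eqP; rewrite -normr_eq0; apply/eqP/le_anti; rewrite normr_ge0 andbT.
apply/ler_addgt0Pr => e e0; rewrite add0r.
pose x := Num.min (del / 2) (e / (K' + 1)).
have K1 : 0 < K' + 1 by rewrite ltr_wpDl.
have x0 : 0 < x by rewrite lt_min !divr_gt0.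
have xd : x < del by rewrite gt_min ltr_pdivrMr// mulr_natr mulr2n ltrDl d0.
apply: (le_trans (main x _)); first by rewrite x0.
apply: (@le_trans _ _ ((K' + 1) * x)); first by rewrite ler_wpM2r ?(ltW x0)// lerDl.
by rewrite mulrC -ler_pdivlMr// ge_min lexx orbT.
Qed.

End Taylor.

Lemma half_sum_le {R : realType} m : \sum_(i < m) 2^-1 ^+ i <= 2 :> R.
Proof.
suff -> : \sum_(i < m) 2^-1 ^+ i = 2 - 2 * 2^-1 ^+ m :> R.
  by rewrite gerBl mulr_ge0// exprn_ge0// invr_ge0.
elim: m => [|m IH]; first by rewrite big_ord0 expr0 mulr1 subrr.
by rewrite big_ord_recr /= IH exprS mulrA mulfV ?mul1r//; ring.
Qed.

Section Bang.
Context {R : realType}.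
Variables (g : nat -> R -> R) (del : R) (M mu : nat -> R).
Hypothesis dg : forall n x, 0 <= x < del -> is_derive x 1 (g n) (g n.+1 x).
Hypothesis gM : forall n x, 0 <= x < del -> `|g n x| <= M n.
Hypothesis M0 : forall n, 0 < M n.
Hypothesis mu0 : forall n, 0 < mu n.
Hypothesis mu_le : forall n, mu n <= mu n.+1.
Hypothesis Mmu : forall n, M n.+1 <= mu n.+1 * M n.
Hypothesis div : forall A, exists n, A <= \sum_(j < n) (mu j.+1)^-1.
Hypothesis g0 : forall n, 0 <= g n 0.

(** Nonnegativity up to a tolerance: the derivative of order n may fall below 0 by the fraction
    2^-(k - n) of its bound. Every level k holds at 0, and nonnegativity is the limit of all
    levels. *)
Let P k x := forall n, (n < k)%N -> - (M n * 2^-1 ^+ (k - n)) <= g n x.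

Let MX n i N : (n + i <= N)%N -> M (n + i) <= M n * mu N ^+ i.
Proof.
elim: i => [|i IH] h; first by rewrite addn0 expr0 mulr1.
rewrite addnS; apply: (le_trans (Mmu _)).
have h' : (n + i <= N)%N by rewrite (leq_trans _ h)// leq_add2l.
have muh : {homo mu : a b / (a <= b)%N >-> a <= b}.
  exact: (homo_leq (@lexx _ _) (@le_trans _ _) mu_le).
rewrite exprSr mulrA [leRHS]mulrC; apply: ler_pM; [exact: ltW|exact: ltW| |exact: IH].
by apply: muh; rewrite -addnS.
Qed.

(* The losses in Taylor's formula add up to a factor at most [2], which is the weight gained by giving up one derivative. *)
Let step k x h : 0 <= x -> 0 <= h -> h <= (4 * mu k.+1)^-1 -> x + h < del ->
  P k.+1 x -> P k (x + h).
Proof.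
move=> x0 h0 hmu xhd Px n nk.
have nk1 : (n <= k.+1)%N by rewrite ltnW// ltnW.
pose N := (k.+1 - n)%N.
have nN : (n + N = k.+1)%N by rewrite subnKC.
have T : \sum_(i < N) g (n + i)%N x * (h ^+ i / i`!%:R) - M k.+1 * (h ^+ N / N`!%:R) <= g n (x + h).
  have := @taylor_ge R N (fun i => g (n + i)%N) x h (M k.+1) h0; rewrite addn0; apply.
    move=> i y _ /andP[xy yh]; rewrite addnS; apply: dg.
    by rewrite (le_trans x0 xy) (le_lt_trans yh).
  move=> y /andP[xy yh]; rewrite nN.
  have := @gM k.+1 y; rewrite (le_trans x0 xy) (le_lt_trans yh)// => /(_ isT).
  by rewrite ler_norml => /andP[].
apply: le_trans T.
have mh : 2 * mu k.+1 * h <= 2^-1.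
  have : 4 * mu k.+1 * h <= 1 by rewrite mulrC -ler_pdivlMr ?mul1r// mulr_gt0.
  by lra.
have term i : (i <= N)%N ->
    M (n + i)%N * 2^-1 ^+ (k.+1 - (n + i)) * (h ^+ i / i`!%:R) <= M n * 2^-1 ^+ N * 2^-1 ^+ i.
  move=> iN; have ni : (n + i <= k.+1)%N by rewrite -nN leq_add2l.
  have hi : h ^+ i / i`!%:R <= h ^+ i.
    by rewrite ler_pdivrMr ?ltr0n ?fact_gt0// ler_peMr ?exprn_ge0// ler1n fact_gt0.
  apply: (@le_trans _ _ (M n * mu k.+1 ^+ i * 2^-1 ^+ (k.+1 - (n + i)) * h ^+ i)).
    apply: ler_pM => //; rewrite ?mulr_ge0 ?exprn_ge0 ?invr_ge0//; first exact: ltW.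
    by rewrite ler_wpM2r ?exprn_ge0// MX.
  rewrite -!mulrA ler_wpM2l ?(ltW (M0 n))//.
  have -> : 2^-1 ^+ (k.+1 - (n + i)) = 2^-1 ^+ N * 2 ^+ i :> R.
    have -> : N = (k.+1 - (n + i) + i)%N by rewrite /N subnDA subnK// -ltnS -subSn -?nN ?addKn.
    by rewrite exprD -mulrA -exprMn mulVf// expr1n mulr1.
  rewrite [leLHS](_ : _ = 2^-1 ^+ N * (2 * mu k.+1 * h) ^+ i); last by rewrite !exprMn; ring.
  rewrite ler_wpM2l ?exprn_ge0 ?invr_ge0// lerXn2r// ?nnegrE ?invr_ge0//.
  by rewrite !mulr_ge0// ltW.
have xd : 0 <= x < del by rewrite x0 (le_lt_trans _ xhd)// lerDl.
apply: (@le_trans _ _ (- \sum_(i < N.+1) M n * 2^-1 ^+ N * 2^-1 ^+ i)).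
  rewrite lerN2 -mulr_sumr.
  have -> : M n * 2^-1 ^+ (k - n) = M n * 2^-1 ^+ N * 2.
    rewrite /N subSn 1?ltnW// exprS; move: (_ ^+ (k - n)) => y.
    by field.
  rewrite ler_wpM2l ?mulr_ge0 ?exprn_ge0 ?invr_ge0 ?(ltW (M0 n))//.
  exact: half_sum_le.
rewrite big_ord_recr /= opprD lerD//; last first.
  rewrite lerN2; have := term N (leqnn N); rewrite nN subnn expr0 mulr1; exact.
rewrite -sumrN; apply: ler_sum => i _.
have iN : (n + i < k.+1)%N by rewrite -nN ltn_add2l.
have hf : 0 <= h ^+ i / i`!%:R by rewrite mulr_ge0 ?exprn_ge0 ?invr_ge0.
apply: (@le_trans _ _ (- (M (n + i)%N * 2^-1 ^+ (k.+1 - (n + i)) * (h ^+ i / i`!%:R)))).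
  by rewrite lerN2; apply: term; exact: ltnW.
by rewrite -mulNr ler_wpM2r//; exact: Px.
Qed.

(** A move to the right by 1 / (4 mu (k+1)) lowers the level from k + 1 to k. As the series of these
    lengths diverges from any rank on, every x is reached from 0 at any prescribed level k, by
    starting at a level high enough; then k tends to infinity. *)
Lemma bang_nonneg n x : 0 <= x < del -> 0 <= g n x.
Proof.
have Pall d : forall k x, 0 <= x < del ->
    x <= \sum_(j < d) (4 * mu (k + j).+1)^-1 -> P k x.
  elim: d => [|d IH] k y /andP[y0 yd].
    rewrite big_ord0 => yle m mk; have -> : y = 0 by apply/le_anti/andP.
    by apply: le_trans (g0 m); rewrite oppr_le0 mulr_ge0 ?exprn_ge0 ?invr_ge0 ?(ltW (M0 m)).
  rewrite big_ord_recl /= addn0 => yle.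
  have m4 : 0 <= (4 * mu k.+1)^-1 by rewrite invr_ge0 mulr_ge0// ltW.
  case: (leP y (4 * mu k.+1)^-1) => ym.
    rewrite -[y]add0r; apply: step => //; first by rewrite add0r.
    apply: IH; first by rewrite lexx (le_lt_trans y0 yd).
    by apply: sumr_ge0 => j _; rewrite invr_ge0 mulr_ge0// ltW.
  rewrite -[y](subrK (4 * mu k.+1)^-1).
  have y'0 : 0 <= y - (4 * mu k.+1)^-1 by rewrite subr_ge0 ltW.
  apply: step => //; first by rewrite subrK.
  apply: IH.
    by rewrite y'0 (le_lt_trans _ yd)// lerBlDr lerDl.
  rewrite lerBlDl; apply: (le_trans yle); rewrite lerD2l.
  by apply: ler_sum => j _; rewrite /bump /= add1n addnS addSn.
move=> xd; have /andP[x0 _] := xd.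
have Pk k : P k x.
  have [m hm] := div (\sum_(j < k) (mu j.+1)^-1 + 4 * x).
  apply: (Pall m) => //.
  have kle : \sum_(j < m) (mu j.+1)^-1 <= \sum_(j < k) (mu j.+1)^-1 + \sum_(j < m) (mu (k + j).+1)^-1.
    have E1 : \sum_(j < k + m) (mu j.+1)^-1 = \sum_(j < k) (mu j.+1)^-1 + \sum_(j < m) (mu (k + j).+1)^-1.
      by rewrite big_split_ord.
    rewrite -E1 addnC big_split_ord /= lerDl.
    by apply: sumr_ge0 => j _; rewrite invr_ge0 ltW.
  have -> : \sum_(j < m) (4 * mu (k + j).+1)^-1 = 4^-1 * \sum_(j < m) (mu (k + j).+1)^-1.
    by rewrite mulr_sumr; apply: eq_bigr => j _; rewrite invfM.
  by rewrite mulrC ler_pdivlMr// mulrC -(lerD2l (\sum_(j < k) (mu j.+1)^-1)) (le_trans hm).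
apply/ler_addgt0Pr => e e0; rewrite -lerBlDr sub0r.
have [k hk] : exists k, M n * 2^-1 ^+ k <= e.
  have hk := truncnS_gt (M n / e); exists (Num.truncn (M n / e)).+1.
  move: (_.+1) hk => k hk.
  rewrite exprVn ler_pdivrMr ?exprn_gt0// mulrC -ler_pdivrMr//.
  by rewrite (le_trans (ltW hk))// -natrX ler_nat ltnW// ltn_expl.
apply: le_trans (Pk (n + k.+1)%N n _); last by rewrite addnS ltnS leq_addr.
rewrite lerN2 addKn exprS (le_trans _ hk)// ler_wpM2l ?(ltW (M0 n))//.
by rewrite ler_piMl ?exprn_ge0 ?invr_ge0// invf_le1// ler1n.
Qed.

End Bang.

Section QuasiAnalytic.
Context {R : realType}.
Variable rho : nat -> R.
Hypothesis hrho : gauge rho.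

(** The point is that (rho (n+1) / rho n)^n stays bounded. By the last gauge condition the quotient
    is at most exp (1 / ((n+1) rho (n+1) rho n)), so its n-th power is at most exp (1 / (rho
    0)^2). *)
Lemma wt_ratio (C S : R) : 0 < C -> 0 < S -> exists2 A, 0 < A &
  forall n, wt rho C S n.+1 <= A * (n.+1%:R * rho n.+1) * wt rho C S n.
Proof.
move=> C0 S0; pose A := expR ((rho 0)^-2).
have A0 : 0 < A by exact: expR_gt0.
exists (S * A) => [|n]; first by rewrite mulr_gt0.
have r0 := gauge_gt0 hrho 0; have rn := gauge_gt0 hrho n; have rn1 := gauge_gt0 hrho n.+1.
have key : (rho n.+1 / rho n) ^+ n <= A.
  have h1 : rho n.+1 / rho n <= expR ((n.+1%:R * rho n.+1 * rho n)^-1).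
    apply: le_trans (expR_ge1Dx _).
    have := gauge_step hrho n; rewrite lerBlDl => h.
    rewrite ler_pdivrMr// mulrDl mul1r (le_trans h)// lerD2l.
    by rewrite [leRHS](_ : _ = (n.+1%:R * rho n.+1)^-1)// invfM -mulrA mulVf ?mulr1// gt_eqF.
  apply: (@le_trans _ _ (expR ((n.+1%:R * rho n.+1 * rho n)^-1) ^+ n)).
    by rewrite lerXn2r// ?nnegrE ?divr_ge0 ?ltW// expR_gt0.
  rewrite -expRM_natl ler_expR ler_pdivrMr ?mulr_gt0//.
  have h2 : 1 <= (rho 0)^-2 * (rho n.+1 * rho n).
    rewrite mulrC ler_pdivlMr ?exprn_gt0// mul1r expr2.
    by apply: ler_pM; rewrite ?(ltW r0) ?(gauge_le hrho).
  apply: (@le_trans _ _ (n.+1%:R * 1)); first by rewrite mulr1 ler_nat.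
  by rewrite -mulrA mulrCA ler_wpM2l.
rewrite /wt factS natrM exprS.
have E : rho n.+1 ^+ n <= A * rho n ^+ n.
  by move: key; rewrite expr_div_n ler_pdivrMr ?exprn_gt0.
rewrite [leLHS](_ : _ = (C * S ^+ n * n`!%:R * S * n.+1%:R * rho n.+1) * rho n.+1 ^+ n); last by rewrite exprMn; ring.
rewrite [leRHS](_ : _ = (C * S ^+ n * n`!%:R * S * n.+1%:R * rho n.+1) * (A * rho n ^+ n)); last by rewrite exprMn; ring.
by rewrite ler_wpM2l// !mulr_ge0 ?exprn_ge0 ?ltW.
Qed.

(** The terms dominate the increments of rho, up to the factor 1 / A; these telescope, and rho is
    unbounded. *)
Lemma gauge_diverges (A : R) : 0 < A -> forall B, exists n,
  B <= \sum_(j < n) (A * (j.+1%:R * rho j.+1))^-1.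
Proof.
move=> A0 B; have [_ _ hun _] := hrho; have [n hn] := hun (A * B + rho 0).
exists n.
have E : rho n - rho 0 = \sum_(j < n) (rho j.+1 - rho j).
  by rewrite -(big_mkord predT (fun j => rho j.+1 - rho j)) telescope_sumr.
apply: (@le_trans _ _ (A^-1 * (rho n - rho 0))).
  by rewrite mulrC ler_pdivlMr// mulrC lerBrDr.
rewrite E mulr_sumr; apply: ler_sum => j _.
by rewrite invfM ler_pM2l ?invr_gt0//; exact: gauge_step.
Qed.

Lemma DC_bang (g : nat -> R -> R) (del C S : R) : 0 < C -> 0 < S ->
  (forall n x, 0 <= x < del -> is_derive x 1 (g n) (g n.+1 x)) ->
  (forall n x, 0 <= x < del -> `|g n x| <= wt rho C S n) ->
  (forall n, 0 <= g n 0) -> forall n x, 0 <= x < del -> 0 <= g n x.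
Proof.
move=> C0 S0 dg gM g0.
have [A A0 hA] := wt_ratio C0 S0.
apply: (@bang_nonneg _ g del (wt rho C S) (fun n => if n is n'.+1 then A * (n%:R * rho n) else A * rho 0 / 2)) => //.
- by move=> n; rewrite /wt !mulr_gt0 ?exprn_gt0 ?mulr_gt0 ?(gauge_gt0 hrho)// ltr0n fact_gt0.
- by case=> [|n]; rewrite !mulr_gt0 ?(gauge_gt0 hrho) ?ltr0n.
- case=> [|n].
    rewrite -mulrA ler_pM2l// mul1r ler_pdivrMr// (le_trans (gauge_le hrho (leq0n 1)))//.
    by rewrite ler_peMr ?(gauge_ge0 hrho)// ler1n.
  rewrite ler_pM2l// ler_pM ?(gauge_ge0 hrho) ?ler_nat//; exact: (gauge_le hrho).
- exact: gauge_diverges.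
Qed.

Lemma DC_bang0 (g : nat -> R -> R) (del C S : R) : 0 < C -> 0 < S ->
  (forall n x, 0 <= x < del -> is_derive x 1 (g n) (g n.+1 x)) ->
  (forall n x, 0 <= x < del -> `|g n x| <= wt rho C S n) ->
  (forall n, g n 0 = 0) -> forall n x, 0 <= x < del -> g n x = 0.
Proof.
move=> C0 S0 dg gM g0 n x hx; apply/le_anti/andP; split.
  rewrite -oppr_ge0; apply: (@DC_bang (fun n x => - g n x) del C S C0 S0) => //.
  - by move=> m y hy; have := dg m y hy; exact: is_deriveN.
  - by move=> m y hy; rewrite normrN gM.
  - by move=> m; rewrite g0 oppr0.
by apply: (DC_bang C0 S0 dg gM) => // m; rewrite g0.
Qed.

Definition line_ders {V : normedModType R} (v : V) n (F : V -> R) := iter n (fun G => 'D_v G) F.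

Lemma line_dersP {V : normedModType R} {I : Type} (e : I -> V) (X : set V) (F : V -> R) i :
  DC rho e X F -> exists C S, [/\ 0 < C, 0 < S, forall n q, X q -> `|line_ders (e i) n F q| <= wt rho C S n &
    forall n q, X q -> is_derive q (e i) (line_ders (e i) n F) (line_ders (e i) n.+1 F q)].
Proof.
move=> [C [S [C0 S0 h]]]; exists C, S.
have E n : line_ders (e i) n F = ders e (nseq n i) F.
  rewrite /line_ders; elim: n F {h} => [//|n IH] F.
  by rewrite iterSr IH.
split=> // n q Xq.
  have /CBP[/(_ (nseq n i) q) + _] := h n; rewrite size_nseq leqnn => /(_ isT Xq)[_].
  by rewrite E.
apply: derivableP; rewrite E; have /CBP[_ /(_ (nseq n i) q i)] := h n.+1.
by rewrite size_nseq ltnSn => /(_ isT Xq).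
Qed.

(** Flatness to the right of 0 makes all Taylor coefficients at 0 vanish; Bang's theorem for the
    function and its negative then leaves only 0. *)
Lemma DC_flat_eq0 (F : R -> R) (del : R) : 0 < del ->
  DC rho unit_dir (ball (0 : R) del) F ->
  (forall n, exists K, forall x, 0 < x < del -> `|F x| <= K * x ^+ n) ->
  forall x, 0 <= x < del -> F x = 0.
Proof.
move=> d0 hF flat.
have [C [S [C0 S0 gM dg]]] := line_dersP tt hF.
have inb x : 0 <= x < del -> ball (0 : R) del x.
  by move=> /andP[x0 xd]; rewrite -ball_normE /ball_ /= sub0r normrN ger0_norm.
pose g n := line_ders (unit_dir tt) n F.
have dg' n x : 0 <= x < del -> is_derive x 1 (g n) (g n.+1 x) by move/inb/(dg n x).
have gM' n x : 0 <= x < del -> `|g n x| <= wt rho C S n by move/inb/(gM n x).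
have g00 n : g n 0 = 0.
  rewrite (taylor_coef_unique (a := fun=> 0) d0 dg' gM') ?mulr0// => N.
  have [K hK] := flat N; exists K => x hx.
  by rewrite big1 ?subr0; [exact: hK|move=> i _; rewrite mul0r].
by move=> x hx; exact: (DC_bang0 C0 S0 dg' gM' g00 0%N hx).
Qed.

(** Bang's theorem propagates to the right only. Above [z0] it is used after a translation, below
    after the reflection s -> z0 - s, whose n-th derivative carries the sign (-1)^n. *)
Lemma DC_vertical_eq0 (G : 'rV[R]_2 -> R) (del x z0 : R) : 0 < del ->
  DC rho (@coord_dir R 2) (ball 0 del) G -> `|x| < del -> `|z0| < del ->
  (forall n, line_ders (@coord_dir R 2 1) n G (pt x z0) = 0) ->
  forall z, `|z| < del -> G (pt x z) = 0.
Proof.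
move=> d0 hG xd z0d flat z zd.
have [C [S [C0 S0 gM dg]]] := line_dersP 1 hG.
pose g n (z : R) : R := line_ders (@coord_dir R 2 1) n G (pt x z).
have dgz n (t : R) : `|t| < del -> is_derive t 1 (g n) (g n.+1 t).
  move=> td; have := dg n (pt x t); rewrite pt_ball// => /(_ (conj xd td)) /is_derive_e1.
  by rewrite pt0 pt1.
have gMz n (t : R) : `|t| < del -> `|g n t| <= wt rho C S n.
  by move=> td; apply: gM; apply/pt_ball.
case: (leP z0 z) => zz.
  (* The length exceeds z - z0, so that [z] is reached, and it keeps s + z0 below z + del - |z| <=
     del. *)
  have dom s : 0 <= s < z - z0 + (del - `|z|) -> `|s + z0| < del.
    move=> /andP[s0 sd]; rewrite ltr_norml; apply/andP; split.
      by move: z0d; rewrite ltr_norml => /andP[h _]; rewrite (lt_le_trans h)// lerDr.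
    by have := ler_norm z; lra.
  have := @DC_bang0 (fun n s => g n (s + z0)) (z - z0 + (del - `|z|)) C S C0 S0.
  move=> /(_ _ _ _ 0%N (z - z0)); rewrite subrK /g; apply.
  - move=> n s /dom hs; have D := dgz n _ hs.
    have := @is_derive1_comp R (g n) (shift z0) s _ _ D (is_derive_shift s 1 z0).
    by rewrite mulr1.
  - by move=> n s /dom hs; exact: gMz.
  - by move=> n; rewrite add0r.
  - by rewrite subr_ge0 zz ltrDl subr_gt0.
have dom s : 0 <= s < z0 - z + (del - `|z|) -> `|z0 - s| < del.
  move=> /andP[s0 sd]; rewrite ltr_norml; apply/andP; split.
    by have := ler_norm (- z); rewrite normrN; lra.
  by move: z0d; rewrite ltr_norml => /andP[_ h]; rewrite (le_lt_trans _ h)// gerBl.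
have := @DC_bang0 (fun n s => (-1) ^+ n * g n (z0 - s)) (z0 - z + (del - `|z|)) C S C0 S0.
move=> /(_ _ _ _ 0%N (z0 - z)); rewrite expr0 mul1r subKr /g; apply.
- move=> n s /dom hs; have D := dgz n _ hs.
  have D' : is_derive s 1 (fun s : R => z0 - s) (-1).
    have := is_deriveD (is_derive_cst z0 s 1) (is_deriveNid s 1).
    by rewrite add0r.
  have D2 := @is_derive1_comp R (g n) (fun s => z0 - s) s _ _ D D'.
  apply: (is_derive_eq (is_deriveZ ((-1) ^+ n) D2)).
  by rewrite -[_ *: _]/(_ * _) exprS /g; ring.
- by move=> n s /dom hs; rewrite normrM normrX normrN1 expr1n mul1r; exact: gMz.
- by move=> n; rewrite subr0 flat mulr0.
- by rewrite subr_ge0 (ltW zz) ltrDl subr_gt0.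
Qed.

End QuasiAnalytic.

(** * Implicit functions *)

Section ImplicitFunction.
Context {R : realType}.
Variable rho : nat -> R.
Hypothesis hrho : gauge rho.

Local Notation e0 := (@coord_dir R 2 0).
Local Notation e1 := (@coord_dir R 2 1).
Local Notation DC2 r := (DC rho (@coord_dir R 2) (ball (0 : 'rV[R]_2) r)).

Section Positive.
Variables (H : 'rV[R]_2 -> R) (r c : R).
Hypotheses (r0 : 0 < r) (r1 : r <= 1) (c0 : 0 < c).
Hypothesis hH : DC2 r H.
Hypothesis H0 : H 0 = 0.
Hypothesis Hz : forall q, ball 0 r q -> c < 'D_e1 H q.

Let bopen : open (ball (0 : 'rV[R]_2) r).
Proof. exact: ball_open. Qed.

Let mono (x z z' : R) : `|x| < r -> `|z| < r -> `|z'| < r -> z <= z' ->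
  c * (z' - z) <= H (pt x z') - H (pt x z).
Proof.
move=> xr zr z'r zz.
have [|t /andP[t0 t1] ->] := @MVT_cc R (fun t => H (pt x t)) (fun t => 'D_e1 H (pt x t)) z z' zz.
  move=> t /andP[zt tz'].
  have tr : `|t| < r.
    move: zr z'r; rewrite !ltr_norml => /andP[h _] /andP[_ h'].
    by rewrite (lt_le_trans h zt) (le_lt_trans tz' h').
  have /derivableP/is_derive_e1 : derivable H (pt x t) e1.
    by apply: DC_derivable hH _; apply/pt_ball.
  by rewrite pt0 pt1.
rewrite ler_wpM2r ?subr_ge0// ltW//; apply: Hz; apply/pt_ball => //; split => //.
move: zr z'r; rewrite !ltr_norml => /andP[h _] /andP[_ h'].
by rewrite (lt_le_trans h t0) (le_lt_trans t1 h').
Qed.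

Let uniq_zero (x z z' : R) : `|x| < r -> `|z| < r -> `|z'| < r ->
  H (pt x z) = 0 -> H (pt x z') = 0 -> z = z'.
Proof.
move=> xr.
wlog zz : z z' / z <= z'.
  move=> hw zr z'r hz hz'; case: (leP z z') => [|/ltW] h; first exact: hw.
  by apply/esym; apply: hw.
move=> zr z'r hz hz'; have := mono xr zr z'r zz; rewrite hz hz' subrr.
by rewrite pmulr_rle0// subr_le0 => z'z; apply/le_anti/andP.
Qed.

Let ptcont (z : R) : `|z| < r -> exists2 d, 0 < d & forall x, `|x| < d ->
   d <= r /\ `|H (pt 0 z) - H (pt x z)| < c * (r / 5).
Proof.
move=> zr; have r5 : 0 < c * (r / 5) by rewrite mulr_gt0// divr_gt0.
have cz : {for (0 : R), continuous (fun x => H (pt x z))}.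
  have c1 : {for (0 : R), continuous (fun x : R => pt x z)}.
    by apply: continuous_pt; [exact: cvg_id|exact: cvg_cst].
  apply: (cvg_comp _ _ c1); apply: DC_continuous hH _.
  by apply/pt_ball => //; rewrite normr0.
have /cvgrPdist_lt/(_ _ r5)/nbhs_ballP[d /= d0 hd] := cz.
exists (Num.min d r); first by rewrite lt_min d0.
move=> x; rewrite lt_min => /andP[xd xr]; split; first by rewrite ge_min lexx orbT.
by apply: hd; rewrite -ball_normE /ball_ /= sub0r normrN.
Qed.

Let r5r : `|r / 5| < r.
Proof. by rewrite gtr0_norm ?divr_gt0// ltr_pdivrMr// ltr_pMr// ltr1n. Qed.

Let H00 : H (pt 0 0) = 0.
Proof. by rewrite (_ : pt 0 0 = 0)//; apply/rowP => j; rewrite !mxE; case: ifP. Qed.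

(** The function changes sign between -r/5 and r/5, first at x = 0 and then nearby by continuity.
    The fraction 1/5 leaves room: two points of the graph are within 2r/5 < r/2 of each other, and
    the ball of radius r/2 about either stays inside the ball of radius r. *)
Let root_exists : exists2 e, 0 < e & forall x, `|x| < e -> e <= r / 5 /\
   exists z, `|z| <= r / 5 /\ H (pt x z) = 0.
Proof.
have r50 : 0 < r / 5 by rewrite divr_gt0.
have [d d0 hd] := ptcont r5r.
have nr5 : `|- (r / 5)| < r by rewrite normrN.
have [d' d'0 hd'] := ptcont nr5.
exists (Num.min (r / 5) (Num.min d d')); first by rewrite !lt_min r50 d0.
move=> x; rewrite !lt_min => /and3P[x5 xd xd']; split; first by rewrite ge_min lexx.
have n0 : `|0 : R| < r by rewrite normr0.
have xr : `|x| < r by rewrite (lt_trans x5)// -[_ / _]gtr0_norm.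
have [_ A] := hd _ xd; have [_ B] := hd' _ xd'.
have A' := mono n0 n0 r5r (ltW r50); rewrite H00 !subr0 in A'.
have le0 : - (r / 5) <= 0 by rewrite oppr_le0 ltW.
have B' := mono n0 nr5 n0 le0; rewrite H00 !sub0r opprK in B'.
have pos : 0 < H (pt x (r / 5)).
  by move: A; rewrite ltr_norml => /andP[_]; lra.
have neg : H (pt x (- (r / 5))) < 0.
  by move: B; rewrite ltr_norml => /andP[]; lra.
have ab : - (r / 5) <= r / 5 by rewrite (le_trans le0)// ltW.
have cH : {within `[- (r / 5), r / 5], continuous (fun z => H (pt x z))}.
  apply: continuous_in_subspaceT => z /set_mem /=; rewrite in_itv /= -ler_norml => z5.
  have c1 : {for z, continuous (fun z : R => pt x z)}.
    by apply: continuous_pt; [exact: cvg_cst|exact: cvg_id].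
  apply: (cvg_comp _ _ c1); apply: DC_continuous hH _.
  apply/pt_ball => //; split=> //; apply: le_lt_trans z5 _.
  by move: r5r; rewrite gtr0_norm.
have [|z zI zE] := @IVT R (fun z => H (pt x z)) _ _ 0 ab cH.
  by rewrite ge_min le_max (ltW pos) (ltW neg) orbT.
by exists z; split=> //; rewrite ler_norml; move: zI; rewrite in_itv.
Qed.

(** The mean value formula yields the derivative -H_x / H_z of the root. This is a differential
    equation phi' = Q(x, phi) with Q in the class, and [CB_solution] draws the bounds at all orders
    from it. *)
Lemma implicit_function_pos : exists e phi, [/\ 0 < e, DC rho unit_dir (ball (0 : R) e) phi &
  forall x z, `|x| < e -> `|z| < r -> H (pt x z) = 0 -> z = phi x].
Proof.
have [e ep he] := root_exists.
pose phi (x : R) := if pselect (`|x| < e) is left h then sval (cid (he x h).2) else 0.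
have phi5 x : `|x| < e -> `|phi x| <= r / 5.
  by rewrite /phi; case: pselect => // h _; case: cid => z /= [].
have phiE x : `|x| < e -> H (pt x (phi x)) = 0.
  by rewrite /phi; case: pselect => // h _; case: cid => z /= [].
have r50 : 0 < r / 5 by rewrite divr_gt0.
have r5' : r / 5 < r by move: r5r; rewrite gtr0_norm.
have e5 : e <= r / 5 by have [] := he 0 _; rewrite ?normr0.
have xr (x : R) : `|x| < e -> `|x| < r by move=> xe; rewrite (lt_trans xe)// (le_lt_trans e5).
have phir (x : R) : `|x| < e -> `|phi x| < r by move=> /phi5 h; exact: le_lt_trans h r5'.
have inb (x : R) : `|x| < e -> ball 0 r (pt x (phi x)) by move=> xe; apply/pt_ball => //; rewrite xr ?phir.
exists e, phi.
suff hphi : DC rho unit_dir (ball (0 : R) e) phi.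
  split=> // x z xe zr hz; apply: (uniq_zero (xr _ xe)) => //; [exact: phir|exact: phiE].
have hD0 := DC_derive hrho 0 hH; have hD1 := DC_derive hrho 1 hH.
pose Q q := - 'D_e0 H q * ('D_e1 H q)^-1.
have hQ : DC2 r Q.
  apply: DC_mul => //; first exact: DC_opp.
  apply: (@DC_inv _ _ hrho _ _ _ _ _ c) => // q hq.
  by apply: lt_le_trans (Hz hq) (ler_norm _).
have [B B0 hB] := DC_bounded hD0.
have dphi (x : R) : `|x| < e -> is_derive x 1 phi (Q (pt x (phi x))).
  move=> xe; pose p := pt x (phi x).
  have r20 : 0 < r / 2 by rewrite divr_gt0.
  have pr5 : `|p| <= r / 5.
    apply: rV_norm_le => [|j]; first exact: ltW.
    by rewrite mxE; case: ifP => _; [rewrite ltW// (lt_le_trans xe)|exact: phi5].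
  have sub y : ball p (r / 2) y -> ball 0 r y.
    rewrite -!ball_normE /ball_ /= sub0r normrN => h.
    rewrite -[y](subrK p) (le_lt_trans (ler_normD _ _))// distrC.
    by move: h pr5; lra.
  have dH y j : ball p (r / 2) y -> derivable H y (delta_mx 0 j).
    by move=> /sub hy; exact: DC_derivable hH hy.
  have mv := mean_value_rV dH.
  pose G (t : R) := pt (t + x) (phi (t + x)).
  have step (t : R) : `|t + x| < e -> exists xi0 xi1, [/\ `|p - xi0| <= `|p - G t|, `|p - xi1| <= `|p - G t|,
     ball 0 r xi0, ball 0 r xi1 &
     0 = 'D_e0 H xi0 * t + 'D_e1 H xi1 * (phi (t + x) - phi x)].
    move=> te.
    have bG : ball p (r / 2) (G t).
      apply/plane_ballP => //; rewrite !mxE /= opprD addrCA subrr addr0 normrN; split.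
        have -> : t = (t + x) - x by rewrite addrK.
        by rewrite (le_lt_trans (ler_normB _ _))//; move: te xe e5 r0; lra.
      by rewrite (le_lt_trans (ler_normB _ _))//; move: (phi5 _ xe) (phi5 _ te) r0; lra.
    have [xi [xi1 E]] := mv _ bG.
    exists (xi 0), (xi 1); split=> //.
    - by apply: sub; move: bG; rewrite -!ball_normE /ball_ /=; exact: le_lt_trans.
    - by apply: sub; move: bG; rewrite -!ball_normE /ball_ /=; exact: le_lt_trans.
    - move: E; rewrite !phiE// subr0 !big_ord_recl big_ord0 addr0 => ->.
      rewrite (_ : lift ord0 ord0 = 1); last exact/val_inj.
      by rewrite (_ : ord0 = 0)// !mxE /= addrK.
  pose X0 (t : R) := if pselect (`|t + x| < e) is left h then sval (cid (step t h)) else p.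
  pose X1 (t : R) := if pselect (`|t + x| < e) is left h then sval (cid (svalP (cid (step t h)))) else p.
  have XP (t : R) : `|t + x| < e -> [/\ `|p - X0 t| <= `|p - G t|, `|p - X1 t| <= `|p - G t|,
     ball 0 r (X0 t), ball 0 r (X1 t) &
     0 = 'D_e0 H (X0 t) * t + 'D_e1 H (X1 t) * (phi (t + x) - phi x)].
    rewrite /X0 /X1; case: pselect => // h _.
    exact: (svalP (cid (svalP (cid (step t h))))).
  have nearx : \forall t \near 0^', `|t + x| < e.
    have : \forall t \near (0 : R), `|t + x| < e.
      apply/nbhs_ballP; exists (e - `|x|) => /=; first by rewrite subr_gt0.
      move=> t; rewrite -ball_normE /ball_ /= sub0r normrN => h.
      by rewrite (le_lt_trans (ler_normD _ _))// -ltrBrDr.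
    exact: cvg_within.
  (* The Lipschitz bound forces both intermediate points to tend to [p] as t tends to 0. *)
  have lip (t : R) : `|t + x| < e -> `|phi (t + x) - phi x| <= (B / c) * `|t|.
    move=> te; have [_ _ b0 b1 E] := XP t te.
    have h1 := Hz b1; have h0 := hB _ b0.
    rewrite mulrAC ler_pdivlMr// mulrC.
    apply: (@le_trans _ _ ('D_e1 H (X1 t) * `|phi (t + x) - phi x|)).
      by rewrite ler_wpM2r// ltW.
    have -> : 'D_e1 H (X1 t) * `|phi (t + x) - phi x| = `|'D_e0 H (X0 t) * t|.
      rewrite -{1}(gtr0_norm (lt_trans c0 h1)) -normrM -[RHS]normrN; congr (`|_|).
      by apply/eqP; rewrite -addr_eq0 addrC -E.
    by rewrite normrM ler_wpM2r.
  have Glim (t : R) : `|t + x| < e -> `|p - G t| <= (1 + B / c) * `|t|.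
    move=> te; have Bc : 0 <= B / c by rewrite divr_ge0// ltW.
    apply: rV_norm_le => [|j]; first by rewrite mulr_ge0// addr_ge0.
    case: (ord2P j) => ->; rewrite !mxE /=.
      by rewrite opprD addrCA subrr addr0 normrN ler_peMl// lerDl.
    by rewrite distrC (le_trans (lip _ te))// ler_wpM2r// lerDr.
  have K0 : 0 < 1 + B / c by rewrite ltr_wpDr// divr_ge0// ltW.
  have Xcvg (X : R -> 'rV[R]_2) : (forall t, `|t + x| < e -> `|p - X t| <= `|p - G t|) ->
      X t @[t --> 0^'] --> p.
    move=> hX; apply/cvgrPdist_lt => ee ee0; near=> t.
    have te : `|t + x| < e by near: t.
    apply: le_lt_trans (hX _ te) _; apply: le_lt_trans (Glim _ te) _.
    rewrite mulrC -ltr_pdivlMr//; near: t; apply: dnbhs0_lt.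
    by rewrite divr_gt0.
  have X0c : X0 t @[t --> 0^'] --> p by apply: Xcvg => t /XP[].
  have X1c : X1 t @[t --> 0^'] --> p by apply: Xcvg => t /XP[].
  have c0' : 'D_e0 H (X0 t) @[t --> 0^'] --> 'D_e0 H p.
    exact: (cvg_comp _ _ X0c (DC_continuous hD0 (inb _ xe))).
  have c1' : 'D_e1 H (X1 t) @[t --> 0^'] --> 'D_e1 H p.
    exact: (cvg_comp _ _ X1c (DC_continuous hD1 (inb _ xe))).
  have D1p : 'D_e1 H p != 0 by rewrite gt_eqF// (lt_trans c0)//; apply: Hz; exact: inb.
  have cQ : (- 'D_e0 H (X0 t) * ('D_e1 H (X1 t))^-1) @[t --> 0^'] --> Q p.
    exact: (cvgM (cvgN c0') (cvgV D1p c1')).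
  have cd : t^-1 *: (phi (t *: 1 + x) - phi x) @[t --> 0^'] --> Q p.
    apply: cvg_trans cQ; apply: near_eq_cvg; near=> t.
    have te : `|t + x| < e by near: t.
    have t0 : t != 0 by near: t; exact: nbhs_dnbhs_neq.
    have [_ _ _ b1 E] := XP t te.
    have D1 : 'D_e1 H (X1 t) != 0 by rewrite gt_eqF// (lt_trans c0)//; exact: Hz.
    rewrite -[_ *: (_ - _)]/(_ * _) [t *: 1]mulr1.
    have -> : phi (t + x) - phi x = - ('D_e0 H (X0 t) * t) / 'D_e1 H (X1 t).
      apply: (mulfI D1); rewrite mulrCA mulfV// mulr1.
      by apply/eqP; rewrite -addr_eq0 addrC -E.
    by field; rewrite D1 t0.
  by apply: DeriveDef; [apply/cvg_ex; eexists; exact: cd|exact: cvg_lim cd].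
have [L [S [L0 S0 hQb]]] := DC_gb hrho hQ.
have b1 : ball (0 : 'rV[R]_2) r `<=` ball 0 1 by exact: le_ball.
have [K [S' [K0 S'0 hzb]]] := DC_gb hrho (DC_coord hrho 1 bopen b1).
have oe : open (ball (0 : R) e) by exact: ball_open.
have be x : ball (0 : R) e x -> `|x| < e by rewrite -ball_normE /ball_ /= sub0r normrN.
(* [phi] is the coordinate z read along its own graph, which is the form [CB_solution] treats. *)
apply: (@DC_ext _ _ _ _ _ _ (fun x => pt x (phi x) 0 1)) => //; first by move=> x _; rewrite pt1.
apply: (@gb_DC _ _ hrho _ _ _ _ _ K ((1 + 2 * L) * (S' + 2 * S))); first exact: ltW.
  by rewrite !(mulr_ge0, addr_ge0)// ltW.
move=> n; have rn := gauge_ge0 hrho n; rewrite -mulrA.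
have := @CB_solution R (ball (0 : R) e) (ball (0 : 'rV[R]_2) r) phi Q n L (S * rho n) ((S' + 2 * S) * rho n) oe bopen.
move=> /(_ _ _ (hQb n) (ltW L0) _ _ n 0%N K (fun q => q 0 1) (leqnn n) (ltW K0)).
apply.
- by move=> x /be/inb.
- by move=> x /be/dphi.
- by rewrite mulr_ge0// ltW.
- by rewrite [leRHS]mulrDl mulrA lerDr mulr_ge0// ltW.
apply: CB_ler (hzb n) => k _; apply: gb_le; [exact: ltW| by [] | by rewrite mulr_ge0// ltW|].
by rewrite ler_wpM2r// lerDl mulr_ge0// ltW.
Unshelve. all: by end_near. Qed.

End Positive.

Lemma implicit_function (H : 'rV[R]_2 -> R) (del : R) : 0 < del -> DC2 del H -> H 0 = 0 ->
  'D_e1 H 0 != 0 -> exists r e phi, [/\ 0 < r, 0 < e, DC rho unit_dir (ball (0 : R) e) phi &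
  forall x z, `|x| < e -> `|z| < r -> H (pt x z) = 0 -> z = phi x].
Proof.
move=> d0; wlog pos : H / 0 < 'D_e1 H 0.
  move=> hw hH H0 nz; case: (ltP 0 ('D_e1 H 0)) => [p|np]; first exact: (hw H).
  have b0 : ball (0 : 'rV[R]_2) del 0 by exact: ballxx.
  have oX : open (ball (0 : 'rV[R]_2) del) by exact: ball_open.
  have DN : 'D_e1 (fun q => - H q) 0 = - 'D_e1 H 0.
    by apply: deriveN; exact: DC_derivable hH b0.
  have [||||r [e [phi [r0 e0 hphi h]]]] := hw (fun q => - H q).
  - by rewrite DN oppr_gt0 lt_neqAle nz.
  - exact: DC_opp.
  - by rewrite H0 oppr0.
  - by rewrite DN oppr_eq0.
  exists r, e, phi; split=> // x z xe zr hz; apply: h => //.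
  by rewrite hz oppr0.
move=> hH H0 _; pose c := 'D_e1 H 0 / 2.
have c0 : 0 < c by rewrite divr_gt0.
have b0 : ball (0 : 'rV[R]_2) del 0 by exact: ballxx.
have cD : {for 0, continuous ('D_e1 H)} by apply: DC_continuous (DC_derive hrho 1 hH) b0.
have cc : c < 'D_e1 H 0 by rewrite ltr_pdivrMr// mulr_natr mulr2n ltrDl.
have : \forall q \near 0, c < 'D_e1 H q by exact: (cvgr_gt _ cD _ cc).
move=> /nbhs_ballP[s /= s0 hs].
pose r := Num.min s (Num.min del 1).
have r0 : 0 < r by rewrite !lt_min s0 d0 ltr01.
have rd : r <= del by rewrite !ge_min lexx orbT.
have rs : r <= s by rewrite !ge_min lexx.
have r1 : r <= 1 by rewrite !ge_min lexx !orbT.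
have [|q bq|e [phi [e0 hphi h]]] := @implicit_function_pos H r c r0 r1 c0 _ H0.
- by apply: DC_subset hH; exact: le_ball.
- by apply: hs; apply: le_ball bq.
- by exists r, e, phi.
Qed.

End ImplicitFunction.

(** * Symmetry of partial derivatives *)

Section Schwarz.
Context {R : realType}.

Lemma mixed_difference {V : normedModType R} (h : V -> R) (u v p : V) (s : R) : 0 < s ->
  (forall t1 t2, 0 <= t1 <= s -> 0 <= t2 <= s -> derivable h (t1 *: u + (t2 *: v + p)) u /\
     derivable ('D_u h) (t1 *: u + (t2 *: v + p)) v) ->
  exists t1 t2, [/\ 0 <= t1 <= s, 0 <= t2 <= s &
    h (s *: u + (s *: v + p)) - h (s *: u + p) - (h (s *: v + p) - h p) =
    'D_v ('D_u h) (t1 *: u + (t2 *: v + p)) * s ^+ 2].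
Proof.
move=> s0 hd.
have ss : 0 <= s <= s by rewrite lexx ltW.
have z0 : 0 <= (0 : R) <= s by rewrite lexx ltW.
pose a t := h (t *: u + (s *: v + p)) - h (t *: u + p).
have da t : 0 <= t <= s -> is_derive t 1 a ('D_u h (t *: u + (s *: v + p)) - 'D_u h (t *: u + p)).
  move=> ts; apply: is_deriveB.
    apply: (is_derive_line (S := fun t => t *: u + (s *: v + p))) => [w|].
      by rewrite scalerDl -addrA.
    exact: (hd _ _ ts ss).1.
  apply: (is_derive_line (S := fun t => t *: u + p)) => [w|].
    by rewrite scalerDl -addrA.
  by move: (hd _ _ ts z0).1; rewrite scale0r add0r.
have [t1 t1s E1] := MVT_cc (ltW s0) da.
have db t : 0 <= t <= s -> is_derive t 1 (fun t => 'D_u h (t1 *: u + (t *: v + p)))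
    ('D_v ('D_u h) (t1 *: u + (t *: v + p))).
  move=> ts; apply: (is_derive_line (S := fun t => t1 *: u + (t *: v + p))) => [w|].
    by rewrite scalerDl -[(w *: v + t *: v) + p]addrA [LHS]addrCA.
  by have [] := hd _ _ t1s ts.
have [t2 t2s E2] := MVT_cc (ltW s0) db.
exists t1, t2; split=> //.
rewrite expr2 mulrA -[s in _ * s * _]subr0 -E2 scale0r add0r -[s in _ * s]subr0 -E1 /a.
by rewrite scale0r !add0r.
Qed.

(** Exchanging [u] and [v] leaves the second difference unchanged, so some value of one mixed
    derivative near [p] equals some value of the other; continuity concludes. Symmetry is needed
    because [mpartial] fixes the order of the variables while [CB] allows all orders. *)
Lemma schwarz {V : normedModType R} (h : V -> R) (u v p : V) (U : set V) : open U -> U p ->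
  (forall q, U q -> [/\ derivable h q u, derivable h q v,
     derivable ('D_u h) q v & derivable ('D_v h) q u]) ->
  {for p, continuous ('D_v ('D_u h))} -> {for p, continuous ('D_u ('D_v h))} ->
  'D_v ('D_u h) p = 'D_u ('D_v h) p.
Proof.
move=> oU Up hd c1 c2; apply/eqP; rewrite -subr_eq0 -normr_eq0.
apply/eqP/le_anti; rewrite normr_ge0 andbT; apply/ler_addgt0Pr => e e0; rewrite add0r.
have e2 : 0 < e / 2 by rewrite divr_gt0.
have [r /= r0 hr] : exists2 r : R, 0 < r & forall q, ball p r q ->
   [/\ U q, `|'D_v ('D_u h) p - 'D_v ('D_u h) q| < e / 2 & `|'D_u ('D_v h) p - 'D_u ('D_v h) q| < e / 2].
  have /nbhs_ballP[r0 /= r00 h0] := open_nbhs_nbhs (conj oU Up).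
  have /cvgrPdist_lt/(_ _ e2)/nbhs_ballP[r1 /= r10 h1] := c1.
  have /cvgrPdist_lt/(_ _ e2)/nbhs_ballP[r2 /= r20 h2] := c2.
  exists (Num.min r0 (Num.min r1 r2)); first by rewrite !lt_min r00 r10.
  move=> q bq; split; [apply: h0|apply: h1|apply: h2];
    by apply: le_ball bq; rewrite !ge_min lexx ?orbT.
pose K := `|u| + `|v| + 1.
have K0 : 0 < K by rewrite ltr_wpDl// addr_ge0.
(* This keeps the parallelogram spanned by s u and s v at [p] inside the ball of radius r. *)
pose s := r / (2 * K).
have s0 : 0 < s by rewrite divr_gt0// mulr_gt0.
have inb t1 t2 : 0 <= t1 <= s -> 0 <= t2 <= s -> ball p r (t1 *: u + (t2 *: v + p)).
  move=> /andP[t10 t1s] /andP[t20 t2s].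
  rewrite -ball_normE /ball_ /= addrA opprD addrCA subrr addr0 normrN.
  apply: (le_lt_trans (ler_normD _ _)); rewrite !normrZ !ger0_norm//.
  apply: (@le_lt_trans _ _ (s * `|u| + s * `|v|)).
    by rewrite lerD// ler_wpM2r.
  apply: (@le_lt_trans _ _ (s * K)).
    by rewrite -mulrDr ler_wpM2l ?(ltW s0)// lerDl.
  rewrite (_ : s * K = r / 2); last by rewrite /s; field; rewrite gt_eqF.
  by rewrite ltr_pdivrMr// ltr_pMr// ltr1n.
have [t1 [t2 [h1 h2 E]]] := @mixed_difference V h u v p s s0
  (fun t1 t2 h1 h2 => let: And3 Uq _ _ := hr _ (inb _ _ h1 h2) in let: And4 a _ c _ := hd _ Uq in conj a c).
have inb' t1' t2' : 0 <= t1' <= s -> 0 <= t2' <= s -> ball p r (t1' *: v + (t2' *: u + p)).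
  by move=> a b; rewrite addrCA; exact: inb.
have [t1' [t2' [h1' h2' E']]] := @mixed_difference V h v u p s s0
  (fun t1 t2 h1 h2 => let: And3 Uq _ _ := hr _ (inb' _ _ h1 h2) in let: And4 _ a _ c := hd _ Uq in conj a c).
have [_ A _] := hr _ (inb _ _ h1 h2); have [_ _ A'] := hr _ (inb' _ _ h1' h2').
have EE : 'D_v ('D_u h) (t1 *: u + (t2 *: v + p)) = 'D_u ('D_v h) (t1' *: v + (t2' *: u + p)).
  have s20 : s ^+ 2 != 0 by rewrite expf_neq0// gt_eqF.
  have EA : s *: u + (s *: v + p) = s *: v + (s *: u + p) by rewrite addrCA.
  move: E E'; rewrite EA.
  move: (h _) (h (s *: u + p)) (h (s *: v + p)) (h p) => a1 a2 a3 a4.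
  move: ('D_v _ _) ('D_u _ _) => y1 y2 E E'.
  apply: (mulIf s20); rewrite -E -E'.
  by ring.
rewrite (splitr e) -(subrKA ('D_v ('D_u h) (t1 *: u + (t2 *: v + p)))).
apply: (le_trans (ler_normD _ _)); apply: lerD; first exact: (ltW A).
rewrite EE distrC; exact: (ltW A').
Qed.

Variables (m : nat) (U : set 'rV[R]_m) (f : 'rV[R]_m -> R).
Hypothesis oU : open U.
Hypothesis sf : smooth_on U f.

Lemma partial_ext (g g' : 'rV[R]_m -> R) i : (forall x, U x -> g x = g' x) ->
  forall x, U x -> partial i g x = partial i g' x.
Proof. by move=> gg x Ux; apply: near_eq_derive; exact: (near_open_eq oU). Qed.

Lemma partials_swap i j s x : U x -> partials (i :: j :: s) f x = partials (j :: i :: s) f x.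
Proof.
move=> Ux; apply: (schwarz oU Ux) => [q Uq||].
- split; [exact: (sf s Uq).2|exact: (sf s Uq).2| |].
  + exact: (sf (j :: s) Uq).2.
  + exact: (sf (i :: s) Uq).2.
- exact: (sf (i :: j :: s) Ux).1.
- exact: (sf (j :: i :: s) Ux).1.
Qed.

Lemma partials_front (s1 : seq 'I_m) i s2 x : U x ->
  partials (s1 ++ i :: s2) f x = partials (i :: s1 ++ s2) f x.
Proof.
elim: s1 x => [//|j s1 IH] x Ux.
rewrite [LHS](partial_ext j IH Ux).
exact: (partials_swap j i (s1 ++ s2) Ux).
Qed.

Lemma partials_perm (s s' : seq 'I_m) x : perm_eq s s' -> U x -> partials s f x = partials s' f x.
Proof.
elim: s s' x => [|i s IH] s' x.
  by rewrite perm_sym => /perm_nilP ->.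
move=> ps; have : i \in s' by rewrite -(perm_mem ps) mem_head.
move=> /path.splitPr is'; case: is' ps => s1 s2 ps Ux.
rewrite partials_front//; apply: partial_ext Ux => y Uy; apply: IH Uy.
by move: ps; rewrite perm_sym -cat1s perm_catCA /= perm_cons perm_sym.
Qed.

Definition word_of (a : 'I_m -> nat) : seq 'I_m := flatten [seq nseq (a i) i | i <- enum 'I_m].

Lemma mpartialE a (g : 'rV[R]_m -> R) : mpartial a g = partials (word_of a) g.
Proof.
rewrite /mpartial /word_of; elim: (enum 'I_m) => [//|i s IH] /=.
rewrite IH /partials foldr_cat; move: (foldr _ g _) => k.
by elim: (a i) => [//|n IHn] /=; rewrite IHn.
Qed.

Lemma perm_word_of (w : seq 'I_m) : perm_eq w (word_of (fun i => count_mem i w)).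
Proof.
apply/allP => i _; apply/eqP => /=.
rewrite /word_of count_flatten -map_comp.
rewrite (eq_map (g := fun j => if j == i then count_mem i w else 0%N)); last first.
  by move=> j /=; rewrite count_nseq /=; case: eqP => [->|_]; rewrite ?mul1n ?mul0n.
rewrite sumnE big_map big_enum /= -big_mkcond /=.
by rewrite (big_pred1 i) // => j; rewrite eq_sym.
Qed.

Lemma size_word_of a : size (word_of a) = mdeg a.
Proof.
rewrite /word_of size_flatten /shape -map_comp sumnE big_map big_enum /=.
by apply: eq_bigr => i _; rewrite size_nseq.
Qed.

Lemma mdeg_count (w : seq 'I_m) : mdeg (fun i => count_mem i w) = size w.
Proof. by rewrite -size_word_of (perm_size (perm_word_of w)). Qed.

Lemma ders_mpartial (w : seq 'I_m) x : U x ->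
  ders (@coord_dir R m) w f x = mpartial (fun i => count_mem i (rev w)) f x.
Proof.
move=> Ux; rewrite mpartialE -(partials_perm (perm_word_of _) Ux).
by rewrite /ders -{1}(revK w) foldl_rev.
Qed.

End Schwarz.

Lemma ders_partials {R : realType} m w (f : 'rV[R]_m -> R) :
  ders (@coord_dir R m) w f = partials (rev w) f.
Proof. by rewrite /ders -{1}(revK w) foldl_rev. Qed.

(** By symmetry every word of derivatives depends only on its multi-index, and [QM] bounds the
    derivatives indexed by multi-indices. *)
Lemma QM_DC {R : realType} (rho M : nat -> R) m (U : set 'rV[R]_m) (h : 'rV[R]_m -> R) x0 :
  gauge rho -> (exists A B, [/\ 0 < A, 0 < B & forall n, M n <= A * (B * rho n) ^+ n]) ->
  open U -> QM M U h -> U x0 ->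
  exists r, [/\ 0 < r, ball x0 r `<=` U & DC rho (@coord_dir R m) (ball x0 r) h].
Proof.
move=> hrho [A [B [A0 B0 hM]]] oU [sm hb] Ux.
have [W [C [r [nW WU C0 r0 hW]]]] := hb _ Ux.
have /nbhs_ballP[d /= d0 hd] := nW.
exists d; split=> //; first by move=> x /hd/WU.
exists (C * A), (r * B); split; rewrite ?mulr_gt0// => n.
apply/CBP; split=> [w q wn bq|w q i wn bq].
  have Wq := hd _ bq; have Uq := WU _ Wq; split.
    by rewrite ders_partials; exact: (sm _ _ Uq).1.
  rewrite (ders_mpartial oU sm)//; apply: (le_trans (hW _ _ Wq)).
  rewrite mdeg_count size_rev /wt.
  rewrite [leRHS](_ : _ = (C * r ^+ size w * (size w)`!%:R) * (A * (B * rho (size w)) ^+ size w)); last by rewrite !exprMn; ring.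
  by apply: ler_wpM2l => //; rewrite !mulr_ge0 ?exprn_ge0// ltW.
have Uq := WU _ (hd _ bq).
by rewrite ders_partials; exact: (sm _ _ Uq).2.
Qed.

(** * A series with poles accumulating at 0 from the left *)

Section SeriesFamily.
Context {R : realType}.

Definition gsum (u : nat -> R) : R := limn (series u).

(** Normalised so that the sum of a dominated series is at most [B]. *)
Definition gdom (B : R) (u : nat -> R) := forall k, `|u k| <= B * 2^-1 ^+ k.+1.

Lemma gdom_series_half (B : R) :
  series (fun k => B * 2^-1 ^+ k.+1) @ \oo --> B.
Proof.
have := @cvg_geometric_series R (B / 2) 2^-1.
rewrite gtr0_norm ?invr_gt0// invf_lt1// ltr1n => /(_ isT).
rewrite (_ : B / 2 / (1 - 2^-1) = B); last by field.
rewrite (_ : geometric _ _ = fun k => B * 2^-1 ^+ k.+1)//.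
by apply/funext => k; rewrite /geometric /= exprS mulrA.
Qed.

Lemma gdom_cvg B u : gdom B u -> cvgn (series u).
Proof.
move=> h; apply: normed_cvg.
apply: (series_le_cvg _ _ h) => [n|n|]; first exact: normr_ge0.
  by apply: le_trans (h n).
apply/cvg_ex; exists B; exact: gdom_series_half.
Qed.

Lemma gsum_le B u : gdom B u -> `|gsum u| <= B.
Proof.
move=> h.
have cn : cvgn [normed series u].
  apply: (series_le_cvg _ _ h) => [n|n|]; first exact: normr_ge0.
    by apply: le_trans (h n).
  apply/cvg_ex; exists B; exact: gdom_series_half.
apply: (le_trans (lim_series_norm cn)).
have cB : cvgn (series (fun k => B * 2^-1 ^+ k.+1)).
  by apply/cvg_ex; exists B; exact: gdom_series_half.
apply: (le_trans (lim_series_le cn cB h)).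
by rewrite (cvg_lim _ (@gdom_series_half B)).
Qed.

Lemma gsumD B B' u v : gdom B u -> gdom B' v -> gsum (fun k => u k + v k) = gsum u + gsum v.
Proof.
by move=> hu hv; rewrite /gsum -(lim_seriesD (gdom_cvg hu) (gdom_cvg hv)).
Qed.

Lemma gsumZ B u c : gdom B u -> gsum (fun k => c * u k) = c * gsum u.
Proof. by move=> hu; rewrite /gsum -[RHS](lim_seriesZ c (gdom_cvg hu)). Qed.

Lemma gdomD B B' u v : gdom B u -> gdom B' v -> gdom (B + B') (fun k => u k + v k).
Proof. by move=> hu hv k; rewrite (le_trans (ler_normD _ _))// mulrDl lerD. Qed.

Lemma gdomZ B u c : gdom B u -> gdom (`|c| * B) (fun k => c * u k).
Proof. by move=> hu k; rewrite normrM -mulrA ler_wpM2l. Qed.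

Lemma gsum_ge B u j : gdom B u -> (forall k, 0 <= u k) -> u j <= gsum u.
Proof.
move=> hu u0; have cu := gdom_cvg hu.
have nd : nondecreasing_seq (series u).
  by apply: nondecreasing_series => k _ _; exact: u0.
apply: le_trans (nondecreasing_cvgn_le nd cu j.+1).
rewrite /series /= big_nat_recr//= lerDr.
by apply: sumr_ge0 => i _.
Qed.

Section Family.
Variables (phi : nat -> R -> R) (D : set R) (A : nat -> R).
Hypothesis Dconv : forall x y z, D x -> D y -> x <= z <= y -> D z.
Hypothesis dphi : forall n x, D x -> is_derive x 1 (phi n) (phi n.+1 x).
Hypothesis phiA : forall n x, D x -> `|phi n x| <= A n.

Let MVT_D n x y : D x -> D y -> exists c, [/\ D c, `|c - x| <= `|y - x| &
  phi n y - phi n x = phi n.+1 c * (y - x)].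
Proof.
move=> Dx Dy; case: (leP x y) => [xy|/ltW yx].
  have [c /andP[xc cy] E] := MVT_cc xy (fun z h => dphi n (Dconv Dx Dy h)).
  exists c; split=> //; first by apply: (Dconv Dx Dy); rewrite xc.
  by rewrite !ger0_norm ?subr_ge0// lerB.
have [c /andP[yc cx] E] := MVT_cc yx (fun z h => dphi n (Dconv Dy Dx h)).
exists c; split.
- by apply: (Dconv Dy Dx); rewrite yc.
- by rewrite !ler0_norm ?subr_le0// !opprB lerB.
- by rewrite -opprB E -mulrN opprB.
Qed.

Lemma quad_remainder n x y : D x -> D y ->
  `|phi n y - phi n x - phi n.+1 x * (y - x)| <= A n.+2 * (y - x) ^+ 2.
Proof.
move=> Dx Dy; have [c [Dc cx ->]] := MVT_D n Dx Dy.
rewrite -mulrBl; have [d [Dd _ ->]] := MVT_D n.+1 Dx Dc.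
rewrite -[(y - x) ^+ 2]ger0_norm ?sqr_ge0// normrX expr2 mulrA !normrM.
rewrite ler_wpM2r// ler_pM//; exact: phiA.
Qed.

Variables (s c : nat -> R) (X : set R) (B : nat -> R).
Hypothesis sX : forall k x, X x -> D (s k * x).
Hypothesis cB : forall n, gdom (B n) (fun k => c k * s k ^+ n).

(** The n-th derivative, term by term, of the sum of c k * phi 0 (s k * x). *)
Definition sfam n x := gsum (fun k => c k * s k ^+ n * phi n (s k * x)).

Lemma sfam_dom n x : X x -> gdom (A n * B n) (fun k => c k * s k ^+ n * phi n (s k * x)).
Proof.
move=> Xx k; rewrite normrM mulrC -mulrA ler_pM//; last exact: cB.
exact/phiA/sX.
Qed.

Lemma sfam_bound n x : X x -> `|sfam n x| <= A n * B n.
Proof. by move=> Xx; exact: gsum_le (sfam_dom n Xx). Qed.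

(** A second-order Taylor estimate of each term, summed. It replaces a theorem on differentiating
    series, and being free of neighbourhoods it also serves the one-sided derivatives at the ends of
    an interval. *)
Lemma sfam_remainder n x y : X x -> X y ->
  `|sfam n y - sfam n x - sfam n.+1 x * (y - x)| <= A n.+2 * B n.+2 * (y - x) ^+ 2.
Proof.
move=> Xx Xy.
have E : sfam n y - sfam n x - sfam n.+1 x * (y - x) =
  gsum (fun k => c k * s k ^+ n * phi n (s k * y) + (-1 * (c k * s k ^+ n * phi n (s k * x)) +
    - (y - x) * (c k * s k ^+ n.+1 * phi n.+1 (s k * x)))).
  have d1 := sfam_dom n Xy; have d2 := gdomZ (-1) (sfam_dom n Xx).
  have d3 := gdomZ (- (y - x)) (sfam_dom n.+1 Xx).
  rewrite (gsumD d1 (gdomD d2 d3)) (gsumD d2 d3) (gsumZ _ (sfam_dom n Xx)) (gsumZ _ (sfam_dom n.+1 Xx)).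
  by rewrite -!/(sfam _ _); ring.
rewrite E; apply: gsum_le => k.
have -> : c k * s k ^+ n * phi n (s k * y) + (-1 * (c k * s k ^+ n * phi n (s k * x)) +
    - (y - x) * (c k * s k ^+ n.+1 * phi n.+1 (s k * x))) =
  c k * s k ^+ n * (phi n (s k * y) - phi n (s k * x) - phi n.+1 (s k * x) * (s k * y - s k * x)).
  by rewrite exprS; ring.
rewrite normrM; apply: (le_trans (ler_wpM2l (normr_ge0 _) (quad_remainder n (sX k Xx) (sX k Xy)))).
rewrite [leLHS](_ : _ = A n.+2 * (y - x) ^+ 2 * `|c k * s k ^+ n.+2|); last first.
  have -> : `|c k * s k ^+ n.+2| = `|c k * s k ^+ n| * s k ^+ 2.
    by rewrite -[n.+2]addn2 exprD mulrA normrM [`|s k ^+ 2|]ger0_norm ?sqr_ge0.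
  by ring.
rewrite [leRHS](_ : _ = A n.+2 * (y - x) ^+ 2 * (B n.+2 * 2^-1 ^+ k.+1)); last by ring.
rewrite ler_wpM2l//; last exact: cB.
by rewrite mulr_ge0 ?sqr_ge0// (le_trans (normr_ge0 _) (phiA n.+2 (sX 0 Xx))).
Qed.

End Family.

Lemma is_derive_remainder (F : R -> R) (x d K : R) :
  (forall y, `|F y - F x - d * (y - x)| <= K * (y - x) ^+ 2) -> is_derive x 1 F d.
Proof.
move=> h.
have K0 : 0 <= K.
  have := le_trans (normr_ge0 _) (h (x + 1)).
  by rewrite [x + 1]addrC addrK expr1n mulr1.
have cF : (fun t : R => t^-1 *: (F (t *: 1 + x) - F x)) @ 0^' --> d.
  apply/cvgrPdist_lt => e e0; near=> t.
  have t0 : t != 0 by near: t; exact: nbhs_dnbhs_neq.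
  have := h (t + x); rewrite addrK => ht.
  rewrite [t *: 1]mulr1 -[_ *: _]/(_ * _) distrC.
  have -> : t^-1 * (F (t + x) - F x) - d = t^-1 * (F (t + x) - F x - d * t) by field.
  rewrite normrM normfV mulrC ltr_pdivrMr ?normr_gt0//.
  apply: (le_lt_trans ht); rewrite -[t ^+ 2]ger0_norm ?sqr_ge0// normrX expr2 mulrA ltr_pM2r ?normr_gt0//.
  apply: (@le_lt_trans _ _ ((K + 1) * `|t|)); first by rewrite ler_wpM2r// lerDl.
  rewrite mulrC -ltr_pdivlMr ?ltr_wpDl//; near: t; apply: dnbhs0_lt.
  by rewrite divr_gt0// ltr_wpDl.
by apply: DeriveDef; [apply/cvg_ex; exists d|exact: cvg_lim cF].
Unshelve. all: by end_near. Qed.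

Lemma derive_in_remainder (I : interval R) (F : R -> R) (x d K : R) :
  ProperFilter (within [set` I] x^') ->
  (forall y, y \in I -> `|F y - F x - d * (y - x)| <= K * (y - x) ^+ 2) ->
  diffquot F x @ within [set` I] x^' --> d.
Proof.
move=> PF h; apply/cvgrPdist_lt => e e0.
have K1 : 0 < `|K| + 1 by rewrite ltr_wpDl.
have nx : \forall y \near x, `|x - y| < e / (`|K| + 1).
  by apply/nbhs_ballP; exists (e / (`|K| + 1)); [rewrite /= divr_gt0|move=> y; rewrite -ball_normE].
near=> y.
have yI : y \in I by near: y; exact: withinT.
have yx : y - x != 0.
  by rewrite subr_eq0; near: y; apply: cvg_within; exact: withinT.
rewrite /diffquot distrC.
have -> : (F y - F x) / (y - x) - d = (F y - F x - d * (y - x)) / (y - x).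
  by rewrite [RHS]mulrBl mulfK.
rewrite normrM normfV ltr_pdivrMr ?normr_gt0//; apply: (le_lt_trans (h y yI)).
rewrite -[(y - x) ^+ 2]ger0_norm ?sqr_ge0// normrX expr2 mulrA ltr_pM2r ?normr_gt0//.
apply: (@le_lt_trans _ _ ((`|K| + 1) * `|y - x|)).
  by rewrite ler_wpM2r// (le_trans (ler_norm K))// lerDl.
rewrite mulrC -ltr_pdivlMr// distrC; near: y; apply: cvg_within; exact: cvg_within.
Unshelve. all: by end_near. Qed.

End SeriesFamily.

(** * The kernels 1/(1 + x) and 1/(1 + t^2) *)

Section Kernels.
Context {R : realType}.

Lemma is_derive_lin (c t : R) : is_derive t 1 (fun t : R => c * t) c.
Proof.
have := is_deriveZ c (is_derive_id t (1 : R)).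
by rewrite [_ *: 1]mulr1.
Qed.

Definition geom_ker n (x : R) : R := (-1) ^+ n * n`!%:R * (1 + x)^-1 ^+ n.+1.

Lemma geom_ker_derive n (x : R) : 0 <= x -> is_derive x 1 (geom_ker n) (geom_ker n.+1 x).
Proof.
move=> x0; have nz : 1 + x != 0 by rewrite gt_eqF// ltr_wpDr.
have D1 : is_derive x 1 (fun x : R => (1 + x)^-1) (- ((1 + x)^-1 ^+ 2)).
  have D0 : is_derive x 1 (fun x : R => 1 + x) 1.
    by have := is_derive_shift x 1 (1 : R); rewrite (_ : shift 1 = fun x => 1 + x)//; apply/funext => y; rewrite addrC.
  have [d0 e0] := D0.
  have := derivableV nz d0; have := deriveV nz d0; rewrite e0 => ev dv.
  apply: DeriveDef => //; by rewrite [LHS]ev -[_ *: _]/(_ * _) mulr1 exprVn.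
have D2 := @is_derive1_comp R (fun y : R => y ^+ n.+1) (fun x : R => (1 + x)^-1) x (n.+1%:R * (1 + x)^-1 ^+ n) _ _ D1.
have {}D2 := D2 _; have D3 : is_derive (1 + x)^-1 1 (fun y : R => y ^+ n.+1) (n.+1%:R * (1 + x)^-1 ^+ n).
  by apply: DeriveDef; [exact: exprn_derivable|rewrite exp_derive [LHS]mulr1].
have D4 := is_deriveZ ((-1) ^+ n * n`!%:R) (D2 D3).
apply: (is_derive_eq D4); rewrite -[_ *: _]/(_ * _) /geom_ker factS natrM.
by move: (1 + x)^-1 => a; rewrite [a ^+ n.+2]exprS [a ^+ n.+1]exprS [(-1) ^+ n.+1]exprS; ring.
Qed.

Lemma geom_ker_le n (x : R) : 0 <= x -> `|geom_ker n x| <= n`!%:R.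
Proof.
move=> x0; rewrite /geom_ker !normrM normrX normrN1 expr1n mul1r ger0_norm// ler_piMr//.
rewrite normrX exprn_ile1// normfV ger0_norm ?addr_ge0// invf_le1 ?lerDl//.
by rewrite ltr_wpDr.
Qed.

(** Successive derivatives of u = 1/(1 + t^2), two at a time. The recurrence is Leibniz's formula
    for the derivative of order n + 2 of (1 + t^2) u = 1. *)
Fixpoint cauchy_ker2 (n : nat) : (R -> R) * (R -> R) :=
  match n with
  | 0 => (fun t => (1 + t ^+ 2)^-1, fun t => - (2 * t) * (1 + t ^+ 2)^-1 ^+ 2)
  | n'.+1 => let: (p, q) := cauchy_ker2 n' in
     (q, fun t => - (2 * n'.+2%:R * t * q t + n'.+2%:R * n'.+1%:R * p t) * (1 + t ^+ 2)^-1)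
  end.

Definition cauchy_ker n := (cauchy_ker2 n).1.

Lemma cauchy_kerSS n t : cauchy_ker n.+2 t =
  - (2 * n.+2%:R * t * cauchy_ker n.+1 t + n.+2%:R * n.+1%:R * cauchy_ker n t) * (1 + t ^+ 2)^-1.
Proof. by rewrite /cauchy_ker /=; case: (cauchy_ker2 n) => p q /=. Qed.

Lemma cauchy_ker_derive n (t : R) : is_derive t 1 (cauchy_ker n) (cauchy_ker n.+1 t).
Proof.
have nz (x : R) : 1 + x ^+ 2 != 0 by rewrite gt_eqF// ltr_wpDr// sqr_ge0.
have Dsq : is_derive t 1 (fun t : R => 1 + t ^+ 2) (2 * t).
  have D : is_derive t 1 (fun t : R => t ^+ 2) (2 * t).
    by apply: DeriveDef; [exact: exprn_derivable|rewrite exp_derive [LHS]mulr1 /= expr1].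
  have := is_deriveD (is_derive_cst (1 : R) t 1) D; rewrite add0r; exact.
have DV : is_derive t 1 (fun t : R => (1 + t ^+ 2)^-1) (- (2 * t) * (1 + t ^+ 2)^-1 ^+ 2).
  have [d0 e0] := Dsq.
  have dv := @derivableV R R (fun t : R => 1 + t ^+ 2) t 1 (nz t) d0.
  have ev := @deriveV R R (fun t : R => 1 + t ^+ 2) t 1 (nz t) d0.
  rewrite e0 in ev; apply: DeriveDef; first exact: dv.
  by rewrite [LHS]ev -[_ *: _]/(_ * _) exprVn; ring.
suff H : is_derive t 1 (cauchy_ker n) (cauchy_ker n.+1 t) /\
         is_derive t 1 (cauchy_ker n.+1) (cauchy_ker n.+2 t) by case: H.
elim: n => [|n [IH1 IH2]].
  split; first exact: DV.
  have D2t : is_derive t 1 (fun t : R => - (2 * t)) (- 2).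
    exact: (is_deriveN (is_derive_lin 2 t)).
  have DM := is_deriveM D2t (is_deriveM DV DV).
  have E : cauchy_ker 1 = (fun t : R => - (2 * t)) * ((fun t : R => (1 + t ^+ 2)^-1) * (fun t : R => (1 + t ^+ 2)^-1)).
    by apply/funext => x; rewrite /cauchy_ker /= expr2.
  rewrite E; apply: (is_derive_eq DM); rewrite cauchy_kerSS -![_ *: _]/(_ * _).
  have -> : ((fun t0 : R => (1 + t0 ^+ 2)^-1) * (fun t0 : R => (1 + t0 ^+ 2)^-1)) t = (1 + t ^+ 2)^-1 ^+ 2 by rewrite expr2.
  rewrite (_ : cauchy_ker 1 t = - (2 * t) * (1 + t ^+ 2)^-1 ^+ 2)//.
  rewrite (_ : cauchy_ker 0 t = (1 + t ^+ 2)^-1)//.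
  by move: (1 + t ^+ 2)^-1 => v; ring.
split=> //.
have D2t : is_derive t 1 (fun t : R => 2 * n.+2%:R * t) (2 * n.+2%:R).
  exact: is_derive_lin.
have DA := is_deriveM D2t IH2.
have DB := is_deriveZ (n.+2%:R * n.+1%:R) IH1.
have DN := is_deriveN (is_deriveD DA DB).
have DM := is_deriveM DN DV.
have E : cauchy_ker n.+2 = - ((fun t : R => 2 * n.+2%:R * t) * cauchy_ker n.+1 + n.+2%:R * n.+1%:R *: cauchy_ker n) * (fun t : R => (1 + t ^+ 2)^-1).
  by apply/funext => x; rewrite cauchy_kerSS.
rewrite E; apply: (is_derive_eq DM).
rewrite [cauchy_ker n.+3 t]cauchy_kerSS -![_ *: _]/(_ * _).
have -> : (- ((fun t : R => 2 * n.+2%:R * t) * cauchy_ker n.+1 + n.+2%:R * n.+1%:R *: cauchy_ker n)) t = - (2 * n.+2%:R * t * cauchy_ker n.+1 t + n.+2%:R * n.+1%:R * cauchy_ker n t) by [].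
rewrite [cauchy_ker n.+2 t]cauchy_kerSS.
move: (cauchy_ker n.+1 t) (cauchy_ker n t) (1 + t ^+ 2)^-1 => b c v.
by ring.
Qed.

(** Both |2t| / (1 + t^2) and 1 / (1 + t^2) are at most 1, so the recurrence reduces the claim to
    2^(n+1) + 2^n <= 2^(n+2). *)
Lemma cauchy_ker_le n (t : R) : `|cauchy_ker n t| <= 2 ^+ n * n`!%:R.
Proof.
have p0 (x : R) : 0 < 1 + x ^+ 2 by rewrite ltr_wpDr// sqr_ge0.
have V1 (x : R) : `|(1 + x ^+ 2)^-1| <= 1.
  by rewrite ger0_norm ?invr_ge0 ?(ltW (p0 x))// invf_le1// lerDl sqr_ge0.
have V2 (x : R) : `|2 * x * (1 + x ^+ 2)^-1| <= 1.
  rewrite normrM normfV (gtr0_norm (p0 x)) ler_pdivrMr// mul1r.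
  rewrite normrM (ger0_norm (ler0n _ 2)) -(real_normK (num_real x)).
  by have := sqr_ge0 (`|x| - 1); nra.
suff H : `|cauchy_ker n t| <= 2 ^+ n * n`!%:R /\ `|cauchy_ker n.+1 t| <= 2 ^+ n.+1 * (n.+1)`!%:R by case: H.
elim: n => [|n [IH1 IH2]].
  split; first by rewrite /cauchy_ker /= expr0 mul1r; exact: V1.
  rewrite (_ : cauchy_ker 1 t = - (2 * t * (1 + t ^+ 2)^-1) * (1 + t ^+ 2)^-1); last first.
    by rewrite /cauchy_ker /=; move: (1 + t ^+ 2)^-1 => v; ring.
  rewrite normrM normrN; apply: (@le_trans _ _ (1 * 1)); first exact: ler_pM.
  by rewrite expr1 (_ : 1`! = 1%N)//; lra.
split=> //; rewrite cauchy_kerSS.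
rewrite [X in `|X|](_ : _ = - (n.+2%:R * cauchy_ker n.+1 t * (2 * t * (1 + t ^+ 2)^-1)) -
   n.+2%:R * n.+1%:R * cauchy_ker n t * (1 + t ^+ 2)^-1); last by ring.
have h1 : `|n.+2%:R * cauchy_ker n.+1 t * (2 * t * (1 + t ^+ 2)^-1)| <= n.+2%:R * (2 ^+ n.+1 * (n.+1)`!%:R).
  rewrite normrM normrM (ger0_norm (ler0n _ n.+2)) -[leRHS]mulr1.
  by apply: ler_pM => //; rewrite ler_wpM2l.
have h2 : `|n.+2%:R * n.+1%:R * cauchy_ker n t * (1 + t ^+ 2)^-1| <= n.+2%:R * n.+1%:R * (2 ^+ n * n`!%:R).
  rewrite normrM normrM (ger0_norm (_ : 0 <= n.+2%:R * n.+1%:R)) ?mulr_ge0// -[leRHS]mulr1.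
  by apply: ler_pM => //; rewrite ?mulr_ge0// ler_wpM2l ?mulr_ge0.
apply: (le_trans (ler_normB _ _)); rewrite normrN; apply: (le_trans (lerD h1 h2)).
rewrite [(n.+2)`!]factS [(n.+1)`!]factS !natrM [2 ^+ n.+2]exprS [2 ^+ n.+1]exprS.
have X0 : 0 <= n.+2%:R * n.+1%:R * (2 ^+ n * n`!%:R) :> R by rewrite !mulr_ge0 ?exprn_ge0.
rewrite [leRHS](_ : _ = 4 * (n.+2%:R * n.+1%:R * (2 ^+ n * n`!%:R))); last by ring.
rewrite [leLHS](_ : _ = 3 * (n.+2%:R * n.+1%:R * (2 ^+ n * n`!%:R))); last by ring.
by lra.
Qed.

End Kernels.

(** * The function f and its Taylor remainders *)

Section SparsePoles.
Context {R : realType}.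
Variable rho : nat -> R.
Hypothesis hrho : gauge rho.

Definition scl (k : nat) : R := k.+1%:R.

Lemma scl_ge1 k : 1 <= scl k. Proof. by rewrite ler1n. Qed.

Lemma scl_gt0 k : 0 < scl k. Proof. by rewrite ltr0n. Qed.

Definition lvl k : nat :=
  let: And4 _ _ h _ := hrho in sval (cid (h (scl k ^+ 2))).

Lemma lvlP k : scl k ^+ 2 <= rho (lvl k).
Proof. rewrite /lvl; case: hrho => a b h d; exact: (svalP (cid (h (scl k ^+ 2)))). Qed.

(** The first factor makes the series converge. The minimum keeps the base of the second at most 1
    and its product with [scl k ^+ 2] at most rho 0; [lvl k] is a rank at which rho has reached
    [scl k ^+ 2]. *)
Definition wgt k : R := 2^-1 ^+ k.+1 * (Num.min 1 (rho 0) / scl k ^+ 2) ^+ lvl k.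

Lemma min_gt0 : 0 < Num.min 1 (rho 0).
Proof. by rewrite lt_min ltr01 (gauge_gt0 hrho). Qed.

Lemma wgt_gt0 k : 0 < wgt k.
Proof.
by rewrite mulr_gt0 ?exprn_gt0 ?invr_gt0// divr_gt0 ?min_gt0// exprn_gt0// scl_gt0.
Qed.

(* The weight of index k is so small that the first lvl k moments are harmless; from rank lvl k on, rho dominates the pole. *)
Lemma wgt_moment k n : wgt k * (scl k ^+ 2) ^+ n <= 2^-1 ^+ k.+1 * rho n ^+ n.
Proof.
have a0 : 0 < scl k ^+ 2 by rewrite exprn_gt0// scl_gt0.
have a1 : 1 <= scl k ^+ 2 by rewrite exprn_ege1// scl_ge1.
rewrite /wgt -mulrA ler_wpM2l ?exprn_ge0 ?invr_ge0//.
set q := Num.min 1 (rho 0) / scl k ^+ 2.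
have q0 : 0 <= q by rewrite divr_ge0 ?(ltW min_gt0)// ltW.
have q1 : q <= 1 by rewrite ler_pdivrMr// mul1r (le_trans _ a1)// ge_min lexx.
case: (leqP (lvl k) n) => nl.
  apply: (@le_trans _ _ (1 * (scl k ^+ 2) ^+ n)).
    by rewrite ler_wpM2r ?exprn_ge0// ?(ltW a0)// exprn_ile1.
  rewrite mul1r lerXn2r// ?nnegrE ?(ltW a0) ?(gauge_ge0 hrho)//.
  by rewrite (le_trans (lvlP k))// (gauge_le hrho).
apply: (@le_trans _ _ (q ^+ n * (scl k ^+ 2) ^+ n)).
  by rewrite ler_wpM2r ?exprn_ge0// ?(ltW a0)// ler_wiXn2l// ltnW.
have qa : q * scl k ^+ 2 <= rho n.
  rewrite /q -mulrA mulVf ?gt_eqF// mulr1 (le_trans _ (gauge_le hrho (leq0n n)))//.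
  by rewrite ge_min lexx orbT.
rewrite -exprMn lerXn2r// nnegrE ?(gauge_ge0 hrho)//.
by rewrite mulr_ge0// ltW.
Qed.

(** With a = [scl k ^+ 2], the fraction 1/(1 + a x) is the sum of (-a x)^j for j < K plus (-a x)^K /
    (1 + a x). These are therefore the weights of the K-th Taylor remainder of f divided by x^K. *)
Definition coef K k : R := wgt k * (- scl k ^+ 2) ^+ K.

Lemma coef_norm K k : `|coef K k| = wgt k * (scl k ^+ 2) ^+ K.
Proof.
have s0 : 0 <= scl k ^+ 2 by rewrite exprn_ge0// ltW// scl_gt0.
by rewrite /coef normrM (gtr0_norm (wgt_gt0 k)) normrX normrN (ger0_norm s0).
Qed.

Lemma coef_dom2 K n : gdom (rho (K + n) ^+ (K + n)) (fun k => coef K k * (scl k ^+ 2) ^+ n).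
Proof.
move=> k; have s0 : 0 <= scl k ^+ 2 by rewrite exprn_ge0// ltW// scl_gt0.
rewrite normrM coef_norm normrX (ger0_norm s0) -mulrA -exprD [leRHS]mulrC.
exact: wgt_moment.
Qed.

Lemma coef_dom1 K n : gdom (rho (K + n) ^+ (K + n)) (fun k => coef K k * scl k ^+ n).
Proof.
move=> k; apply: le_trans (coef_dom2 K n k); rewrite !normrM ler_wpM2l//.
have s0 := ltW (scl_gt0 k).
rewrite !ger0_norm ?exprn_ge0// lerXn2r// ?nnegrE ?exprn_ge0//.
by rewrite expr2 ler_peMl// scl_ge1.
Qed.

(** Here [K] is the index of the remainder and [n] the order of differentiation. In [gser] below,
    the same remainder is composed with t -> t^2 before differentiating. *)
Definition fser K n (x : R) := sfam geom_ker (fun k => scl k ^+ 2) (coef K) n x.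

Definition gser K n (t : R) := sfam cauchy_ker scl (coef K) n t.

Lemma coef_dom K : gdom (rho K ^+ K) (coef K).
Proof.
have := coef_dom2 K 0; rewrite addn0.
by under [X in gdom _ X]eq_fun do rewrite expr0 mulr1.
Qed.

Let nonneg_conv (x y z : R) : 0 <= x -> 0 <= y -> x <= z <= y -> 0 <= z.
Proof. by move=> x0 _ /andP[/(le_trans x0)]. Qed.

Let scl_nonneg k (x : R) : 0 <= x -> 0 <= scl k ^+ 2 * x.
Proof. by move=> x0; rewrite mulr_ge0// exprn_ge0// ltW// scl_gt0. Qed.

Lemma fser_bound K n x : 0 <= x -> `|fser K n x| <= n`!%:R * rho (K + n) ^+ (K + n).
Proof.
exact: (@sfam_bound _ geom_ker [set x | 0 <= x] (fun n => n`!%:R) (@geom_ker_le R) _ _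
  [set x | 0 <= x] _ scl_nonneg (coef_dom2 K)).
Qed.

Lemma fser_remainder K n x y : 0 <= x -> 0 <= y ->
  `|fser K n y - fser K n x - fser K n.+1 x * (y - x)| <=
  (n.+2)`!%:R * rho (K + n.+2) ^+ (K + n.+2) * (y - x) ^+ 2.
Proof.
exact: (@sfam_remainder _ geom_ker [set x | 0 <= x] (fun n => n`!%:R) nonneg_conv
  (@geom_ker_derive R) (@geom_ker_le R) _ _ [set x | 0 <= x] _ scl_nonneg (coef_dom2 K)).
Qed.

Lemma gser_bound K n t : `|gser K n t| <= 2 ^+ n * n`!%:R * rho (K + n) ^+ (K + n).
Proof.
exact: (@sfam_bound _ cauchy_ker setT (fun n => 2 ^+ n * n`!%:R) (fun n x _ => @cauchy_ker_le R n x) _ _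
  setT _ (fun k x _ => I) (coef_dom1 K)).
Qed.

Lemma gser_derive K n (t : R) : is_derive t 1 (gser K n) (gser K n.+1 t).
Proof.
apply: is_derive_remainder => y.
exact: (@sfam_remainder _ cauchy_ker setT (fun n => 2 ^+ n * n`!%:R) (fun x y z _ _ _ => I)
  (fun n x _ => @cauchy_ker_derive R n x) (fun n x _ => @cauchy_ker_le R n x) _ _ setT _
  (fun k x _ => I) (coef_dom1 K)).
Qed.

Lemma gser_sqr K t : gser K 0 t = fser K 0 (t ^+ 2).
Proof.
rewrite /gser /fser /sfam; congr gsum; apply/funext => k.
rewrite !expr0 /cauchy_ker /geom_ker /= expr0 mulr1 mul1r expr1.
by rewrite fact0 mul1r exprMn.
Qed.

(** The identity 1/(1 + a x) = 1 - a x / (1 + a x), summed over the poles. It is what makes the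
    lifts of the graph to successive charts compatible. *)
Lemma fser_step K x : 0 <= x -> fser K 0 x = fser K 0 0 + x * fser K.+1 0 x.
Proof.
move=> x0.
have d (J : nat) (y : R) : 0 <= y -> gdom (0`!%:R * rho (J + 0) ^+ (J + 0)) (fun k => coef J k * (scl k ^+ 2) ^+ 0 * geom_ker 0 (scl k ^+ 2 * y)).
  exact: (@sfam_dom _ geom_ker [set x | 0 <= x] (fun n => n`!%:R) (@geom_ker_le R) _ _
    [set x | 0 <= x] _ scl_nonneg (coef_dom2 J)).
rewrite /fser /sfam -(gsumZ x (d K.+1 x x0)) -(gsumD (d K 0 (lexx _)) (gdomZ x (d K.+1 x x0))).
congr gsum; apply/funext => k.
have nz : 1 + scl k ^+ 2 * x != 0 by rewrite gt_eqF// ltr_wpDr// scl_nonneg.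
rewrite /geom_ker /coef; move: (scl k ^+ 2) nz => a nz.
rewrite !expr0 !expr1 [(- a) ^+ K.+1]exprS fact0 mulr0 addr0 invr1 !mulr1 !mul1r.
by field.
Qed.

Definition mom K := (-1) ^+ K * fser K 0 0.

(** Up to sign, the Taylor coefficients of f are moments with positive weights. Since [k] is free, a
    single term shows that they outgrow every geometric sequence. *)
Lemma mom_ge K k : wgt k * (scl k ^+ 2) ^+ K <= mom K.
Proof.
have d : gdom (rho K ^+ K) (fun k => wgt k * (scl k ^+ 2) ^+ K).
  move=> j; have := coef_dom K j; rewrite coef_norm ger0_norm//.
  by rewrite mulr_ge0 ?(ltW (wgt_gt0 j))// exprn_ge0// exprn_ge0// ltW// scl_gt0.
have E : mom K = gsum (fun k => wgt k * (scl k ^+ 2) ^+ K).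
  rewrite /mom /fser /sfam.
  rewrite (_ : (fun k => _) = coef K); last first.
    apply/funext => j; rewrite /geom_ker expr0 mulr1 mulr0 addr0 invr1 expr1 mulr1.
    by rewrite expr0 fact0 !mulr1.
  rewrite -(gsumZ _ (coef_dom K)); congr gsum; apply/funext => j.
  by rewrite /coef mulrCA -exprMn mulN1r opprK.
rewrite E; apply: gsum_ge d _ => j.
by rewrite mulr_ge0 ?(ltW (wgt_gt0 j))// exprn_ge0// exprn_ge0// ltW// scl_gt0.
Qed.

Lemma mom_gt0 K : 0 < mom K.
Proof.
apply: lt_le_trans (mom_ge K 0).
by rewrite mulr_gt0 ?wgt_gt0// exprn_gt0// exprn_gt0// scl_gt0.
Qed.

Lemma gauge_shiftn K : exists C S, [/\ 0 < C, 0 < S &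
  forall n, rho (K + n) ^+ (K + n) * (K + n)`!%:R <= C * (S * rho n) ^+ n * n`!%:R].
Proof.
elim: K => [|K [C [S [C0 S0 h]]]].
  by exists 1, 1; split=> // n; rewrite add0n !mul1r.
have [L [T [L0 T0 h']]] := gauge_shift hrho C0 S0.
exists L, T; split=> // n; rewrite addSnnS; exact: le_trans (h n.+1) (h' n).
Qed.

Lemma DC_gser (X : set R) K : open X -> DC rho unit_dir X (gser K 0).
Proof.
move=> oX; have [C [S [C0 S0 h]]] := gauge_shiftn K.
pose b n : R := 2 ^+ n * n`!%:R * rho (K + n) ^+ (K + n).
have key n j : CB unit_dir X n (fun k => b (j + k)%N) (gser K j).
  have base i (t : R) : X t -> {for t, continuous (gser K i)} /\ `|gser K i t| <= b (i + 0)%N.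
    move=> _; split; first exact: is_derive1_continuous (gser_derive K i t).
    by rewrite addn0; exact: gser_bound.
  elim: n j => [|n IH] j; first by split=> //; exact: base.
  apply: (CB_intro (F' := fun _ => gser K j.+1)) => //; first exact: base.
    by move=> i t _; exact: gser_derive.
  move=> _; rewrite (_ : (fun k => _) = fun k => b (j.+1 + k)%N); first exact: IH.
  by apply/funext => k; rewrite addSnnS.
exists C, (2 * S); split; rewrite ?mulr_gt0// => n.
apply: CB_ler (key n 0%N) => k _; rewrite add0n /b /wt.
rewrite -[2 * S * _]mulrA exprMn.
rewrite [leRHS](_ : _ = 2 ^+ k * (C * (S * rho k) ^+ k * k`!%:R)); last by ring.
rewrite -mulrA ler_wpM2l ?exprn_ge0// mulrC.
apply: le_trans (h k); rewrite ler_wpM2l ?exprn_ge0 ?(gauge_ge0 hrho)//.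
by rewrite ler_nat leq_fact// leq_addl.
Qed.

Variable M : nat -> R.
Hypothesis hM : forall n, rho n ^+ n <= M n.

(** The limit defining [derive_in] is determined only along a proper filter; nearby points are found
    to the right of x in the left half of the interval and to the left otherwise. *)
Lemma within01_proper (x : R) : 0 <= x <= 1 -> ProperFilter (within [set` `[(0:R), 1]] x^').
Proof.
move=> /andP[x0 x1]; apply: Build_ProperFilter_ex.
move=> P /=; rewrite /within /= => h.
have : \forall y \near x, y != x -> y \in `[(0:R), 1] -> P y by exact: h.
move=> /nbhs_ballP[e /= e0 he].
pose s := Num.min e 1 / 2.
have m0 : 0 < Num.min e 1 by rewrite lt_min e0 ltr01.
have me : Num.min e 1 <= e by rewrite ge_min lexx.
have m1 : Num.min e 1 <= 1 by rewrite ge_min lexx orbT.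
have s0 : 0 < s by rewrite /s; lra.
have se : s < e by rewrite /s; lra.
have s2 : s <= 2^-1 by rewrite /s; lra.
case: (leP x 2^-1) => xh.
  exists (x + s); apply: he.
  - by rewrite /ball /= opprD addrA subrr add0r normrN gtr0_norm.
  - by rewrite -subr_eq0 addrAC subrr add0r gt_eqF.
  - by rewrite in_itv /=; apply/andP; split; lra.
exists (x - s); apply: he.
- by rewrite /ball /= opprB addrC subrK gtr0_norm.
- by rewrite -subr_eq0 addrAC subrr add0r oppr_eq0 gt_eqF.
- by rewrite in_itv /=; apply/andP; split; lra.
Qed.

Lemma shift_bound a (F C : R) n : 1 <= C -> `|F| <= C * rho n ^+ n ->
  `|F - (if n is 0%N then a else 0)| <= (1 + `|a|) * (C * M n).
Proof.
move=> C1 hF; have C0 : 0 <= C by exact: le_trans C1.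
have FM : `|F| <= C * M n by apply: (le_trans hF); rewrite ler_wpM2l.
have M0 : 0 <= C * M n by exact: le_trans FM.
rewrite mulrDl mul1r (le_trans (ler_normB _ _))// lerD//.
case: n {hF FM} M0 => [|n] M0; last by rewrite normr0 mulr_ge0.
rewrite ler_peMr// mulr_ege1//.
by have := hM 0; rewrite expr0.
Qed.

Lemma fser_QI a : QI M `[0, 1] (fun x => fser 0 0 x - a).
Proof.
have cvgF n x b (G : R -> R) : x \in `[(0:R), 1] -> (forall y, y \in `[(0:R), 1] -> G y = fser 0 n y - b) ->
    diffquot G x @ within [set` `[(0:R), 1]] x^' --> fser 0 n.+1 x.
  move=> xI GE; move: (xI); rewrite in_itv /= => x01.
  have PF := within01_proper x01.
  have x0 : 0 <= x by have /andP[] := x01.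
  have H : diffquot (fser 0 n) x @ within [set` `[(0:R), 1]] x^' --> fser 0 n.+1 x.
    apply: (derive_in_remainder PF) => y; rewrite in_itv /= => /andP[y0 _].
    exact: (fser_remainder 0 n x0 y0).
  apply: cvg_trans H.
  apply: near_eq_cvg; near=> y.
  have yI : y \in `[(0:R), 1] by near: y; exact: withinT.
  by rewrite /diffquot !GE//; congr (_ / _); ring.
pose b n : R := if n is 0%N then a else 0.
have DE n x : x \in `[(0:R), 1] ->
    iter n (derive_in [set` `[(0:R), 1]]) (fun x => fser 0 0 x - a) x = fser 0 n x - b n.
  elim: n x => [//|n IH] x xI; rewrite iterS /derive_in.
  have x01 : 0 <= x <= 1 by move: xI; rewrite in_itv.
  have PF := within01_proper x01.
  by rewrite subr0; exact: (cvg_lim (@Rhausdorff R) (cvgF n x _ _ xI IH)).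
split=> [n x xI|].
  by apply/cvg_ex; eexists; exact: (cvgF n x _ _ xI (DE n)).
exists (1 + `|a|), 1; split; [by rewrite ltr_pwDl|by []|].
move=> n x xI; rewrite DE//.
have x0 : 0 <= x by move: xI; rewrite in_itv => /andP[].
rewrite expr1n mulr1 -mulrA; apply: shift_bound; first by rewrite ler1n fact_gt0.
by have := fser_bound 0 n x0; rewrite add0n.
Unshelve. all: by end_near. Qed.

Lemma is_derive_rV1 (g : R -> R) (q : 'rV[R]_1) i (d : R) : is_derive (q 0 0) 1 g d ->
  is_derive q (delta_mx 0 i) (fun x : 'rV[R]_1 => g (x 0 0)) d.
Proof.
have E : (fun h : R => h^-1 *: (g ((h *: delta_mx 0 i + q) 0 0) - g (q 0 0))) =
         (fun h : R => h^-1 *: (g (h *: 1 + q 0 0) - g (q 0 0))).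
  apply/funext => h; rewrite !mxE (ord1 i) eqxx /= [h *: 1]mulr1.
  by rewrite mulr1.
move=> [h1 h2]; apply: DeriveDef; first by rewrite /derivable E.
by rewrite /derive E.
Qed.

Lemma gser_QM a : QM M setT (fun x : 'rV[R]_1 => gser 0 0 (x 0 0) - a).
Proof.
have PE (s : seq 'I_1) : partials s (fun x : 'rV[R]_1 => gser 0 0 (x 0 0) - a) =
    fun x : 'rV[R]_1 => gser 0 (size s) (x 0 0) - (if size s is 0%N then a else 0).
  elim: s => [//|i s IH] /=; rewrite IH; apply/funext => q; rewrite subr0.
  have D := is_deriveB (gser_derive 0 (size s) (q 0 0)) (is_derive_cst (if size s is 0%N then a else 0) (q 0 0) 1).
  rewrite subr0 in D; have [_ E] := is_derive_rV1 i D; exact: E.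
split=> [s q _|q _].
  rewrite PE; split.
    have c1 : {for q, continuous (fun x : 'rV[R]_1 => x 0 0)} by exact: coord_continuous.
    have c2 : {for q, continuous (fun x : 'rV[R]_1 => gser 0 (size s) (x 0 0))}.
      exact: (cvg_comp _ _ c1 (is_derive1_continuous (gser_derive 0 (size s) (q 0 0)))).
    move: (if size s is 0%N then a else 0) => b.
    have c3 : {for q, continuous (fun _ : 'rV[R]_1 => b)} by apply: cst_continuous.
    exact: (cvgB c2 c3).
  move=> i.
  have D := is_deriveB (gser_derive 0 (size s) (q 0 0)) (is_derive_cst (if size s is 0%N then a else 0) (q 0 0) 1).
  have [E _] := is_derive_rV1 i D; exact: E.
exists setT, (1 + `|a|), 2; split; [exact: filterT|by []|by rewrite ltr_pwDl|by []|].
move=> al x _; rewrite mpartialE PE size_word_of -2!mulrA [2 ^+ _ * _]mulrA.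
apply: shift_bound.
  by rewrite mulr_ege1// ?exprn_ege1 ?ler1n ?fact_gt0.
by have := gser_bound 0 (mdeg al) (x 0 0); rewrite add0n.
Qed.

Definition grestr a (x : 'rV[R]_1) : R :=
  if pselect (cube x) is left _ then gser 0 0 (x 0 0) - a else 0.

Lemma grestr_QM a : restricted_QM M (grestr a).
Proof.
exists setT, (fun x : 'rV[R]_1 => gser 0 0 (x 0 0) - a); split=> //.
- exact: openT.
- exact: gser_QM.
- by move=> x hx; rewrite /grestr; case: pselect.
- by move=> x hx; rewrite /grestr; case: pselect.
Qed.

End SparsePoles.

(** * No extension of f or its remainders to the left of 0 *)

Section NoExtension.
Context {R : realType}.
Variable rho : nat -> R.
Hypothesis hrho : gauge rho.

Local Notation f K x := (fser hrho K 0 x).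
Local Notation c K := (fser hrho K 0 0).
Local Notation m K := (mom hrho K).

Lemma fser_expand L n (x : R) : 0 <= x ->
  f L x = \sum_(j < n) c (L + j)%N * x ^+ j + x ^+ n * f (L + n)%N x.
Proof.
move=> x0; elim: n => [|n IH]; first by rewrite big_ord0 add0r expr0 mul1r addn0.
rewrite IH (fser_step hrho (L + n) x0) big_ord_recr /= addnS exprSr.
by ring.
Qed.

Lemma fser_bound0 K (x : R) : 0 <= x -> `|f K x| <= rho K ^+ K.
Proof. by move=> x0; have := fser_bound hrho K 0 x0; rewrite fact0 mul1r addn0. Qed.

Lemma fserE0 K : c K = (-1) ^+ K * m K.
Proof. by rewrite /mom mulrA -exprMn mulN1r opprK expr1n mul1r. Qed.

(* On the left of 0 such an extension would have, up to sign, a Taylor series with positive coefficients, hence be absolutely monotone by Bang's theorem; but the moments grow too fast for a convergent series. *)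
Lemma no_extension (phi : R -> R) (e : R) L : 0 < e -> DC rho unit_dir (ball (0 : R) e) phi ->
  ~ (forall x, 0 < x < e -> phi x = x * f L x).
Proof.
move=> e0 hphi ext.
have [C [S [C0 S0 gM dg]]] := line_dersP tt hphi.
have inb (x : R) : `|x| < e -> ball (0 : R) e x by rewrite -ball_normE /ball_ /= sub0r normrN.
pose d n := line_ders (unit_dir tt) n phi.
have dd n (x : R) : `|x| < e -> is_derive x 1 (d n) (d n.+1 x) by move/inb/(dg n x).
have dM n (x : R) : `|x| < e -> `|d n x| <= wt rho C S n by move/inb/(gM n x).
(* The coefficients are shifted by one because the function is x times a remainder, the form in
   which the lifted graph appears in a chart. *)
pose a n := if n is j.+1 then c (L + j)%N else 0.
have d0 n : d n 0 = n`!%:R * a n.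
  apply: (taylor_coef_unique e0 (M := wt rho C S)) => [k x /andP[x0 xe]|k x /andP[x0 xe]|N].
  - by apply: dd; rewrite ger0_norm.
  - by apply: dM; rewrite ger0_norm.
  - case: N => [|N].
      exists (e * rho L ^+ L) => x /andP[x0 xe]; rewrite big_ord0 subr0 expr0 mulr1.
      rewrite [d 0%N x]ext ?x0// normrM (gtr0_norm x0).
      by apply: ler_pM; rewrite ?(ltW x0) ?(ltW xe) ?fser_bound0// ltW.
    exists (rho (L + N) ^+ (L + N)) => x /andP[x0 xe].
    rewrite [d 0%N x]ext ?x0// (fser_expand L N (ltW x0)) big_ord_recl /= mul0r add0r.
    rewrite mulrDr mulr_sumr.
    have -> : \sum_(i < N) c (L + (0 + i))%N * x ^+ bump 0 i = \sum_(j < N) x * (c (L + j)%N * x ^+ j).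
      by apply: eq_bigr => j _; transitivity (c (L + j)%N * (x * x ^+ j)); [rewrite -exprS|rewrite mulrCA].
    rewrite addrAC subrr add0r mulrA -exprS normrM mulrC normrX (gtr0_norm x0).
    rewrite ler_wpM2r ?exprn_ge0 ?(ltW x0)//.
    exact: fser_bound0 (ltW x0).
(* The sign (-1)^n comes from the reflection. The coefficient of order j + 1 has sign (-1)^(L+j), so
   the global sign (-1)^(L+1) makes all of them nonnegative. *)
pose g n (s : R) := (-1) ^+ L.+1 * (-1) ^+ n * d n (- s).
have gd n (x : R) : 0 <= x < e -> is_derive x 1 (g n) (g n.+1 x).
  move=> /andP[x0 xe]; have nx : `|- x| < e by rewrite normrN ger0_norm.
  have D2 := @is_derive1_comp R (d n) (fun s : R => - s) x _ _ (dd n _ nx) (is_deriveNid x 1).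
  apply: (is_derive_eq (is_deriveZ ((-1) ^+ L.+1 * (-1) ^+ n) D2)).
  by rewrite -[_ *: _]/(_ * _) /g [(-1) ^+ n.+1]exprS; ring.
have gM' n (x : R) : 0 <= x < e -> `|g n x| <= wt rho C S n.
  move=> /andP[x0 xe]; rewrite /g !normrM !normrX !normrN1 !expr1n !mul1r.
  by apply: dM; rewrite normrN ger0_norm.
have g0 j : g j.+1 0 = (j.+1)`!%:R * m (L + j)%N.
  rewrite /g oppr0 d0 /= fserE0.
  rewrite [LHS](_ : _ = ((-1) ^+ L.+1 * (-1) ^+ j.+1 * (-1) ^+ (L + j)) * ((j.+1)`!%:R * m (L + j)%N)); last by ring.
  rewrite [(-1) ^+ L.+1]exprS [(-1) ^+ j.+1]exprS exprD.
  rewrite [X in X * _](_ : _ = ((-1) * (-1)) ^+ L * ((-1) * (-1)) ^+ j); last by rewrite !exprMn; ring.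
  by rewrite mulN1r opprK !expr1n !mul1r.
have g00 j : 0 <= g j 0.
  case: j => [|j]; first by rewrite /g oppr0 d0 /= !mulr0.
  by rewrite g0 mulr_ge0// ltW// mom_gt0.
have gpos := DC_bang hrho C0 S0 gd gM' g00.
have [s s0 se] : exists2 s : R, 0 < s & s < e by exists (e / 2); lra.
have dom x : 0 <= x <= s -> 0 <= x < e by move=> /andP[-> h]; exact: le_lt_trans h se.
have bound j : m (L + j)%N * s ^+ j.+1 <= g 0%N s.
  have := @taylor_ge R j.+2 g 0 s 0 (ltW s0); rewrite add0r mul0r subr0 oppr0 => H.
  have {}H := H (fun n x _ hx => gd n x (dom x hx)) (fun x hx => gpos j.+2 x (dom x hx)).
  apply: le_trans H; rewrite big_ord_recr /= g0.
  have -> : m (L + j)%N * s ^+ j.+1 = (j.+1)`!%:R * m (L + j)%N * (s ^+ j.+1 / (j.+1)`!%:R).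
    by field; rewrite pnatr_eq0 -lt0n fact_gt0.
  rewrite lerDr; apply: sumr_ge0 => i _.
  by rewrite mulr_ge0// mulr_ge0 ?invr_ge0// exprn_ge0// ltW.
(* A pole this close to 0 contributes at least a fixed multiple of 2^j to the j-th Taylor term at
   [s], while each such term is at most [g 0 s]. *)
have [k hk] : exists k, 2 <= scl k ^+ 2 * s :> R.
  exists (Num.truncn (2 / s)).
  have h1 := truncnS_gt (2 / s); move: h1; rewrite -/(scl _) => h1.
  have h2 : (2 / s) <= scl (Num.truncn (2 / s)) ^+ 2.
    rewrite expr2; apply: (le_trans (ltW h1)); apply: ler_peMl; last exact: scl_ge1.
    exact: ltW (scl_gt0 _).
  by rewrite -ler_pdivrMr.
have w0 := wgt_gt0 hrho k.
have s2 : 1 <= scl k ^+ 2 :> R by rewrite exprn_ege1// scl_ge1.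
have b2 j : wgt hrho k * s * 2 ^+ j <= g 0%N s.
  apply: le_trans (bound j).
  apply: (@le_trans _ _ (wgt hrho k * (scl k ^+ 2) ^+ j * s ^+ j.+1)).
    rewrite [s ^+ j.+1]exprS [leRHS](_ : _ = wgt hrho k * s * ((scl k ^+ 2) * s) ^+ j); last first.
      by move: (scl k ^+ 2) => y; rewrite exprMn; ring.
    apply: ler_wpM2l; first by rewrite mulr_ge0 ?(ltW w0) ?(ltW s0).
    by apply: lerXn2r => //; rewrite nnegrE// (le_trans _ hk).
  rewrite ler_wpM2r ?exprn_ge0 ?(ltW s0)//; apply: le_trans (mom_ge hrho (L + j) k).
  by rewrite ler_wpM2l ?(ltW w0)// ler_weXn2l// leq_addl.
have ws0 : 0 < wgt hrho k * s by rewrite mulr_gt0.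
have h1 := truncnS_gt (g 0%N s / (wgt hrho k * s)).
set n := Num.truncn _ in h1.
have := b2 n; apply/negP; rewrite -ltNge.
move: h1; rewrite ltr_pdivrMr// => /lt_le_trans; apply.
by rewrite mulrC ler_wpM2l ?(ltW ws0)// succ_le2X.
Qed.

End NoExtension.

(** * Charts along a Taylor series *)

Section BlowUp.
Context {R : realType}.
Variable rho : nat -> R.
Hypothesis hrho : gauge rho.

Local Notation f K x := (fser hrho K 0 x).
Local Notation c K := (fser hrho K 0 0).
Local Notation g K t := (gser hrho K 0 t).
Local Notation B r := (ball (0 : 'rV[R]_2) r).
Local Notation DC2 r := (DC rho (@coord_dir R 2) (ball (0 : 'rV[R]_2) r)).
Local Notation DC1 r := (DC rho (@unit_dir R) (ball (0 : R) r)).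

Lemma oB (r : R) : open (B r). Proof. exact: ball_open. Qed.

Lemma pt00 : pt 0 0 = 0 :> 'rV[R]_2.
Proof. by apply/rowP => j; rewrite !mxE; case: ifP. Qed.

Lemma ball_R (x r : R) : ball (0 : R) r x <-> `|x| < r.
Proof. by rewrite -ball_normE /ball_ /= sub0r normrN. Qed.

(* The second coordinate of the K-fold blow-up of the plane along the Taylor
   series of f at 0. *)
Definition chart K (q : 'rV[R]_2) : R :=
  \sum_(0 <= j < K.+1) c j * q 0 0 ^+ j + q 0 0 ^+ K * q 0 1.

(** The transition from chart K + 1 to chart K. The shift by the Taylor coefficient places at the
    origin the point where the lifted graph meets the exceptional line. *)
Definition blow K (q : 'rV[R]_2) : 'rV[R]_2 := pt (q 0 0) (q 0 0 * (c K.+1 + q 0 1)).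

(* The lift to the K-th chart of the branch t |-> (t^2, f (t^2)) of the graph. *)
Definition lift_curve K (t : R) : 'rV[R]_2 := pt (t ^+ 2) (t ^+ 2 * g K.+1 t).

Fixpoint blows K n (q : 'rV[R]_2) : 'rV[R]_2 :=
  if n is n'.+1 then blows K n' (blow (K + n') q) else q.

Lemma chart_blow K q : chart K (blow K q) = chart K.+1 q.
Proof.
by rewrite /chart /blow pt0 pt1 [in RHS]big_nat_recr//= [q 0 0 ^+ K.+1]exprSr; ring.
Qed.

Lemma chart_blows K n q : chart K (blows K n q) = chart (K + n) q.
Proof. by elim: n q => [|n IH] q; rewrite ?addn0//= IH chart_blow addnS. Qed.

Lemma blows0 K n q : blows K n q 0 0 = q 0 0.
Proof. by elim: n q => [//|n IH] q /=; rewrite IH pt0. Qed.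

Lemma blow_curve K t : blow K (lift_curve K.+1 t) = lift_curve K t.
Proof.
rewrite /blow /lift_curve pt0 pt1 [g K.+1 t]gser_sqr (fser_step hrho K.+1 (sqr_ge0 t)).
by rewrite -gser_sqr.
Qed.

Lemma blows_curve K n t : blows K n (lift_curve (K + n) t) = lift_curve K t.
Proof. by elim: n => [|n IH]; rewrite ?addn0//= addnS blow_curve IH. Qed.

Lemma chart_curve K t : chart K (lift_curve K t) = g 0 t.
Proof.
have <- : chart 0 (lift_curve 0 t) = g 0 t.
  rewrite /chart big_nat1 expr0 mulr1 mul1r /lift_curve pt1.
  by rewrite [g 0 t]gser_sqr (fser_step hrho 0 (sqr_ge0 t)) -gser_sqr.
by rewrite -[K]add0n -chart_blows blows_curve.
Qed.

Lemma blow_small K r : 0 < r -> exists r', [/\ 0 < r', r' <= r, r' <= 1 &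
  forall q, B r' q -> B r (blow K q)].
Proof.
move=> r0; pose A := `|c K.+1| + 1.
have A0 : 0 < A by rewrite ltr_wpDl.
pose r' := Num.min (Num.min r 1) (r / A).
have r'0 : 0 < r' by rewrite !lt_min r0 ltr01 divr_gt0.
have r'r : r' <= r by rewrite !ge_min lexx.
have r'1 : r' <= 1 by rewrite !ge_min lexx orbT.
exists r'; split=> // q; rewrite -{1}(ptE q) => /(pt_ball _ _ r'0)[q0 q1].
apply/pt_ball => //; split; first exact: lt_le_trans q0 r'r.
rewrite normrM; apply: (@le_lt_trans _ _ (`|q 0 0| * A)).
  rewrite ler_wpM2l// (le_trans (ler_normD _ _))// lerD2l.
  exact/ltW/(lt_le_trans q1 r'1).
rewrite -ltr_pdivlMr//; apply: (lt_le_trans q0).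
by rewrite ge_min lexx orbT.
Qed.

Lemma DC2_pt r r' (G : 'rV[R]_2 -> R) (u v : 'rV[R]_2 -> R) :
  DC2 r G -> DC2 r' u -> DC2 r' v -> (forall q, B r' q -> B r (pt (u q) (v q))) ->
  DC2 r' (fun q => G (pt (u q) (v q))).
Proof.
move=> hG hu hv hb.
have E q : pt (u q) (v q) = \row_j (if j == 0 then u q else v q) by apply/rowP => j; rewrite !mxE.
have := @DC_comp _ _ hrho _ _ (@coord_dir R 2) (B r') 2 (B r) G
  (fun j q => if j == 0 then u q else v q) (@oB r') (@oB r).
rewrite (_ : (fun q => G _) = (fun q => G (pt (u q) (v q)))); last by apply/funext => q; rewrite E.
apply.
- by move=> q bq; rewrite -E; exact: hb.
- by move=> j; case: (ord2P j) => -> /=.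
- exact: hG.
Qed.

Lemma DC2_coord r j : 0 < r -> r <= 1 -> DC2 r (fun q => q 0 j).
Proof.
by move=> r0 r1; apply: DC_coord => //; [exact: oB|exact: le_ball].
Qed.

Lemma DC2_blow K r r' G : DC2 r G -> 0 < r' -> r' <= 1 ->
  (forall q, B r' q -> B r (blow K q)) -> DC2 r' (fun q => G (blow K q)).
Proof.
move=> hG r'0 r'1 hb; apply: (DC2_pt hG) => //; first exact: DC2_coord.
apply: DC_mul => //; [exact: oB|exact: DC2_coord|].
by apply: DC_add => //; [exact: oB|exact: DC_cst|exact: DC2_coord].
Qed.

Lemma curve_small K r : 0 < r -> exists eta, [/\ 0 < eta, eta <= 1 &
  forall t, `|t| < eta -> B r (lift_curve K t)].
Proof.
move=> r0.
have [Bd Bd0 hBd] := DC_bounded (DC_gser hrho K.+1 (@ball_open _ R (0 : R) 1)).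
pose eta := Num.min 1 (r / (Bd + 1)).
have A0 : 0 < Bd + 1 by rewrite addr_gt0.
have eta0 : 0 < eta by rewrite lt_min ltr01 divr_gt0.
exists eta; split=> //; first by rewrite ge_min lexx.
move=> t te; have t1 : `|t| < 1 by rewrite (lt_le_trans te)// ge_min lexx.
have tr : `|t| * (Bd + 1) < r.
  by rewrite -ltr_pdivlMr// (lt_le_trans te)// ge_min lexx orbT.
have t2 : `|t ^+ 2| <= `|t| by rewrite normrX expr2 ler_piMl// ltW.
apply/pt_ball => //; split.
  apply: (le_lt_trans t2); apply: le_lt_trans tr.
  by rewrite ler_peMr// lerDr ltW.
apply: le_lt_trans tr; rewrite normrM ler_pM// (le_trans (hBd _ _))//; last by rewrite lerDl.
exact/ball_R.
Qed.

Lemma DC_curve K r eta G : DC2 r G -> 0 < eta -> eta <= 1 ->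
  (forall t, `|t| < eta -> B r (lift_curve K t)) ->
  DC1 eta (fun t => G (lift_curve K t)).
Proof.
move=> hG eta0 eta1 hb.
have o1 : open (ball (0 : R) eta) by exact: ball_open.
have hid : DC1 eta (fun t => t).
  by apply: (DC_id hrho o1 (A := 1)) => // x /ball_R h; rewrite ltW// (lt_le_trans h).
have hsq := DC_exp hrho 2 o1 hid.
have E t : lift_curve K t = \row_j (if j == 0 then t ^+ 2 else t ^+ 2 * g K.+1 t).
  by apply/rowP => j; rewrite !mxE.
have := @DC_comp _ _ hrho _ _ (@unit_dir R) (ball (0 : R) eta) 2 (B r) G
  (fun j t => if j == 0 then t ^+ 2 else t ^+ 2 * g K.+1 t) o1 (@oB r).
rewrite (_ : (fun q => G _) = (fun t => G (lift_curve K t))); last by apply/funext => t; rewrite E.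
apply.
- by move=> t /ball_R bt; rewrite -E; exact: hb.
- by move=> j; case: (ord2P j) => -> //=; apply: DC_mul => //; exact: DC_gser.
- exact: hG.
Qed.

Lemma blow_divide K r G : 0 < r -> DC2 r G -> G 0 = 0 -> exists r' G1, [/\ 0 < r', r' <= 1,
  DC2 r' G1, (forall q, B r' q -> B r (blow K q)) &
  forall q, B r' q -> G (blow K q) = q 0 0 * G1 q].
Proof.
move=> r0 hG G0; have [r' [r'0 r'r r'1 hb]] := blow_small K r0.
have [G1 hG1 E] := @DC_divide R r' r'0 rho _ hrho (DC2_blow hG r'0 r'1 hb)
  (fun z _ => ltac:(by rewrite /blow pt0 mul0r pt00)).
by exists r', G1; split.
Qed.

(** A pull-back by n blow-ups, with one factor x divided out at each. The process continues as long
    as the quotient vanishes at the origin. *)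
Definition pulled K n r (G : 'rV[R]_2 -> R) r' (G' : 'rV[R]_2 -> R) :=
  [/\ 0 < r', r' <= 1, DC2 r' G', (forall q, B r' q -> B r (blows K n q)) &
  forall q, B r' q -> G (blows K n q) = q 0 0 ^+ n * G' q].

Lemma pulled_shrink K r G : 0 < r -> DC2 r G -> exists r', pulled K 0 r G r' G.
Proof.
move=> r0 hG; exists (Num.min r 1); split.
- by rewrite lt_min r0 ltr01.
- by rewrite ge_min lexx orbT.
- by apply: DC_subset hG; apply: le_ball; rewrite ge_min lexx.
- by move=> q /=; apply: le_ball; rewrite ge_min lexx.
- by move=> q _; rewrite expr0 mul1r.
Qed.

Lemma pulled_step K n r G r' G' : pulled K n r G r' G' -> G' 0 = 0 ->
  exists r'' G'', pulled K n.+1 r G r'' G''.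
Proof.
move=> [r'0 r'1 hG' hb hE] G'0.
have [r'' [G'' [r''0 r''1 hG'' hb' hE']]] := blow_divide (K + n) r'0 hG' G'0.
exists r'', G''; split=> //.
  by move=> q /hb' /hb.
move=> q bq /=; rewrite hE; last exact: hb'.
by rewrite hE'// pt0 mulrA -exprSr.
Qed.

(** If division by x never stops, [G] along the curve is O(t^n) for every n, because the curve lifts
    to every chart. The parameter t is essential: in it the curve belongs to the class on both sides
    of 0, so that flatness implies vanishing. *)
Lemma unit_or_flat K r eta G : 0 < r -> DC2 r G -> 0 < eta -> eta <= 1 ->
  (forall t, `|t| < eta -> B r (lift_curve K t)) ->
  (exists n r' U, pulled K n r G r' U /\ U 0 != 0) \/
  (forall t, 0 <= t < eta -> G (lift_curve K t) = 0).
Proof.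
move=> r0 hG eta0 eta1 hb.
case: (pselect (exists n r' U, pulled K n r G r' U /\ U 0 != 0)) => [|nU]; [by left|right].
have all n : exists r' G', pulled K n r G r' G'.
  elim: n => [|n [r' [G' hp]]]; first by have [r' h] := pulled_shrink K r0 hG; exists r', G.
  apply: (pulled_step hp); apply/eqP; apply: contra_notT nU => nz.
  by exists n, r', G'.
have hu := DC_curve hG eta0 eta1 hb.
have [B0 B00 hB0] := DC_bounded hu.
apply: (DC_flat_eq0 hrho eta0 hu) => n.
have [r' [G' [r'0 r'1 hG' hb' hE]]] := all n.
have [B1 B10 hB1] := DC_bounded hG'.
have [eta' [eta'0 eta'1 hbc]] := curve_small (K + n) r'0.
(* Below eta' the chart of index K + n gives the bound B1 x^n; beyond it the uniform bound B0 is at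
   most B0 (x / eta')^n. *)
exists (B1 + B0 / eta' ^+ n) => x /andP[x0 xe].
have xn0 : 0 <= x ^+ n by rewrite exprn_ge0// ltW.
have en0 : 0 < eta' ^+ n by rewrite exprn_gt0.
have hB0n : 0 <= B0 / eta' ^+ n by rewrite divr_ge0// ltW.
case: (ltP x eta') => xe'.
  have bq : B r' (lift_curve (K + n) x) by apply: hbc; rewrite gtr0_norm.
  rewrite -(blows_curve K n) hE// normrM normrX.
  apply: (@le_trans _ _ (x ^+ n * B1)).
    apply: ler_pM => //; last exact: hB1.
    rewrite lerXn2r// ?nnegrE ?(ltW x0)// /lift_curve pt0 normrX gtr0_norm//.
    by rewrite expr2 ler_piMl// ?(ltW x0)// ltW// (lt_le_trans xe').
  by rewrite mulrC ler_wpM2r// lerDl.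
apply: (@le_trans _ _ B0); first by apply: hB0; apply/ball_R; rewrite gtr0_norm.
apply: (@le_trans _ _ (B0 / eta' ^+ n * x ^+ n)); last by rewrite ler_wpM2r// lerDr ltW.
rewrite mulrAC ler_pdivlMr// ler_wpM2l ?(ltW B00)// lerXn2r// ?nnegrE ltW//.
Qed.

End BlowUp.

(** * Zero or monomial times unit *)

Section Dichotomy.
Context {R : realType}.
Variable rho : nat -> R.
Hypothesis hrho : gauge rho.

Local Notation e0 := (@coord_dir R 2 0).
Local Notation e1 := (@coord_dir R 2 1).
Local Notation B r := (ball (0 : 'rV[R]_2) r).
Local Notation DC2 r := (DC rho (@coord_dir R 2) (ball (0 : 'rV[R]_2) r)).
Local Notation lift_curve := (lift_curve hrho).
Local Notation blows := (blows hrho).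
Local Notation blow := (blow hrho).
Local Notation pulled := (pulled hrho).

Lemma eq_off_axis r (F G : 'rV[R]_2 -> R) : 0 < r ->
  (forall q, B r q -> {for q, continuous F}) -> (forall q, B r q -> {for q, continuous G}) ->
  (forall q, B r q -> q 0 0 != 0 -> F q = G q) -> forall q, B r q -> F q = G q.
Proof.
move=> r0 cF cG E q bq; have [q00|] := eqVneq (q 0 0) 0; last exact: E.
have cp : {for (0 : R), continuous (fun x : R => pt x (q 0 1))}.
  by apply: continuous_pt; [exact: cvg_id|exact: cvg_cst].
have q0E : pt 0 (q 0 1) = q by rewrite -[in RHS](ptE q) q00.
have bq' : B r (pt 0 (q 0 1)) by rewrite q0E.
have c1 : F (pt x (q 0 1)) @[x --> 0^'] --> F (pt 0 (q 0 1)).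
  by apply: cvg_within_filter; exact: (cvg_comp _ _ cp (cF _ bq')).
have c2 : G (pt x (q 0 1)) @[x --> 0^'] --> G (pt 0 (q 0 1)).
  by apply: cvg_within_filter; exact: (cvg_comp _ _ cp (cG _ bq')).
rewrite -q0E; apply: (cvg_unique _ c1) => //; apply: cvg_trans c2.
apply: near_eq_cvg; near=> x.
have x0 : x != 0 by near: x; exact: nbhs_dnbhs_neq.
apply/esym/E; last by rewrite pt0.
move: bq; rewrite -{1}(ptE q) => /(pt_ball _ _ r0)[_ q1].
apply/pt_ball => //; split=> //; near: x; exact: dnbhs0_lt.
Unshelve. all: by end_near. Qed.

Lemma blow_derive1 K F q : derivable F (blow K q) e1 ->
  'D_e1 (fun q => F (blow K q)) q = q 0 0 * 'D_e1 F (blow K q).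
Proof.
move=> /derivableP/is_derive_e1; rewrite pt0 pt1 => D1.
have D2 : is_derive (q 0 1) 1 (fun t : R => q 0 0 * (fser hrho K.+1 0 0 + t)) (q 0 0).
  have Ds : is_derive (q 0 1) 1 (fun t : R => fser hrho K.+1 0 0 + t) 1.
    have := is_deriveD (is_derive_cst (fser hrho K.+1 0 0) (q 0 1) 1) (is_derive_id (q 0 1) (1 : R)).
    by rewrite add0r.
  by have := is_deriveZ (q 0 0) Ds; rewrite [_ *: 1]mulr1.
have D3 := @is_derive1_comp R (fun t => F (pt (q 0 0) t)) (fun t : R => q 0 0 * (fser hrho K.+1 0 0 + t)) (q 0 1) _ _ D1 D2.
have : is_derive q e1 (fun q => F (blow K q)) ('D_e1 F (blow K q) * q 0 0).
  apply/is_derive_e1; rewrite (_ : (fun t => _) = (fun t => F (pt (q 0 0) t)) \o (fun t : R => q 0 0 * (fser hrho K.+1 0 0 + t)))//.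
  by apply/funext => t; rewrite /blow /= pt0 pt1.
by move=> [_ ->]; rewrite mulrC.
Qed.

(** Each blow-up scales z by x, so the z-derivative of the pull-back is x^n times the pull-back of
    the z-derivative. *)
Lemma DC2_blows K n r F r' (G' : 'rV[R]_2 -> R) (G : 'rV[R]_2 -> R) :
  pulled K n r G r' G' -> 0 < r -> DC2 r F ->
  exists r'', [/\ 0 < r'', r'' <= r', DC2 r'' (fun q => F (blows K n q)) &
    forall q, B r'' q -> 'D_e1 (fun q => F (blows K n q)) q = q 0 0 ^+ n * 'D_e1 F (blows K n q)].
Proof.
move=> [r'0 r'1 _ hb _] r0 hF.
suff [s [s0 hs hD]] : exists s, [/\ 0 < s, DC2 s (fun q => F (blows K n q)) &
   forall q, B s q -> 'D_e1 (fun q => F (blows K n q)) q = q 0 0 ^+ n * 'D_e1 F (blows K n q)].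
  exists (Num.min s r'); split.
  - by rewrite lt_min s0.
  - by rewrite ge_min lexx orbT.
  - by apply: DC_subset hs; apply: le_ball; rewrite ge_min lexx.
  - by move=> q bq; apply: hD; apply: le_ball bq; rewrite ge_min lexx.
elim: n {hb} => [|n [s [s0 hs hD]]].
  by exists r; split=> // q _; rewrite expr0 mul1r.
have [s' [s'0 _ s'1 hb']] := blow_small hrho (K + n) s0.
exists s'; split=> //.
  exact: (DC2_blow hs s'0 s'1 hb').
move=> q bq; rewrite (@blow_derive1 (K + n) (fun q => F (blows K n q))).
  by rewrite hD ?pt0 ?mulrA ?exprS//; exact: hb'.
apply: DC_derivable hs _; exact: hb'.
Qed.

(** While m > 0, the z-derivative vanishes on the axis x = 0. There [Phi] is constant, equal to its
    value at the origin, which is 0 because the curve ends there; hence x divides [Phi]. The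
    quotient has m lowered by one and still vanishes on the curve, where x = t^2 is nonzero. *)
Lemma divide_power L m r (Phi U : 'rV[R]_2 -> R) eta : 0 < r -> DC2 r Phi -> DC2 r U -> 0 < eta ->
  (forall q, B r q -> 'D_e1 Phi q = q 0 0 ^+ m * U q) ->
  (forall t, 0 < t < eta -> Phi (lift_curve L t) = 0) ->
  exists H, [/\ DC2 r H, (forall q, B r q -> 'D_e1 H q = U q), H 0 = 0 &
    exists2 eta', 0 < eta' & forall t, 0 < t < eta' -> H (lift_curve L t) = 0].
Proof.
move=> r0 hPhi hU eta0.
have [zeta [zeta0 zeta1 hb]] := curve_small hrho L r0.
have root0 (F : 'rV[R]_2 -> R) eps : DC2 r F -> 0 < eps ->
    (forall t, 0 < t < eps -> F (lift_curve L t) = 0) -> F 0 = 0.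
  move=> hF eps0 F0.
  have hu := DC_curve hF zeta0 zeta1 hb.
  have cu := DC_continuous hu (ballxx (0 : R) zeta0).
  have E0 : F (lift_curve L 0) = F 0 by congr F; apply/rowP => j; rewrite !mxE expr0n /= mul0r; case: ifP.
  have c1 : F (lift_curve L t) @[t --> 0^'+] --> F 0.
    by rewrite -E0; exact: cvg_at_right_filter.
  have c2 : F (lift_curve L t) @[t --> 0^'+] --> (0 : R).
    apply: cvg_near_cst; near=> t; apply: F0; apply/andP; split; near: t.
      exact: nbhs_right_gt.
    exact: nbhs_right_lt.
  exact: (cvg_unique _ c1 c2).
elim: m Phi eta hPhi eta0 => [|m IH] Phi eta hPhi eta0 hD hz.
  exists Phi; split=> //.
  - by move=> q bq; rewrite hD// expr0 mul1r.
  - exact: root0 hz.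
  - by exists eta.
have Phi0 := root0 _ _ hPhi eta0 hz.
have Phi00 z : `|z| < r -> Phi (pt 0 z) = 0.
  move=> zr; have [|c _ E] := @MVT_dist R (fun t => Phi (pt 0 t)) (fun=> 0) 0 z.
    move=> t; rewrite !subr0 => tz.
    have bt : B r (pt 0 t) by apply/pt_ball => //; rewrite normr0; split=> //; exact: le_lt_trans tz zr.
    have /derivableP := DC_derivable (i := 1) hPhi bt.
    rewrite hD// pt0 exprS !mul0r => /is_derive_e1; by rewrite pt0 pt1.
  by move: E; rewrite mul0r pt00 Phi0 subr0.
have [Phi1 hPhi1 E1] := DC_divide r0 hrho hPhi Phi00.
apply: (IH Phi1 (Num.min eta zeta)) => //; first by rewrite lt_min eta0.
  apply: (eq_off_axis r0).
  - by move=> q bq; exact: DC_continuous (DC_derive hrho 1 hPhi1) bq.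
  - move=> q bq; have cU := DC_continuous hU bq.
    have cX : {for q, continuous (fun q : 'rV[R]_2 => q 0 0 ^+ m)}.
      have c0 : {for q, continuous (fun q : 'rV[R]_2 => q 0 0)} by exact: coord_continuous.
      exact: (cvg_comp _ _ c0 (@exprn_continuous R m (q 0 0))).
    exact: (cvgM cX cU).
  - move=> q bq q0; apply: (mulfI q0); rewrite mulrA -exprS -hD//.
    have D1 : is_derive q e1 (fun q => q 0 0 * Phi1 q) (q 0 0 * 'D_e1 Phi1 q).
      apply/is_derive_e1.
      have /derivableP/is_derive_e1 D := DC_derivable (i := 1) hPhi1 bq.
      have := is_deriveZ (q 0 0) D.
      by apply: near_eq_is_derive; near=> t; rewrite pt0.
    have D2 : is_derive q e1 Phi (q 0 0 * 'D_e1 Phi1 q).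
      apply: near_eq_is_derive D1; apply: (near_open_eq (@oB R r)) bq => y by'.
      by rewrite E1.
    by have [_ ->] := D2.
move=> t /andP[t0]; rewrite lt_min => /andP[te tz].
have bt : B r (lift_curve L t) by apply: hb; rewrite gtr0_norm.
have := hz t; rewrite t0 te => /(_ isT); rewrite E1// pt0 => /eqP.
by rewrite mulf_eq0 expf_eq0 /= (gt_eqF t0) /= => /eqP.
Unshelve. all: by end_near. Qed.

(** An implicit function is defined on both sides of x = 0 and would coincide for x > 0 with the
    second coordinate of the lifted curve, x times a Taylor remainder. *)
Lemma no_implicit_root L r (H : 'rV[R]_2 -> R) eta : 0 < r -> DC2 r H -> H 0 = 0 -> 'D_e1 H 0 != 0 ->
  0 < eta -> ~ (forall t, 0 < t < eta -> H (lift_curve L t) = 0).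
Proof.
move=> r0 hH H0 D0 eta0 hz.
have [s [e [phi [s0 e0 hphi uniq]]]] := implicit_function hrho r0 hH H0 D0.
have [zeta [zeta0 zeta1 hb]] := curve_small hrho L s0.
pose d := Num.min eta zeta.
have d0 : 0 < d by rewrite lt_min eta0.
pose e' := Num.min e (d ^+ 2).
have e'0 : 0 < e' by rewrite lt_min e0 exprn_gt0.
apply: (@no_extension R rho hrho phi e' L.+1 e'0).
  by apply: DC_subset hphi; apply: le_ball; rewrite ge_min lexx.
move=> x /andP[x0]; rewrite lt_min => /andP[xe xd].
pose t := Num.sqrt x.
have t0 : 0 < t by rewrite sqrtr_gt0.
have tt : t ^+ 2 = x by rewrite sqr_sqrtr// ltW.
have td : t < d by rewrite -(ltr_pXn2r (n := 2)) ?nnegrE ?ltW// tt.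
have te : t < eta by rewrite (lt_le_trans td)// ge_min lexx.
have tz : t < zeta by rewrite (lt_le_trans td)// ge_min lexx orbT.
have bt : B s (lift_curve L t) by apply: hb; rewrite gtr0_norm.
have [_ zs] := (pt_ball _ _ s0).1 bt.
have := hz t; rewrite t0 te => /(_ isT) h.
rewrite -tt -gser_sqr; apply/esym/uniq => //.
by rewrite tt gtr0_norm.
Qed.

(** In the critical case let n + 1 be the least order of a z-derivative not vanishing identically
    along the curve. After k blow-ups that derivative is x^k times a unit, while the one of order n
    still vanishes on the curve. Dividing the latter by powers of x gives a function with nonzero
    z-derivative and the curve among its zeros, which is impossible. *)
Lemma chart_dichotomy K (r : R) (G : 'rV[R]_2 -> R) : 0 < r -> DC2 r G ->
  exists n r', [/\ 0 < r', r' <= 1, (forall q, B r' q -> B r (blows K n q)) &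
    (forall q, B r' q -> 0 < q 0 0 -> G (blows K n q) = 0) \/
    exists U, pulled K n r G r' U /\ U 0 != 0].
Proof.
move=> r0 hG.
have [eta [eta0 eta1 hb]] := curve_small hrho K r0.
case: (unit_or_flat r0 hG eta0 eta1 hb) => [[n [r' [U [hp U0]]]]|flat].
  have [r'0 r'1 _ hb' _] := hp.
  by exists n, r'; split=> //; right; exists U.
have hline n : DC2 r (line_ders e1 n G).
  by elim: n => [//|n IH]; exact: (DC_derive hrho 1 IH).
case: (pselect (forall n t, 0 <= t < eta -> line_ders e1 n G (lift_curve K t) = 0)) => [all|nall].
  (* The bound eta^2 ensures that every vertical line with 0 < x < r' meets the curve at t = sqrt x
     < eta. *)
  pose r' := Num.min (Num.min r 1) (eta ^+ 2).
  have r'0 : 0 < r' by rewrite !lt_min r0 ltr01 exprn_gt0.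
  have r'r : r' <= r by rewrite !ge_min lexx.
  have r'e : r' <= eta ^+ 2 by rewrite !ge_min lexx !orbT.
  exists 0%N, r'; split=> //; [by rewrite !ge_min lexx !orbT|by move=> q; exact: le_ball|left].
  move=> q + q00; rewrite -{1}(ptE q) => /(pt_ball _ _ r'0)[q0 q1] /=.
  pose t := Num.sqrt (q 0 0).
  have tt : t ^+ 2 = q 0 0 by rewrite sqr_sqrtr// ltW.
  have t0 : 0 <= t by exact: sqrtr_ge0.
  have te : t < eta.
    rewrite -(ltr_pXn2r (n := 2)) ?nnegrE ?(ltW eta0)// tt.
    by apply: lt_le_trans r'e; rewrite -[X in X < _]gtr0_norm.
  have bt : B r (lift_curve K t) by apply: hb; rewrite ger0_norm.
  have [_ zs] := (pt_ball _ _ r0).1 bt.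
  have tr : `|t ^+ 2| < r by rewrite tt (lt_le_trans q0).
  rewrite -(ptE q) -tt.
  apply: (DC_vertical_eq0 hrho r0 hG tr zs) => [n|].
    by apply: all; rewrite t0.
  exact: lt_le_trans q1 r'r.
have exn : exists n, `[< ~ forall t, 0 <= t < eta -> line_ders e1 n G (lift_curve K t) = 0 >].
  by move/existsNP: nall => [n hn]; exists n; apply/asboolP.
case: (ex_minnP exn) => n /asboolP hn hmin.
case: n hn hmin => [|n] hn hmin; first by exfalso; apply: hn => t ht; exact: flat.
pose F := line_ders e1 n G.
have F0 t : 0 <= t < eta -> F (lift_curve K t) = 0.
  move=> ht; apply/eqP; apply: contraT => /eqP nz.
  have : (n.+1 <= n)%N by apply: hmin; apply/asboolP => h; apply: nz; exact: h.
  by rewrite ltnn.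
case: (unit_or_flat r0 (hline n.+1) eta0 eta1 hb) => [[k [r' [U [hp U0]]]]|//].
have [r'0 r'1 hU hb' hE] := hp.
have [s [s0 sr' hPhi hD]] := DC2_blows hp r0 (hline n).
have hUs : DC2 s U by apply: DC_subset hU; exact: le_ball.
(* One x^k comes from the chain rule, the other from the factorisation of the pulled-back
   derivative. *)
have hD' q : B s q -> 'D_e1 (fun q => F (blows K k q)) q = q 0 0 ^+ (k + k) * U q.
  move=> bq; rewrite hD// exprD -mulrA; congr (_ * _).
  by apply: hE; apply: le_ball bq.
have hz t : 0 < t < eta -> F (blows K k (lift_curve (K + k) t)) = 0.
  by move=> /andP[/ltW t0 te]; rewrite blows_curve F0// t0.
have [H [hH HD H0 [eta' eta'0 hz']]] := divide_power s0 hPhi hUs eta0 hD' hz.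
exfalso; apply: (no_implicit_root s0 hH H0 _ eta'0 hz').
by rewrite HD//; exact: ballxx.
Qed.

End Dichotomy.

(** * The gauge log log *)

Section LogLog.
Context {R : realType}.

Definition loglog (n : nat) : R := ln (ln (n + 3)%:R).

(** From exp (-1/6) >= 5/6 follows e <= (6/5)^6 < 2.99. The same estimate with 5 in place of 6 gives
    (5/4)^5 > 3. The inequality makes log log 3 positive. *)
Lemma expR1_lt3 : expR 1 < 3 :> R.
Proof.
have h : expR (6^-1) <= 6 / 5 :> R.
  rewrite -[X in expR X]opprK expRN -[6 / 5]invf_div lef_pV2 ?posrE ?expR_gt0 ?divr_gt0//.
  by have := @expR_ge1Dx R (- 6^-1); lra.
have -> : expR 1 = expR (6^-1) ^+ 6 :> R by rewrite -expRM_natl mulfV.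
apply: (@le_lt_trans _ _ ((6 / 5) ^+ 6)); first by rewrite lerXn2r// nnegrE ?expR_ge0// divr_ge0.
by rewrite !exprS expr0; lra.
Qed.

Lemma ln_gt1 n : 1 < ln (n + 3)%:R :> R.
Proof.
have n0 : (0 : R) < (n + 3)%:R by rewrite ltr0n addn_gt0 orbT.
rewrite -[ltLHS](@expRK R) ltr_ln ?posrE ?expR_gt0// (lt_le_trans expR1_lt3)//.
by rewrite ler_nat leq_addl.
Qed.

Lemma ln_sub_le (a b : R) : 0 < a -> 0 < b -> ln a - ln b <= (a - b) / b.
Proof.
move=> a0 b0; rewrite -ln_div ?posrE//.
have -> : a / b = 1 + (a - b) / b by rewrite mulrBl mulfV ?gt_eqF// addrC subrK.
apply: le_ln1Dx; rewrite mulrBl mulfV ?gt_eqF// ltrBrDr addNr.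
exact: divr_gt0.
Qed.

(** For the last condition, the increment of log log is at most 1 / ((n+3) log (n+3)), and log log
    (n+4) <= log (n+3); the product is at most (n+1)/(n+3). *)
Lemma loglog_gauge : gauge loglog.
Proof.
have n0 n : (0 : R) < (n + 3)%:R by rewrite ltr0n addn_gt0 orbT.
have l0 n : 0 < ln (n + 3)%:R :> R by exact: lt_trans (ln_gt1 n).
have le_ln n : ln (n + 3)%:R <= ln (n.+1 + 3)%:R :> R by rewrite ler_ln ?posrE// ler_nat.
split.
- by rewrite -[ltLHS](@ln1 R) ltr_ln ?posrE// ln_gt1.
- by move=> n; rewrite ler_ln ?posrE//.
- move=> A; pose y := expR (expR A).
  exists (Num.truncn y).+1; rewrite /loglog -[A](@expRK R) ler_ln ?posrE ?expR_gt0//.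
  rewrite -[expR A](@expRK R) ler_ln ?posrE ?expR_gt0//.
  apply: (le_trans (ltW (truncnS_gt y))); rewrite ler_nat; exact: leq_addr.
move=> n; set a := ln (n.+1 + 3)%:R : R; set b := ln (n + 3)%:R : R.
have ab : a - b <= ((n + 3)%:R)^-1.
  apply: (le_trans (ln_sub_le (n0 _) (n0 _))).
  by rewrite addSn -natrB// subSnn mul1r.
have d1 : loglog n.+1 - loglog n <= ((n + 3)%:R)^-1 / b.
  apply: (le_trans (ln_sub_le (l0 _) (l0 _))).
  by rewrite ler_wpM2r// invr_ge0 ltW.
have lb : loglog n.+1 <= b.
  have h3 : ((n + 3)%:R)^-1 <= 1 :> R by rewrite invf_le1// ler1n addn_gt0 orbT.
  have := ln_sub_le (l0 n.+1) ltr01; rewrite ln1 subr0 divr1 -/(loglog _) -/a; lra.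
have p0 : 0 <= loglog n.+1 by rewrite ln_ge0// ltW// ln_gt1.
apply: (@le_trans _ _ (n.+1%:R * b * (((n + 3)%:R)^-1 / b))).
  apply: ler_pM => //.
  - by rewrite mulr_ge0.
  - by rewrite subr_ge0 ler_ln ?posrE//; exact: le_ln.
  - by rewrite ler_wpM2l.
have b0 : b != 0 by rewrite gt_eqF// l0.
rewrite [leLHS](_ : _ = n.+1%:R / (n + 3)%:R); last by field; rewrite b0 gt_eqF.
by rewrite ler_pdivrMr// mul1r ler_nat addnS ltnS leq_addr.
Qed.

Lemma loglog_seqE n : loglog_seq R n = (loglog 0 ^+ 3)^-1 * loglog n ^+ (n + 3).
Proof. by []. Qed.

Lemma loglog_seq_ge n : loglog n ^+ n <= loglog_seq R n.
Proof.
have h0 := gauge_gt0 loglog_gauge.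
rewrite loglog_seqE exprD mulrC -mulrA ler_peMr ?exprn_ge0 ?(ltW (h0 n))//.
rewrite -[X in X / _]/(loglog n ^+ 3) ler_pdivlMr ?exprn_gt0// mul1r.
by rewrite lerXn2r ?nnegrE ?(ltW (h0 _))// (gauge_le loglog_gauge).
Qed.

Lemma loglog_seq_le : exists A B, [/\ 0 < A, 0 < B & forall n, loglog_seq R n <= A * (B * loglog n) ^+ n].
Proof.
have h0 := gauge_gt0 loglog_gauge.
have hc := gauge_le2X loglog_gauge.
set c := _ + _ in hc; have c0 : 0 < c by rewrite addr_gt0 ?invr_gt0.
(* The three surplus factors of rho are at most (c 2^n)^3, whence the ratio 8. *)
exists ((loglog 0 ^+ 3)^-1 * c ^+ 3), 8; split=> //.
  by rewrite mulr_gt0 ?exprn_gt0// invr_gt0 exprn_gt0.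
move=> n; rewrite loglog_seqE -mulrA ler_wpM2l ?invr_ge0 ?exprn_ge0 ?(ltW (h0 _))//.
rewrite (exprD _ n 3) (exprMn n 8) [leRHS]mulrA [leRHS]mulrC; apply: ler_wpM2l; first by rewrite exprn_ge0// ltW.
apply: (@le_trans _ _ ((c * 2 ^+ n) ^+ 3)).
  by rewrite lerXn2r ?nnegrE ?(ltW (h0 _))// mulr_ge0// ltW.
rewrite exprMn ler_wpM2l ?exprn_ge0 ?(ltW c0)// -exprM mulnC exprM.
by rewrite [X in X ^+ n <= _](_ : _ = 8)// !exprS expr0; ring.
Qed.

End LogLog.

(** * Terms and quantifier-free formulas in a chart *)

Section Tame.
Context {R : realType}.
Variable rho : nat -> R.
Hypothesis hrho : gauge rho.

Local Notation B r := (ball (0 : 'rV[R]_2) r).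
Local Notation DC2 r := (DC rho (@coord_dir R 2) (ball (0 : 'rV[R]_2) r)).
Local Notation blows := (blows hrho).
Local Notation blow := (blow hrho).
Local Notation chart := (chart hrho).

(** Stability under shrinking the ball and passing to the next chart; finitely many properties, each
    known in a chart of its own, can then be brought into a common one. *)
Definition persistent (P : nat -> R -> Prop) :=
  (forall K (d d' : R), 0 < d' -> d' <= d -> P K d -> P K d') /\
  (forall K (d d' : R), 0 < d' -> d' <= 1 -> (forall q, B d' q -> B d (blow K q)) ->
     P K d -> P K.+1 d').

Definition eventually_chart (P : nat -> R -> Prop) := exists K d, [/\ 0 < d, d <= 1 & P K d].

Lemma persistent_all m (P : 'I_m -> nat -> R -> Prop) : (forall i, persistent (P i)) ->
  persistent (fun K d => forall i, P i K d).
Proof.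
move=> h; split=> K d d' d'0 h1.
  by move=> hP i; exact: (h i).1 (hP i).
by move=> hb hP i; exact: (h i).2 hb (hP i).
Qed.

Lemma persistent_lift P K n (d : R) : persistent P -> 0 < d -> d <= 1 -> P K d ->
  exists d', [/\ 0 < d', d' <= 1 & P (K + n)%N d'].
Proof.
move=> [_ hP] d0 d1 h; elim: n => [|n [d' [d'0 d'1 IH]]]; first by exists d; rewrite addn0.
have [s [s0 _ s1 hb]] := blow_small hrho (K + n) d'0.
by exists s; split=> //; rewrite addnS; exact: hP hb IH.
Qed.

Lemma eventually_and P Q : persistent P -> persistent Q -> eventually_chart P -> eventually_chart Q ->
  eventually_chart (fun K d => P K d /\ Q K d).
Proof.
move=> hP hQ [K [d [d0 d1 p]]] [K' [d' [d'0 d'1 q]]].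
have [s [s0 s1 p']] := persistent_lift K' hP d0 d1 p.
have [s' [s'0 s'1 q']] := persistent_lift K hQ d'0 d'1 q.
exists (K + K')%N, (Num.min s s'); have m0 : 0 < Num.min s s' by rewrite lt_min s0.
split=> //; first by rewrite ge_min s1.
split; [apply: hP.1 p' => //|rewrite addnC; apply: hQ.1 q' => //].
  by rewrite ge_min lexx.
by rewrite ge_min lexx orbT.
Qed.

Lemma eventually_all m (P : 'I_m -> nat -> R -> Prop) : (forall i, persistent (P i)) ->
  (forall i, eventually_chart (P i)) -> eventually_chart (fun K d => forall i, P i K d).
Proof.
move=> hP h.
suff H (s : seq 'I_m) : eventually_chart (fun K d => forall i, i \in s -> P i K d).
  have [K [d [d0 d1 H']]] := H (enum 'I_m); exists K, d; split=> // i.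
  by apply: H'; rewrite mem_enum.
elim: s => [|i s IH]; first by exists 0%N, 1.
have pers : persistent (fun K d => forall i, i \in s -> P i K d).
  split=> K d d' d'0 h1; first by move=> hs j js; apply: (hP j).1 (hs j js).
  by move=> hb hs j js; apply: (hP j).2 hb (hs j js).
have [K [d [d0 d1 [p q]]]] := eventually_and (hP i) pers (h i) IH.
exists K, d; split=> // j; rewrite inE => /orP[/eqP ->//|]; exact: q.
Qed.

Definition on_chart (Pr : R -> R -> Prop) K (d : R) :=
  forall q, B d q -> 0 < q 0 0 -> Pr (q 0 0) (chart K q).

Lemma on_chart_persistent Pr : persistent (on_chart Pr).
Proof.
split=> K d d' d'0 h1.
  by move=> h q bq; apply: h; exact: le_ball bq.
move=> hb h q bq q0.
by have := h _ (hb _ bq); rewrite chart_blow /blow pt0; exact.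
Qed.

Lemma on_chart_blows Pr K n (d d' : R) : (forall q, B d' q -> B d (blows K n q)) ->
  on_chart Pr K d -> on_chart Pr (K + n) d'.
Proof.
move=> hb h q bq q0.
by have := h _ (hb _ bq); rewrite chart_blows blows0; exact.
Qed.

(** The negative power, which accommodates the reciprocal, is kept apart so that [G] stays in the
    class across x = 0 and can be blown up further. *)
Definition tame_at (T : R -> R -> R) K (d : R) := exists l (G : 'rV[R]_2 -> R),
  DC2 d G /\ forall q, B d q -> 0 < q 0 0 -> T (q 0 0) (chart K q) = q 0 0 ^- l * G q.

Definition tame T := eventually_chart (tame_at T).

Lemma tame_at_persistent T : persistent (tame_at T).
Proof.
split=> K d d' d'0 h1.
  move=> [l [G [hG E]]]; exists l, G; split; first by apply: DC_subset hG; exact: le_ball.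
  by move=> q bq; apply: E; exact: le_ball bq.
move=> hb [l [G [hG E]]]; exists l, (fun q : 'rV[R]_2 => G (blow K q)); split.
  exact: (DC2_blow hG d'0 h1 hb).
move=> q bq q0; have := E _ (hb _ bq); rewrite chart_blow /blow pt0; exact.
Qed.

Lemma tame_DC K (d : R) T (G : 'rV[R]_2 -> R) : 0 < d -> d <= 1 -> DC2 d G ->
  (forall q, B d q -> 0 < q 0 0 -> T (q 0 0) (chart K q) = G q) -> tame T.
Proof.
move=> d0 d1 hG E; exists K, d; split=> //; exists 0%N, G; split=> // q bq q0.
by rewrite E// expr0 invr1 mul1r.
Qed.

Lemma tame_cst c : tame (fun _ _ => c).
Proof. by apply: (@tame_DC 0 1 _ (fun=> c)) => //; exact: DC_cst. Qed.

Lemma tame_fst : tame (fun x _ => x).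
Proof. by apply: (@tame_DC 0 1 _ (fun q : 'rV[R]_2 => q 0 0)) => //; exact: DC2_coord. Qed.

Lemma tame_snd : tame (fun _ y => y).
Proof.
apply: (@tame_DC 0 1 _ (fun q : 'rV[R]_2 => fser hrho 0 0 0 + q 0 1)) => //.
  by apply: DC_add => //; [exact: oB|exact: DC_cst|exact: DC2_coord].
by move=> q _ _; rewrite /chart big_nat1 !expr0 mulr1 mul1r.
Qed.

Lemma DC2_monomial (d : R) n : 0 < d -> d <= 1 -> DC2 d (fun q : 'rV[R]_2 => q 0 0 ^+ n).
Proof. by move=> d0 d1; exact: (DC_exp hrho n (@oB R d) (DC2_coord hrho 0 d0 d1)). Qed.

Lemma tame_mul T S : tame T -> tame S -> tame (fun x y => T x y * S x y).
Proof.
move=> hT hS.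
have [K [d [d0 d1 [[l [G [hG E]]] [l' [G' [hG' E']]]]]]] :=
  eventually_and (tame_at_persistent T) (tame_at_persistent S) hT hS.
exists K, d; split=> //; exists (l + l')%N, (fun q : 'rV[R]_2 => G q * G' q); split.
  by apply: DC_mul => //; exact: oB.
by move=> q bq q0; rewrite E// E'// exprD invfM; ring.
Qed.

Lemma tame_add T S : tame T -> tame S -> tame (fun x y => T x y + S x y).
Proof.
move=> hT hS.
have [K [d [d0 d1 [[l [G [hG E]]] [l' [G' [hG' E']]]]]]] :=
  eventually_and (tame_at_persistent T) (tame_at_persistent S) hT hS.
exists K, d; split=> //.
exists (l + l')%N, (fun q : 'rV[R]_2 => q 0 0 ^+ l' * G q + q 0 0 ^+ l * G' q); split.
  by apply: DC_add => //; [exact: oB| |]; apply: DC_mul => //; solve [exact: oB|exact: DC2_monomial].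
move=> q bq q0; rewrite E// E'// exprD.
have xl : q 0 0 ^+ l != 0 by rewrite expf_neq0// gt_eqF.
have xl' : q 0 0 ^+ l' != 0 by rewrite expf_neq0// gt_eqF.
by field; rewrite xl xl'.
Qed.

Lemma tame_opp T : tame T -> tame (fun x y => - T x y).
Proof.
move=> /(tame_mul (tame_cst (-1))).
by under eq_fun do under eq_fun do rewrite mulN1r.
Qed.

Lemma sign_near (r : R) (U : 'rV[R]_2 -> R) : 0 < r -> DC2 r U -> U 0 != 0 ->
  exists (s : bool) c r', [/\ 0 < c, 0 < r', r' <= r & forall q, B r' q -> c < (-1) ^+ s * U q].
Proof.
move=> r0 hU U0; pose s := (U 0 < 0); pose c := `|U 0| / 2.
have c0 : 0 < c by rewrite divr_gt0// normr_gt0.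
have cU : {for (0 : 'rV[R]_2), continuous U} by apply: DC_continuous hU _; exact: ballxx.
have /cvgrPdist_lt/(_ c c0)/nbhs_ballP[r' /= r'0 hr'] := cU.
exists s, c, (Num.min r r'); split=> //; [by rewrite lt_min r0|by rewrite ge_min lexx|].
move=> q bq; have : `|U 0 - U q| < c by apply: hr'; apply: le_ball bq; rewrite ge_min lexx orbT.
rewrite ltr_norml => /andP[h1 h2]; rewrite /s.
have [neg|pos] := ltP (U 0) 0.
  by rewrite expr1 mulN1r; move: h1; rewrite /c ltr0_norm//; lra.
by rewrite expr0 mul1r; move: h2; rewrite /c ger0_norm//; lra.
Qed.

Definition unit_form T K (d : R) := exists l p (U : 'rV[R]_2 -> R) (s : bool) c,
  [/\ DC2 d U, 0 < c, (forall q, B d q -> c < (-1) ^+ s * U q) &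
    forall q, B d q -> 0 < q 0 0 -> T (q 0 0) (chart K q) = q 0 0 ^- l * (q 0 0 ^+ p * U q)].

Lemma tame_normal K (d : R) T : 0 < d -> tame_at T K d ->
  exists n d', [/\ 0 < d', d' <= 1, (forall q, B d' q -> B d (blows K n q)) &
    on_chart (fun x y => T x y = 0) (K + n) d' \/ unit_form T (K + n) d'].
Proof.
move=> d0 [l [G [hG E]]].
have [n [r [r0 r1 hb [Z|[U [[_ _ hU _ EU] U0]]]]]] := chart_dichotomy hrho K d0 hG.
  exists n, r; split=> //; left=> q bq q0.
  by have := E _ (hb _ bq); rewrite chart_blows blows0 Z// mulr0; exact.
have [s [c [r' [c0 r'0 r'r hs]]]] := sign_near r0 hU U0.
have bb q : B r' q -> B r q by exact: le_ball.
exists n, r'; split=> //; [exact: le_trans r1|by move=> q /bb/hb|right].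
exists l, n, U, s, c; split=> //; first exact: DC_subset hU.
move=> q /bb bq q0; have := E _ (hb _ bq); rewrite chart_blows blows0 EU//; exact.
Qed.

Lemma tame_sign T : tame T -> [\/ eventually_chart (on_chart (fun x y => T x y = 0)),
  eventually_chart (on_chart (fun x y => 0 < T x y)) | eventually_chart (on_chart (fun x y => T x y < 0))].
Proof.
move=> [K [d [d0 d1 /(tame_normal d0)[n [r [r0 r1 _ [Z|]]]]]]].
  by apply: Or31; exists (K + n)%N, r.
move=> [l [p [U [s [c [_ c0 hs E]]]]]].
have pos q : 0 < q 0 0 -> 0 < q 0 0 ^- l * q 0 0 ^+ p :> R.
  by move=> q0; rewrite mulr_gt0// ?invr_gt0 exprn_gt0.
case: s hs => hs; [apply: Or33|apply: Or32]; exists (K + n)%N, r; split=> // q bq q0; rewrite E// mulrA.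
  by rewrite nmulr_llt0 ?pos//; have := hs _ bq; rewrite expr1 mulN1r; lra.
by rewrite mulr_gt0 ?pos//; have := hs _ bq; rewrite expr0 mul1r; lra.
Qed.

Lemma tame_inv T : tame T -> tame (fun x y => (T x y)^-1).
Proof.
move=> [K [d [d0 d1 /(tame_normal d0)[n [r [r0 r1 _ [Z|]]]]]]].
  apply: (@tame_DC (K + n) r _ (fun=> 0)) => //; first exact: DC_cst.
  by move=> q bq q0; rewrite Z// invr0.
move=> [l [p [U [s [c [hU c0 hs E]]]]]].
exists (K + n)%N, r; split=> //; exists p, (fun q : 'rV[R]_2 => q 0 0 ^+ l * (U q)^-1); split.
  apply: DC_mul => //; [exact: oB|exact: DC2_monomial|].
  apply: (@DC_inv _ _ hrho _ _ _ _ _ c (@oB R r) c0 _ hU) => q bq.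
  apply: (lt_le_trans (hs _ bq)); apply: (le_trans (ler_norm _)).
  by rewrite normrM normrX normrN1 expr1n mul1r.
by move=> q bq q0; rewrite E// !invfM invrK mulrCA.
Qed.

(** Only a function without negative powers can be substituted into a function of the class. In the
    normal form x^-l x^p U, boundedness forces l <= p because U stays away from 0. *)
Lemma tame_bounded T : tame T -> eventually_chart (on_chart (fun x y => `|T x y| <= 1)) ->
  eventually_chart (fun K d => exists G, DC2 d G /\
    forall q, B d q -> 0 < q 0 0 -> T (q 0 0) (chart K q) = G q).
Proof.
move=> hT hB.
have [K [d [d0 d1 [ht hb]]]] := eventually_and (tame_at_persistent T) (on_chart_persistent _) hT hB.
have [n [r [r0 r1 hbl [Z|]]]] := tame_normal d0 ht.
  by exists (K + n)%N, r; split=> //; exists (fun=> 0); split=> //; exact: DC_cst.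
have {}hb := on_chart_blows hbl hb.
move=> [l [p [U [s [c [hU c0 hs E]]]]]].
have [lp|pl] := leqP l p.
  exists (K + n)%N, r; split=> //; exists (fun q : 'rV[R]_2 => q 0 0 ^+ (p - l) * U q); split.
    by apply: DC_mul => //; [exact: oB|exact: DC2_monomial].
  move=> q bq q0; rewrite E// mulrA -{1}(subnKC lp) exprD mulrA mulVf ?mul1r//.
  by rewrite expf_neq0// gt_eqF.
(* If l > p, then |T| <= 1 on the line z = 0 gives |U| <= x, against x < c < |U|. *)
exfalso; pose x := Num.min r c / 2.
have m0 : 0 < Num.min r c by rewrite lt_min r0.
have x0 : 0 < x by rewrite divr_gt0.
have xm : x < Num.min r c by rewrite /x; lra.
have xr : x < r by rewrite (lt_le_trans xm)// ge_min lexx.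
have xc : x < c by rewrite (lt_le_trans xm)// ge_min lexx orbT.
have bq : B r (pt x 0) by apply/pt_ball => //; rewrite normr0 gtr0_norm.
have := hb _ bq; rewrite E ?pt0// => /(_ x0).
have cU : c < `|U (pt x 0)|.
  apply: (lt_le_trans (hs _ bq)); apply: (le_trans (ler_norm _)).
  by rewrite normrM normrX normrN1 expr1n mul1r.
have xl0 : 0 < x ^+ l by rewrite exprn_gt0.
have xl : x ^+ l <= x ^+ p * x.
  by rewrite -exprSr ler_wiXn2l// ltW// (lt_le_trans xr).
rewrite normrM normfV (gtr0_norm xl0) ler_pdivrMl// mulr1 normrM gtr0_norm ?exprn_gt0//.
move=> /le_trans/(_ xl); rewrite ler_pM2l ?exprn_gt0// => h.
by have := lt_le_trans cU h; rewrite ltNge (ltW xc).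
Qed.

End Tame.

Section QuantifierFree.
Context {R : realType}.
Variables (rho M : nat -> R).
Hypothesis hrho : gauge rho.
Hypothesis hM : exists A B, [/\ 0 < A, 0 < B & forall n, M n <= A * (B * rho n) ^+ n].

Local Notation B r := (ball (0 : 'rV[R]_2) r).
Local Notation DC2 r := (DC rho (@coord_dir R 2) (ball (0 : 'rV[R]_2) r)).
Local Notation tame := (tame hrho).
Local Notation chart := (chart hrho).
Local Notation on_chart := (on_chart hrho).

(** The signs of T j + 1 and T j - 1 become constant. Either some argument stays outside [-1, 1] and
    the value is 0, or all stay inside, have no negative powers, and composition applies. *)
Lemma tame_restricted m (g : 'rV[R]_m -> R) (T : 'I_m -> R -> R -> R) : restricted_QM M g ->
  (forall j, tame (T j)) -> tame (fun x y => g (\row_j T j x y)).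
Proof.
move=> [U [h [oU cubeU hh gE g0]]] hT.
have out : (exists j, eventually_chart (on_chart (fun x y => ~~ (-1 <= T j x y <= 1)))) \/
    forall j, eventually_chart (on_chart (fun x y => -1 <= T j x y <= 1)).
  have [e|ne] := pselect (exists j, eventually_chart (on_chart (fun x y => ~~ (-1 <= T j x y <= 1)))).
    by left.
  right=> j.
  have cmp c : tame (fun x y => T j x y + c) by exact: tame_add (hT j) (tame_cst hrho c).
  have lo : eventually_chart (on_chart (fun x y => -1 <= T j x y)).
    have [[K [d [d0 d1 Z]]]|[K [d [d0 d1 Z]]]|[K [d [d0 d1 Z]]]] := tame_sign (cmp 1).
    - by exists K, d; split=> // q bq q0; have := Z q bq q0; lra.
    - by exists K, d; split=> // q bq q0; have := Z q bq q0; lra.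
    - exfalso; apply: ne; exists j; exists K, d; split=> // q bq q0.
      by rewrite negb_and -ltNge; apply/orP; left; have := Z q bq q0; lra.
  have hi : eventually_chart (on_chart (fun x y => T j x y <= 1)).
    have [[K [d [d0 d1 Z]]]|[K [d [d0 d1 Z]]]|[K [d [d0 d1 Z]]]] := tame_sign (cmp (-1)).
    - by exists K, d; split=> // q bq q0; have := Z q bq q0; lra.
    - exfalso; apply: ne; exists j; exists K, d; split=> // q bq q0.
      by rewrite negb_and -!ltNge; apply/orP; right; have := Z q bq q0; lra.
    - by exists K, d; split=> // q bq q0; have := Z q bq q0; lra.
  have [K [d [d0 d1 [p q]]]] :=
    eventually_and (on_chart_persistent hrho _) (on_chart_persistent hrho _) lo hi.
  by exists K, d; split=> // v bv v0; rewrite p// q.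
case: out => [[j [K [d [d0 d1 Z]]]]|inside].
  apply: (@tame_DC _ _ hrho K d _ (fun=> 0)) => //; first exact: DC_cst.
  move=> q bq q0; apply: g0 => /(_ j); rewrite mxE => h1.
  by have := Z q bq q0; rewrite h1.
pose P j K (d : R) := exists G, DC2 d G /\
    forall q, B d q -> 0 < q 0 0 -> T j (q 0 0) (chart K q) = G q.
have pP j : persistent hrho (P j).
  split=> K d d' d'0 h1.
    move=> [G [hG E]]; exists G; split; first by apply: DC_subset hG; exact: le_ball.
    by move=> q bq; apply: E; exact: le_ball bq.
  move=> hb [G [hG E]]; exists (fun q => G (blow hrho K q)); split.
    exact: (DC2_blow hG d'0 h1 hb).
  by move=> q bq q0; have := E _ (hb _ bq); rewrite chart_blow /blow pt0; exact.
have evP j : eventually_chart (P j).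
  apply: tame_bounded (hT j) _; have [K [d [d0 d1 Z]]] := inside j.
  by exists K, d; split=> // q bq q0; rewrite ler_norml; exact: Z.
have [K [d [d0 d1 [h1 h2]]]] := eventually_and (persistent_all pP)
  (persistent_all (fun j => on_chart_persistent hrho _)) (eventually_all pP evP)
  (eventually_all (fun j => on_chart_persistent hrho _) inside).
have /choice[G hG] : forall j, exists G, DC2 d G /\
    forall q, B d q -> 0 < q 0 0 -> T j (q 0 0) (chart K q) = G q by exact: h1.
(* A limit of points of the closed cube as x tends to 0 from the right, hence in the cube, around
   which [h] is in the class. *)
pose a : 'rV[R]_m := \row_j G j 0.
have contG j : {for (0 : 'rV[R]_2), continuous (G j)}.
  by apply: DC_continuous (hG j).1 _; exact: ballxx.
have acube : cube a.
  move=> j; rewrite mxE.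
  have cp : {for (0 : R), continuous (fun x : R => pt x 0)}.
    by apply: continuous_pt; [exact: cvg_id|exact: cvg_cst].
  have cg : {for pt 0 0, continuous (G j)} by rewrite pt00; exact: contG.
  have c1 : G j (pt x 0) @[x --> 0^'+] --> G j 0.
    have := cvg_comp _ _ cp cg; rewrite pt00 => c.
    exact: cvg_at_right_filter c.
  have bnd : \forall x \near 0^'+, -1 <= G j (pt x 0) <= 1.
    near=> x.
    have x0 : 0 < x by near: x; exact: nbhs_right_gt.
    have xd : x < d by near: x; exact: nbhs_right_lt.
    have bq : B d (pt x 0) by apply/pt_ball => //; rewrite normr0 gtr0_norm.
    have := h2 j _ bq; rewrite pt0 => /(_ x0).
    by have := (hG j).2 _ bq; rewrite pt0 => ->.
  apply/andP; split.
    rewrite -(cvg_lim (@Rhausdorff R) c1); apply: limr_ge; first by apply/cvg_ex; exists (G j 0).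
    by apply: filterS bnd => x /andP[].
  rewrite -(cvg_lim (@Rhausdorff R) c1); apply: limr_le; first by apply/cvg_ex; exists (G j 0).
  by apply: filterS bnd => x /andP[].
have [r [r0 rU hD]] := QM_DC hrho hM oU hh (cubeU _ acube).
have [d' [d'0 d'd hb]] : exists d', [/\ 0 < d', d' <= d & forall q, B d' q -> ball a r (\row_j G j q)].
  have : \forall q \near (0 : 'rV[R]_2), forall j, `|G j 0 - G j q| < r.
    near=> q; near: q.
    apply: filter_forall => j; have /cvgrPdist_lt/(_ r r0) := contG j; exact.
  move=> /nbhs_ballP[s /= s0 hs]; exists (Num.min d s); split.
  - by rewrite lt_min d0.
  - by rewrite ge_min lexx.
  move=> q bq; apply/rV_ballP => // j; rewrite !mxE.
  by apply: hs; apply: le_ball bq; rewrite ge_min lexx orbT.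
apply: (@tame_DC _ _ hrho K d' _ (fun q => h (\row_j G j q))) => //; first exact: le_trans d1.
  apply: (@DC_comp _ _ hrho _ _ (@coord_dir R 2) (B d') m (ball a r) h G) => //; try exact: ball_open.
  by move=> j; apply: DC_subset (hG j).1; exact: le_ball.
move=> q bq q0; have bq' : B d q by exact: le_ball bq.
rewrite gE; last by move=> j; rewrite mxE; exact: h2.
by congr h; apply/rowP => j; rewrite !mxE (hG j).2.
Unshelve. all: by end_near. Qed.

Lemma tame_term n (t : term (LQM_inv M) n) (E : 'I_n -> R -> R -> R) : (forall i, tame (E i)) ->
  tame (fun x y => @Defs.eval _ (R_QM_inv M) _ (fun i => E i x y) t).
Proof.
move=> hE; elim: t => [i|m s ts IH] /=; first exact: hE.
case: s ts IH => [k [s|g hg]|] ts IH /=.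
- case: s ts IH => ts IH /=.
  + exact: tame_cst.
  + exact: tame_cst.
  + exact: tame_opp.
  + exact: tame_add.
  + exact: tame_mul.
- exact: (tame_restricted hg IH).
- exact: tame_inv.
Qed.

Lemma qf_constant n (phi : formula (LQM_inv M) n) (E : 'I_n -> R -> R -> R) :
  quantifier_free phi -> (forall i, tame (E i)) ->
  eventually_chart (on_chart (fun x y => @Defs.holds _ (R_QM_inv M) _ phi (fun i => E i x y))) \/
  eventually_chart (on_chart (fun x y => ~ @Defs.holds _ (R_QM_inv M) _ phi (fun i => E i x y))).
Proof.
have and_ev Pr Qr (Sr : R -> R -> Prop) : (forall x y, Pr x y -> Qr x y -> Sr x y) ->
    eventually_chart (on_chart Pr) -> eventually_chart (on_chart Qr) -> eventually_chart (on_chart Sr).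
  move=> h hP hQ; have [K [d [d0 d1 [p q]]]] :=
    eventually_and (on_chart_persistent hrho _) (on_chart_persistent hrho _) hP hQ.
  by exists K, d; split=> // v bv v0; apply: h; [exact: p|exact: q].
have mono Pr (Sr : R -> R -> Prop) : (forall x y, Pr x y -> Sr x y) ->
    eventually_chart (on_chart Pr) -> eventually_chart (on_chart Sr).
  by move=> h hP; apply: (and_ev _ _ _ _ hP hP) => x y p _; exact: h.
have sgn n' (t u : term (LQM_inv M) n') (E' : 'I_n' -> R -> R -> R) : (forall i, tame (E' i)) ->
    tame (fun x y => @Defs.eval _ (R_QM_inv M) _ (fun i => E' i x y) t +
                     - @Defs.eval _ (R_QM_inv M) _ (fun i => E' i x y) u).
  by move=> hE'; apply: tame_add; [exact: tame_term|apply: tame_opp; exact: tame_term].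
elim: phi E => [{}n t u|{}n m r ts|{}n phi IH|{}n phi IHp psi IHq|{}n phi IHp psi IHq|//|//] E /=.
- move=> _ hE; have [h|h|h] := tame_sign (sgn _ t u _ hE); [left|right|right]; apply: mono h => x y.
  + by move/eqP; rewrite subr_eq0 => /eqP.
  + by rewrite subr_gt0 => h e; move: h; rewrite e ltxx.
  + by rewrite subr_lt0 => h e; move: h; rewrite e ltxx.
- case: r ts => ts _ hE /=.
  have [h|h|h] := tame_sign (sgn _ (ts ord0) (ts ord_max) _ hE); [right|right|left]; apply: mono h => x y.
  + by move/eqP; rewrite subr_eq0 => /eqP ->; rewrite ltxx.
  + by rewrite subr_gt0 => h; apply/negP; rewrite -leNgt ltW.
  + by rewrite subr_lt0.
- by move=> qf hE; have [h|h] := IH _ qf hE; [right|left]; apply: mono h => x y // p; apply.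
- move=> /andP[qp qq] hE; have [p|p] := IHp _ qp hE; last by right; apply: mono p => x y np [].
  have [q|q] := IHq _ qq hE; last by right; apply: mono q => x y np [].
  by left; apply: and_ev p q.
- move=> /andP[qp qq] hE; have [p|p] := IHp _ qp hE; first by left; apply: mono p; left.
  have [q|q] := IHq _ qq hE; first by left; apply: mono q; right.
  by right; apply: and_ev p q => x y np nq [].
Qed.

Local Notation f0 := (fser hrho 0 0).

(** A formula true throughout a chart would put two points of one vertical line on the graph; one
    false throughout would miss the lifted graph, which enters every ball about the origin with x >
    0. *)
Lemma graph_not_qf : ~ @qf_definable _ (R_QM_inv M) 2 (graph_on `[0, 1] (fun x => f0 x - f0 0)).
Proof.
move=> [k [phi [p [qf hphi]]]].
(* The charts follow the series itself, whereas the graph is that of the series minus its value at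
   0. *)
pose v (x y : R) (i : 'I_2) : R := if i == ord0 then x else y - f0 0.
pose E i x y : R := env_cat (v x y) p i.
have hE i : tame (E i).
  rewrite /E /env_cat; case: (fintype.split i) => j; last exact: tame_cst.
  rewrite /v; case: (j == ord0); first exact: tame_fst.
  exact: (tame_add (tame_snd hrho) (tame_cst hrho (- f0 0))).
have V x y : @Defs.holds _ (R_QM_inv M) _ phi (fun i => E i x y) <-> 0 <= x <= 1 /\ y = f0 x.
  rewrite -(hphi (v x y)) /graph_on /= /v /= in_itv /=.
  by split=> -[-> e]; split=> //; [exact: addIr e|rewrite e].
have curve K (d : R) : 0 < d -> exists t, [/\ 0 < t, t <= 1 & B d (lift_curve hrho K t)].
  move=> d0; have [eta [eta0 eta1 hb]] := curve_small hrho K d0.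
  by exists (eta / 2); split; [lra|lra|apply: hb; rewrite gtr0_norm; lra].
case: (qf_constant qf hE) => -[K [d [d0 d1 H]]].
  have [t [t0 t1 bt]] := curve K d d0.
  move: (bt) => /(pt_ball _ _ d0)[b0 b1].
  have t20 : 0 < t ^+ 2 by rewrite exprn_gt0.
  have val z : `|z| < d -> chart K (pt (t ^+ 2) z) = f0 (t ^+ 2).
    move=> zd; have bq : B d (pt (t ^+ 2) z) by apply/pt_ball.
    by have := H _ bq; rewrite pt0 => /(_ t20)/V[].
  have d2 : `|d / 2| < d by rewrite gtr0_norm; lra.
  have z0 : `|0 : R| < d by rewrite normr0.
  have := val _ d2; rewrite -(val _ z0) /chart !pt0 !pt1 mulr0 => /addrI/eqP.
  by rewrite mulf_eq0 expf_eq0 (gt_eqF t20) andbF /= gt_eqF// divr_gt0.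
have [t [t0 t1 bt]] := curve K d d0.
have := H _ bt; rewrite /lift_curve pt0 -/(lift_curve hrho K t) chart_curve => /(_ (exprn_gt0 _ t0)).
apply; apply/V; split; last exact: gser_sqr.
by apply/andP; split; [exact/exprn_ge0/ltW|apply: exprn_ile1 => //; exact: ltW].
Qed.

End QuantifierFree.

(** * Definability of the graph *)

Section Definability.
Context {R : realType}.
Variables (rho M : nat -> R).
Hypothesis hrho : gauge rho.
Hypothesis hM : forall n, rho n ^+ n <= M n.

Local Notation f0 := (fser hrho 0 0).

Definition args1 (L : signature) n (t : Defs.term L n) : 'I_1 -> Defs.term L n := fun=> t.

Definition args2 (L : signature) n (t u : Defs.term L n) : 'I_2 -> Defs.term L n :=
  fun j => if j == ord0 then t else u.

(* Under the quantifier the variables are t, x, y, in this order. *)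
Definition curve_formula (L : signature) (mul : Defs.fsym L 2) (one : Defs.fsym L 0) (g : Defs.fsym L 1)
    (lt : Defs.rsym L 2) n : Defs.formula L n.+2 :=
  let t := @Defs.Var L _ (ord0 : 'I_n.+3) in
  let x := @Defs.Var L _ (lift ord0 (ord0 : 'I_n.+2)) in
  let y := @Defs.Var L _ (lift ord0 (lift ord0 (ord0 : 'I_n.+1))) in
  Defs.Ex (Defs.And (Defs.Eq (Defs.App mul (args2 t t)) x)
    (Defs.And (Defs.Eq y (Defs.App g (args1 t)))
      (Defs.Not (Defs.Rel lt (args2 (Defs.App one (fun=> t)) x))))).

Let g0 : QM_fsym M 1 := SRestr (grestr_QM hrho hM (f0 0)).

(** The restricted function is 0 outside [-1, 1]; the condition x <= 1 confines t to the interval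
    where it agrees with the series. *)
Lemma curve_formula_graph (x y : R) :
  (exists t, [/\ t * t = x, y = grestr hrho (f0 0) (\row_(i < 1) t) & ~ 1 < x]) <->
  x \in `[0, 1] /\ y = f0 x - f0 0.
Proof.
have gE t : t * t <= 1 -> grestr hrho (f0 0) (\row_(i < 1) t) = f0 (t ^+ 2) - f0 0.
  move=> t1; rewrite /grestr; case: pselect => [_|]; first by rewrite mxE gser_sqr.
  case=> i; rewrite mxE -ler_norml -(@expr_le1 _ 2)// -normrX expr2 ger0_norm//.
  by rewrite -expr2 sqr_ge0.
rewrite in_itv /=; split=> [[t [<- -> /negP]]|[/andP[x0 x1] ->]].
  by rewrite -leNgt => t1; rewrite -{1}expr2 sqr_ge0 t1 gE// expr2.
exists (Num.sqrt x); rewrite -expr2 sqr_sqrtr//; split=> //; last by apply/negP; rewrite -leNgt.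
by rewrite gE -?expr2 sqr_sqrtr.
Qed.

Lemma env_cat_nil (v : 'I_2 -> R) (p : 'I_0 -> R) (i : 'I_2) : @env_cat R 2 0 v p i = v i.
Proof.
by rewrite /env_cat; case: fintype.splitP => [j e|[]//]; congr v; exact/val_inj/esym.
Qed.

Let e0 (e : 'I_2 -> R) (t : R) : env_cons t e (lift ord0 ord0) = e ord0.
Proof. by rewrite /env_cons liftK. Qed.

Let e1 (e : 'I_2 -> R) (t : R) : env_cons t e (lift ord0 (lift ord0 ord0)) = e ord_max.
Proof. by rewrite /env_cons liftK /=; congr e; exact/val_inj. Qed.

Let et (e : 'I_2 -> R) (t : R) : env_cons t e ord0 = t.
Proof. by rewrite /env_cons unlift_none. Qed.

Lemma graph_definable : @definable _ (R_QM M) 2 (graph_on `[0, 1] (fun x => f0 x - f0 0)).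
Proof.
exists 0%N, (@curve_formula (LQM M) (SRing M SMul) (SRing M SOne) g0 SLt 0), (fun=> 0) => v.
have E0 := env_cat_nil v (fun=> 0) ord0; have E1 := env_cat_nil v (fun=> 0) ord_max.
rewrite /graph_on /= -curve_formula_graph -E0 -E1.
split=> -[t]; rewrite /= ?et ?e0 ?e1.
  by case=> h1 h2 h3; exists t; rewrite /= ?et ?e0 ?e1.
by case=> h1 [h2 h3]; exists t.
Qed.

Lemma admits_QE_graph : admits_QE (R_QM_inv M) ->
  @qf_definable _ (R_QM_inv M) 2 (graph_on `[0, 1] (fun x => f0 x - f0 0)).
Proof.
move=> /(_ _ (@curve_formula (LQM_inv M) (SQM (SRing M SMul)) (SQM (SRing M SOne)) (SQM g0) SLt 0)).
move=> [psi [qf h]]; exists 0%N, psi, (fun=> 0); split=> // v; rewrite -h.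
have E0 := env_cat_nil v (fun=> 0) ord0; have E1 := env_cat_nil v (fun=> 0) ord_max.
rewrite /graph_on /= -curve_formula_graph -E0 -E1.
split=> -[t]; rewrite /= ?et ?e0 ?e1.
  by case=> h1 h2 h3; exists t; rewrite /= ?et ?e0 ?e1.
by case=> h1 [h2 h3]; exists t.
Qed.

End Definability.

Theorem mainTheorem1 (R : realType) :
  ~ admits_QE (R_QM_inv (@loglog_seq R)) /\
  exists (eps : R) (f : R -> R) (V : set ('I_2 -> R)),
    [/\ 0 < eps,
        QI (@loglog_seq R) `[0, eps] f,
        V = graph_on `[0, eps] f,
        V (fun _ => 0) &
        @definable _ (R_QM (@loglog_seq R)) 2 V /\
        ~ @qf_definable _ (R_QM_inv (@loglog_seq R)) 2 V].
Proof.
have hrho := @loglog_gauge R.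
have nqf := @graph_not_qf R _ _ hrho (@loglog_seq_le R).
split; first by move=> /(admits_QE_graph hrho (@loglog_seq_ge R)).
pose f x := fser hrho 0 0 x - fser hrho 0 0 0.
exists 1, f, (graph_on `[0, 1] f); split=> //.
- exact: (fser_QI hrho (@loglog_seq_ge R)).
- by rewrite /graph_on /= in_itv /= lexx ler01 /f subrr.
- by split=> //; exact: (graph_definable hrho (@loglog_seq_ge R)).
Qed.
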